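(* Let $\varphi$ be a linear $\mathrm{G}_2$-structure on the $7$-dimensional real vector space $\mathbb{V}$, and let $\mathbb{U}\subset\mathbb{V}$ be a non-isotropic $3$-dimensional subspace. Take any basis $U_1,U_2,U_3$ of $\mathbb{U}$, and denote $c=\varphi(U_1,U_2,U_3)\neq0$. Define $A_{ij}=g_\varphi(U_i,U_j)$, $\alpha^i=\frac12\varepsilon^{ijk}\varphi(U_j,U_k,\cdot)$, $\beta=( *\varphi)(U_1,U_2,U_3,\cdot)$, the $1$-forms $\theta^i$ by $\theta^i(U_j)=\delta^i_j$ and $\theta^i|_{\mathbb{U}^{\perp_{g_\varphi}}}=0$, and $$\omega_k=-c\,U_k\lrcorner\varphi+\frac12\varepsilon_{ijk}\alpha^{ij},\qquad \tilde\omega^k=-\frac12c\,\varepsilon^{ijk}( *\varphi)(U_i,U_j,\cdot,\cdot)+\alpha^k\wedge\beta .$$ Then there are the decompositions (defining the $3$-form $\Omega$ and the $4$-form $\bar\Omega$) $$\varphi=\frac1{c^2}\alpha^{123}-\frac1{c^2}\alpha^i\wedge\omega_i+\Omega,$$ $$*\varphi=-\frac1{c^3}\beta\wedge\alpha^{123}-\frac1{2c^3}\varepsilon_{ijk}\,\tilde\omega^i\wedge\alpha^{jk}-\frac1{c^3}\omega_i\wedge\beta\wedge\alpha^i+\bar\Omega,$$ and moreover: (1) the forms $\beta,\omega_k,\tilde\omega^k,\Omega,\bar\Omega$ are horizontal; (2) the decompositions are canonical, in the sense that each term in them is independent of the particular choice of basis $U_1,U_2,U_3$ of $\mathbb{U}$;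 (3) the triples $\underline\omega=(\omega_1,\omega_2,\omega_3)$ and $\underline{\tilde\omega}=(\tilde\omega^1,\tilde\omega^2,\tilde\omega^3)$ are definite on $\mathbb{U}^{\perp_{g_\varphi}}$ in the sense that $$\omega_i\wedge\omega_j=2c(\det A)^{5/6}\frac{A_{ij}}{(\det A)^{1/3}}\mathrm{vol}_{\mathbb{U}^{\perp_{g_\varphi}}},\qquad \tilde\omega^i\wedge\tilde\omega^j=2c(\det A)^{7/6}\frac{A^{ij}}{(\det A)^{-1/3}}\mathrm{vol}_{\mathbb{U}^{\perp_{g_\varphi}}},$$ where $\mathrm{vol}_{\mathbb{U}^{\perp_{g_\varphi}}}=(\det A)^{1/2}*\theta^{123}$ is a horizontal $4$-form whose restriction to $\mathbb{U}^{\perp_{g_\varphi}}$ is the volume form of $\mathbb{U}^{\perp_{g_\varphi}}$; (4) the triples $\underline\omega$ and $\underline{\tilde\omega}$ are also definite on $\mathbb{K}_{\mathbb{U}}$.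
   Context: A linear $\mathrm{G}_2$-structure on a $7$-dimensional real vector space $\mathbb{V}$ is a $3$-form $\varphi\in\Lambda^3\mathbb{V}^*$ which in some basis of $\mathbb{V}^*$ equals $e^{123}-e^1(e^{45}+e^{67})-e^2(e^{46}+e^{75})-e^3(e^{47}+e^{56})$ (wedges omitted). It determines an inner product and orientation by $g_\varphi(u,v)\,\mathrm{vol}_\varphi=\frac16(u\lrcorner\varphi)\wedge(v\lrcorner\varphi)\wedge\varphi$; $*$ is the Hodge star. A subspace $\mathbb{W}$ is isotropic if $\varphi|_{\mathbb{W}}=0$, non-isotropic otherwise; $\mathbb{U}^{\perp_{g_\varphi}}$ is the $g_\varphi$-orthogonal complement. Summation over repeated indices in $\{1,2,3\}$ is understood; $\varepsilon$ is the Levi-Civita symbol; $\alpha^{ij}=\alpha^i\wedge\alpha^j$ etc.; $(A^{ij})=A^{-1}$. A $k$-form $\lambda$ on $\mathbb{V}$ is horizontal if $U\lrcorner\lambda=0$ for every $U\in\mathbb{U}$. $\mathbb{K}_{\mathbb{U}}=\ker\alpha^1\cap\ker\alpha^2\cap\ker\alpha^3$, a $4$-dimensional subspace. A triple of $2$-forms is definite on a $4$-dimensional space if, for a volume form $\mu$ on it, the matrix $\left(\frac{\omega_i\wedge\omega_j}{2\mu}\right)$ (of restrictions) is definite. *)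

(* Defs.v *)
From HB Require Import structures.
From mathcomp Require Import all_boot all_order all_fingroup all_algebra.
From mathcomp Require Import all_classical all_reals all_analysis.
Set Implicit Arguments.
Unset Strict Implicit.
Unset Printing Implicit Defensive.
Import Order.TTheory GRing.Theory Num.Theory.
Local Open Scope ring_scope.

(* The space of all real functions of k vectors, with pointwise operations.
   The k-forms on V are its elements satisfying [is_form]. *)
Definition kform (R : realType) (V : vectType R) (k : nat) : Type :=
  k.-tuple V -> R^o.

Section Forms.
Context {R : realType} {V : vectType R}.

Definition set_tnth k (v : k.-tuple V) (i : 'I_k) (x : V) : k.-tuple V :=
  [tuple if j == i then x else tnth v j | j < k].

Definition is_form k (lam : kform V k) : Prop :=
  (forall (v : k.-tuple V) (i : 'I_k) (a : R) (x y : V),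
     lam (set_tnth v i (a *: x + y)) =
     a * lam (set_tnth v i x) + lam (set_tnth v i y)) /\
  (forall (v : k.-tuple V) (i j : 'I_k),
     i != j -> tnth v i = tnth v j -> lam v = 0).

Definition form_of (f : 'Hom(V, R^o)) : kform V 1 := fun v => f (thead v).

(* For a 1-form lam, the corresponding element of the dual space: on such lam
   the argument of linfun is linear (see covectorE). *)
Definition covector (lam : kform V 1) : 'Hom(V, R^o) :=
  linfun (fun x => lam [tuple x]).

Lemma covectorE (lam : kform V 1) (x : V) :
  is_form lam -> covector lam x = lam [tuple x].
Proof.
move=> [lam_lin _].
have set1 y : set_tnth [tuple 0] ord0 y = [tuple y].
  by apply: eq_from_tnth => i; rewrite tnth_mktuple !ord1 eqxx (tnth_nth 0).
have lin : linear (fun y => lam [tuple y] : R^o).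
  by move=> a y z; have := lam_lin [tuple 0] ord0 a y z; rewrite !set1.
pose f : {linear V -> R^o} :=
  HB.pack (fun y => lam [tuple y]) (GRing.isLinear.Build R V R^o *:%R _ lin).
exact: (lfunE f x).
Qed.

(* Normalised so that (a /\ b)(x, y) = a x * b y - a y * b x on 1-forms. *)
Definition wedge k l (lam : kform V k) (mu : kform V l) : kform V (k + l) :=
  fun v => (k`! * l`!)%N%:R^-1 *
    \sum_(s : 'S_(k + l)) (-1) ^+ s *
      lam [tuple tnth v (s (lshift l i)) | i < k] *
      mu [tuple tnth v (s (rshift k j)) | j < l].

(* lam(u_1, ..., u_m, -, ..., -) *)
Definition plug m k (u : m.-tuple V) (lam : kform V (m + k)) : kform V k :=
  fun v => lam [tuple of u ++ v].

Definition interior k (u : V) (lam : kform V k.+1) : kform V k :=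
  fun v => lam [tuple of u :: v].

Definition restr (W : {vspace V}) k (lam : kform V k) :
    kform (subvs_of W) k :=
  fun v => lam (map_tuple vsval v).

Definition horizontal (W : {vspace V}) k (lam : kform V k.+1) : Prop :=
  forall u, u \in W -> interior u lam = 0.

Definition gram n (g : V -> V -> R) (b : n.-tuple V) : 'M[R]_n :=
  \matrix_(i, j) g (tnth b i) (tnth b j).

(* nu restricts on W to a volume form of the inner product g on W, for one of
   the two orientations of W. *)
Definition volume_form_on n (g : {dot V for @idfun R}) (W : {vspace V})
    (nu : kform V n) : Prop :=
  [/\ \dim W = n, is_form nu &
      forall E : n.-tuple V,
        {subset E <= W} -> orthonormal g E -> `|nu E| = 1].

(* Hodge star of the metric g and volume form vol: in index notation with
   respect to a basis b of V,
     ( *lam)_{c_1 .. c_l} = 1/k! lam^{a_1 .. a_k} vol_{a_1 .. a_k c_1 .. c_l},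
   the indices of lam being raised with the inverse of the Gram matrix; the
   result does not depend on b. For V oriented by vol, this is the star with
   mu /\ *lam = <mu, lam> vol. *)
Definition hodge k l (g : V -> V -> R) (vol : kform V (k + l))
    (lam : kform V k) : kform V l :=
  let b := vbasis {:V} in
  let ginv := invmx (gram g b) in
  fun v => k`!%:R^-1 *
    \sum_(I : {ffun 'I_k -> 'I_(\dim {:V})})
      \sum_(J : {ffun 'I_k -> 'I_(\dim {:V})})
        (\prod_(a < k) ginv (I a) (J a)) *
        lam [tuple tnth b (I a) | a < k] *
        vol [tuple of [tuple tnth b (J a) | a < k] ++ v].

End Forms.

Arguments restr {R V} W {k} lam _.
Arguments interior {R V k} u lam _.
Arguments plug {R V m k} u lam _.

Notation "a \wedge b" := (wedge a b) (at level 40, left associativity).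

Definition levi_civita (R : realType) (i j k : 'I_3) : R :=
  \sum_(s : 'S_3 | [tuple s x | x < 3] == [tuple i; j; k]) (-1) ^+ s.

Definition posdefmx (R : realType) n (M : 'M[R]_n) : Prop :=
  forall x : 'rV[R]_n, x != 0 -> 0 < (x *m M *m x^T) 0 0.

Definition definitemx (R : realType) n (M : 'M[R]_n) : Prop :=
  posdefmx M \/ posdefmx (- M).

Definition definite_triple_on (R : realType) (V : vectType R)
    (W : {vspace V}) (om : 'I_3 -> kform V 2) : Prop :=
  \dim W = 4%N /\
  exists mu : kform (subvs_of W) 4, exists M : 'M[R]_3,
    [/\ is_form mu, mu != 0,
        forall i j,
          restr W (om i) \wedge restr W (om j) = (2 * M i j) *: mu &
        definitemx M].

Section G2.
Context {R : realType} {V : vectType R}.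

Definition G2_structure (phi : kform V 3) : Prop :=
  exists2 b : 7.-tuple 'Hom(V, R^o), basis_of fullv b &
    let e (i : nat) := form_of (nth 0 b i.-1) in
    phi = (e 1%N \wedge e 2%N \wedge e 3%N : kform V 3)
        - (e 1%N \wedge (e 4%N \wedge e 5%N + e 6%N \wedge e 7%N) : kform V 3)
        - (e 2%N \wedge (e 4%N \wedge e 6%N + e 7%N \wedge e 5%N) : kform V 3)
        - (e 3%N \wedge (e 4%N \wedge e 7%N + e 5%N \wedge e 6%N) : kform V 3).

(* g and vol are the inner product and the volume form (hence orientation)
   determined by phi. *)
Definition G2_metric (phi : kform V 3) (g : {dot V for @idfun R})
    (vol : kform V 7) : Prop :=
  volume_form_on g fullv vol /\
  forall u v : V,
    g u v *: vol =
    6^-1 *: (interior u phi \wedge interior v phi \wedge phi : kform V 7).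

Definition isotropic (phi : kform V 3) (W : {vspace V}) : Prop :=
  restr W phi = 0.

End G2.

(* The forms attached to a basis U of a 3-dimensional subspace; psi stands for
   the Hodge dual of phi. *)
Section AssociatedForms.
Context {R : realType} {V : vectType R}.
Variables (phi : kform V 3) (psi : kform V 4) (U : 3.-tuple V).
Local Notation eps := (levi_civita R).

Definition alpha (i : 'I_3) : kform V 1 :=
  2^-1 *: \sum_j \sum_k
    eps i j k *: @plug R V 2 1 [tuple tnth U j; tnth U k] phi.

Definition beta : kform V 1 := @plug R V 3 1 U psi.

Definition omega (k : 'I_3) : kform V 2 :=
  - (phi U *: interior (tnth U k) phi)
  + 2^-1 *: \sum_i \sum_j eps i j k *: (alpha i \wedge alpha j).

Definition tomega (k : 'I_3) : kform V 2 :=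
  - ((2^-1 * phi U) *: \sum_i \sum_j
       eps i j k *: @plug R V 2 2 [tuple tnth U i; tnth U j] psi)
  + alpha k \wedge beta.

Definition alpha123 : kform V 3 := alpha 0 \wedge alpha 1 \wedge alpha 2.

Definition phi_term1 : kform V 3 := (phi U ^+ 2)^-1 *: alpha123.

Definition phi_term2 : kform V 3 :=
  - ((phi U ^+ 2)^-1 *: \sum_i (alpha i \wedge omega i)).

Definition Omega : kform V 3 := phi - (phi_term1 + phi_term2).

Definition psi_term1 : kform V 4 :=
  - ((phi U ^+ 3)^-1 *: (beta \wedge alpha123)).

Definition psi_term2 : kform V 4 :=
  - ((2 * phi U ^+ 3)^-1 *: \sum_i \sum_j \sum_k
       eps i j k *: (tomega i \wedge (alpha j \wedge alpha k))).

Definition psi_term3 : kform V 4 :=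
  - ((phi U ^+ 3)^-1 *: \sum_i (omega i \wedge beta \wedge alpha i)).

Definition barOmega : kform V 4 := psi - (psi_term1 + psi_term2 + psi_term3).

(* The common kernel of the alpha^i. *)
Definition kerU : {vspace V} := (\bigcap_(i < 3) lker (covector (alpha i)))%VS.

End AssociatedForms.

(* Main.v *)
Require Import Defs.
From HB Require Import structures.
From mathcomp Require Import all_boot all_order all_fingroup all_algebra.
From mathcomp Require Import all_classical all_reals all_analysis.
From mathcomp Require Import ring lra.

(** All forms are studied through their values on lists of vectors. The exterior
    product, defined by a sum over all permutations, is a sum over shuffles when
    its factors are alternating ([feval_wedge]), and so an explicit polynomial in
    their values. Indices are counted from 0.

    Algebra gives most of the horizontality statements and the independence of the
    basis. Since phi is alternating, alpha^i(U_j) = c delta_ij ([alphaU]). Hence the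
    contractions of beta, omega, tomega and Omega with vectors of the subspace
    vanish, and so do those of barOmega with two such vectors ([barOmegaUU]). If
    the basis U is replaced by P U, with d = det P, then c and beta are multiplied
    by d, alpha by the matrix of cofactors of P, omega by d P, and tomega by d times
    the matrix of cofactors. In each term of the decompositions, the sum over the
    basis pairs P with its cofactors, which produces powers of d that compensate
    the power of c ([wedge_contract]).

    By the same covariance, the products omega_i /\ omega_j and
    tomega^i /\ tomega^j, and the horizontality of barOmega, need only be
    determined for one orthonormal basis of the subspace. In an adapted basis,
    where phi is the standard form, the definition of the metric forces
    orthonormality, up to a scale that the normalisation of the volume form fixes
    ([adapted_orthonormal]). The cross product defined by phi then satisfies the
    identities of the imaginary octonions, and the Cayley-Dickson construction
    makes an adapted basis f from any orthonormal pair f_0, f_1, its product f_2,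
    and any unit vector f_3 orthogonal to these three ([cross_frame]). Hence every
    3-dimensional subspace has an orthonormal basis f_0, f_1, c f_2 + s f_3 with
    c^2 + s^2 = 1 ([exists_rotated_frame]). Completed by - s f_2 + c f_3, f_4, f_5
    and f_6, it gives an orthonormal basis h of the space, in which phi and its
    Hodge dual have eleven components each. On the last four vectors, for instance,
    omega_0 = h^{34} + c h^{56} and tomega^0 = h^{56} + c h^{34}. One reads off
    omega_i /\ omega_j = tomega^i /\ tomega^j = 2 c delta_ij h^{3456} and the
    vanishing of the components of barOmega with one index in the subspace.

    A horizontal 4-form is determined by its value on a basis of any complement of
    the subspace. With nu = vol(U_0, U_1, U_2, -) this yields, for every basis U,
    omega_i /\ omega_j = 2 c A_ij nu ([wedge_omega]) and
    tomega^i /\ tomega^j = 2 c (det A) A^{ij} nu ([wedge_tomega]). Since theta^i is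
    the inner product with A^{ij} U_j, the Hodge dual of
    theta^0 /\ theta^1 /\ theta^2 is nu / det A ([hodge_theta]), and the volume form
    of the orthogonal complement is nu / (det A)^{1/2}. Finally, A is positive
    definite and nu restricts to a volume form on each complement of the subspace,
    so that both triples are definite on the orthogonal complement and on the
    common kernel of the alpha^i ([definite_on_complement]). *)

Set Implicit Arguments.
Unset Strict Implicit.
Unset Printing Implicit Defensive.
Import Order.TTheory GRing.Theory Num.Theory.
Local Open Scope ring_scope.
Local Notation interior := Defs.interior.

(** * Values of forms on lists of vectors *)

Section FormEvaluation.
Context {R : realType} {V : vectType R}.
Implicit Types (k : nat) (x y : V) (s : seq V).

(** Values are taken on plain lists, padded with 0, so that vectors can be
    inserted, moved and listed without transport along equalities of lengths. *)
Definition feval k (lam : kform V k) (s : seq V) : R :=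
  lam [tuple s`_i | i < k].

Lemma feval_tuple k (lam : kform V k) (v : k.-tuple V) : feval lam v = lam v.
Proof.
rewrite /feval; congr lam; apply: eq_from_tnth => i.
by rewrite tnth_mktuple (tnth_nth 0).
Qed.

Lemma kform_ext k (lam mu : kform V k) :
  (forall s, size s = k -> feval lam s = feval mu s) -> lam = mu.
Proof.
move=> eq_s; apply/funext => v; rewrite -2!feval_tuple.
by apply: eq_s; rewrite size_tuple.
Qed.

Lemma feval_interior k u (lam : kform V k.+1) s :
  feval (interior u lam) s = feval lam (u :: s).
Proof.
rewrite /feval /interior; congr lam; apply: eq_from_tnth => i.
rewrite tnth_mktuple (tnth_nth 0) /=; case: i => [[|i] lti] //=.
by rewrite (nth_map (Ordinal (lti : (i < k)%N))) ?size_enum_ord // nth_enum_ord.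
Qed.

Lemma feval_plug m k (u : m.-tuple V) (lam : kform V (m + k)) s :
  feval (plug u lam) s = feval lam (u ++ s).
Proof.
rewrite /feval /plug; congr lam; apply: eq_from_tnth => i.
rewrite tnth_mktuple (tnth_nth 0) /= !nth_cat size_tuple.
case: ltnP => // lemi.
have lti : (i - m < k)%N by rewrite ltn_subLR.
by rewrite (nth_map (Ordinal lti)) ?size_enum_ord // nth_enum_ord.
Qed.

Lemma fevalZ_form k a (lam : kform V k) s : feval (a *: lam) s = a * feval lam s.
Proof. by []. Qed.

Lemma fevalD_form k (lam mu : kform V k) s :
  feval (lam + mu) s = feval lam s + feval mu s.
Proof. by []. Qed.

Lemma fevalN_form k (lam : kform V k) s : feval (- lam) s = - feval lam s.
Proof. by []. Qed.

Lemma feval0_form k s : feval (0 : kform V k) s = 0.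
Proof. by []. Qed.

Lemma feval_sum_form k I (r : seq I) (P : pred I) (F : I -> kform V k) s :
  feval (\sum_(i <- r | P i) F i) s = \sum_(i <- r | P i) feval (F i) s.
Proof. by rewrite /feval; apply: (big_morph (fun lam : kform V k => lam _)). Qed.

Definition fevalE := (fevalD_form, fevalN_form, fevalZ_form, feval0_form,
  @feval_sum_form, feval_interior, @feval_plug).

Let appD k (lam mu : kform V k) v : (lam + mu) v = lam v + mu v.
Proof. by []. Qed.

Let appZ k a (lam : kform V k) v : (a *: lam) v = a * lam v.
Proof. by []. Qed.

Let app0 k v : (0 : kform V k) v = 0.
Proof. by []. Qed.

Lemma is_form0 k : is_form (0 : kform V k).
Proof. by split=> [v i a x y|//]; rewrite !app0 mulr0 addr0. Qed.

Lemma is_formD k (lam mu : kform V k) :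
  is_form lam -> is_form mu -> is_form (lam + mu).
Proof.
move=> [lin1 alt1] [lin2 alt2]; split=> [v i a x y|v i j ij vij].
  by rewrite !appD lin1 lin2 mulrDr addrACA.
by rewrite appD (alt1 _ _ _ ij vij) (alt2 _ _ _ ij vij) addr0.
Qed.

Lemma is_formZ k a (lam : kform V k) : is_form lam -> is_form (a *: lam).
Proof.
move=> [lin1 alt1]; split=> [v i b x y|v i j ij vij]; rewrite !appZ.
  by rewrite lin1 mulrDr mulrCA.
by rewrite (alt1 _ _ _ ij vij) mulr0.
Qed.

Lemma is_formN k (lam : kform V k) : is_form lam -> is_form (- lam).
Proof. by rewrite -scaleN1r; apply: is_formZ. Qed.

Lemma is_form_sum k I (r : seq I) (P : pred I) (F : I -> kform V k) :
  (forall i, P i -> is_form (F i)) -> is_form (\sum_(i <- r | P i) F i).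
Proof.
move=> formF; elim/big_rec: _ => [|i lam Pi]; first exact: is_form0.
by apply: is_formD; apply: formF.
Qed.

Lemma tnth_set k (v : k.-tuple V) i j x :
  tnth (set_tnth v i x) j = if j == i then x else tnth v j.
Proof. by rewrite tnth_mktuple. Qed.

Lemma set_tnthC k (v : k.-tuple V) i j x y : i != j ->
  set_tnth (set_tnth v i x) j y = set_tnth (set_tnth v j y) i x.
Proof.
move=> neq_ij; apply: eq_from_tnth => l; rewrite !tnth_set.
by case: (eqVneq l j) => // ->; rewrite eq_sym (negPf neq_ij).
Qed.

Lemma formD_slot k (lam : kform V k) v i x y : is_form lam ->
  lam (set_tnth v i (x + y)) = lam (set_tnth v i x) + lam (set_tnth v i y).
Proof. by case=> lin _; rewrite -{1}[x]scale1r lin mul1r. Qed.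

(** Polarisation: expand the value, which is zero, of lam on two copies of
    v_i + v_j. *)
Lemma form_tperm k (lam : kform V k) (v : k.-tuple V) i j : is_form lam ->
  i != j -> lam [tuple tnth v (tperm i j l) | l < k] = - lam v.
Proof.
move=> formlam neq_ij; have [lin alt] := formlam.
pose S x y := set_tnth (set_tnth v i x) j y.
have SD1 x1 x2 y : lam (S (x1 + x2) y) = lam (S x1 y) + lam (S x2 y).
  by rewrite /S !(set_tnthC _ _ _ neq_ij) formD_slot.
have SD2 x y1 y2 : lam (S x (y1 + y2)) = lam (S x y1) + lam (S x y2).
  exact: formD_slot.
have Sdiag x : lam (S x x) = 0.
  by apply: (alt _ i j neq_ij); rewrite !tnth_set !eqxx (negPf neq_ij).
have := Sdiag (tnth v i + tnth v j); rewrite SD1 !SD2 !Sdiag add0r addr0.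
have -> : S (tnth v i) (tnth v j) = v.
  apply: eq_from_tnth => l; rewrite !tnth_set.
  by case: (eqVneq l j) => [->|_] //; case: (eqVneq l i) => [->|].
have -> : S (tnth v j) (tnth v i) = [tuple tnth v (tperm i j l) | l < k].
  apply: eq_from_tnth => l; rewrite !tnth_set tnth_mktuple.
  case: (eqVneq l j) => [->|nlj]; first by rewrite tpermR.
  by case: (eqVneq l i) => [->|nli]; rewrite ?tpermL // tpermD // eq_sym.
by rewrite addrC => /eqP; rewrite addr_eq0 => /eqP.
Qed.

Lemma form_perm k (lam : kform V k) (v : k.-tuple V) (p : 'S_k) :
  is_form lam -> lam [tuple tnth v (p i) | i < k] = (-1) ^+ p * lam v.
Proof.
move=> formlam; have [ts -> dts] := prod_tpermP p.
elim: ts dts v => [_|t ts IHts /= /andP[dt dts]] v.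
  rewrite big_nil odd_perm1 mul1r; congr lam.
  by apply: eq_from_tnth => i; rewrite tnth_mktuple perm1.
rewrite big_cons odd_mul_tperm dt addTb signrN mulNr -(IHts dts).
rewrite -(form_tperm _ formlam dt); congr lam.
by apply: eq_from_tnth => i; rewrite !tnth_mktuple permM.
Qed.

Lemma feval_linear k (lam : kform V k) s1 s2 a x y : is_form lam ->
  (size s1 < k)%N -> feval lam (s1 ++ (a *: x + y) :: s2) =
    a * feval lam (s1 ++ x :: s2) + feval lam (s1 ++ y :: s2).
Proof.
move=> [lin _] lts1.
pose w := [tuple (s1 ++ 0 :: s2)`_i | i < k].
have set_slot z : feval lam (s1 ++ z :: s2) =
    lam (set_tnth w (Ordinal lts1) z).
  congr lam; apply: eq_from_tnth => i; rewrite tnth_set !tnth_mktuple -val_eqE /=.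
  rewrite !nth_cat; case: ltngtP => // [lt_si|->]; last by rewrite subnn.
  by case: (i - size s1)%N (subn_gt0 (size s1) i) => [|n] //; rewrite lt_si.
by rewrite !set_slot lin.
Qed.

Section Slot.
Variables (k : nat) (lam : kform V k) (s1 s2 : seq V).
Hypotheses (formlam : is_form lam) (lts1 : (size s1 < k)%N).

Lemma feval_slotD x y : feval lam (s1 ++ (x + y) :: s2) =
  feval lam (s1 ++ x :: s2) + feval lam (s1 ++ y :: s2).
Proof. by rewrite -{1}[x]scale1r feval_linear // mul1r. Qed.

Lemma feval_slot0 : feval lam (s1 ++ 0 :: s2) = 0.
Proof.
have := feval_slotD 0 0; rewrite addr0 => /eqP.
by rewrite -subr_eq0 opprD addNKr oppr_eq0 => /eqP.
Qed.

Lemma feval_slotZ a x : feval lam (s1 ++ (a *: x) :: s2) =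
  a * feval lam (s1 ++ x :: s2).
Proof. by rewrite -[a *: x]addr0 feval_linear // feval_slot0 addr0. Qed.

Lemma feval_slotN x : feval lam (s1 ++ (- x) :: s2) =
  - feval lam (s1 ++ x :: s2).
Proof. by rewrite -scaleN1r feval_slotZ mulN1r. Qed.

Lemma feval_slot_sum I (r : seq I) (P : pred I) (a : I -> R) (F : I -> V) :
  feval lam (s1 ++ (\sum_(i <- r | P i) a i *: F i) :: s2) =
  \sum_(i <- r | P i) a i * feval lam (s1 ++ F i :: s2).
Proof.
elim/big_rec2: _ => [|i b x Pi <-]; first exact: feval_slot0.
by rewrite feval_linear.
Qed.
End Slot.

Lemma feval_perm k (lam : kform V k) s s' : is_form lam -> size s = k ->
  perm_eq s s' -> exists b : bool, feval lam s = (-1) ^+ b * feval lam s'.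
Proof.
move=> formlam szs eqs; have szs' : size s' == k by rewrite -(perm_size eqs) szs.
have : perm_eq s (Tuple szs') by [].
case/tuple_permP => p defs; exists (p : bool).
have -> : s = [tuple tnth (Tuple szs') (p i) | i < k] by [].
by rewrite feval_tuple form_perm // -(feval_tuple lam (Tuple szs')).
Qed.

Lemma feval_repeat k (lam : kform V k) s : is_form lam -> size s = k ->
  ~~ uniq s -> feval lam s = 0.
Proof.
move=> [_ alt] szs /uniqPn => /(_ 0)[i [j [lt_ij ltj eqij]]]; rewrite szs in ltj.
apply: (alt _ (Ordinal (ltn_trans lt_ij ltj)) (Ordinal ltj)).
  by rewrite -val_eqE /= ltn_eqF.
by rewrite !tnth_mktuple.
Qed.

Lemma feval_swap k (lam : kform V k) s1 x y s2 : is_form lam ->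
  ((size s1).+1 < k)%N -> feval lam (s1 ++ x :: y :: s2) =
  - feval lam (s1 ++ y :: x :: s2).
Proof.
move=> formlam lts1; have lts1' := ltnW lts1.
pose i := Ordinal lts1'; pose j := Ordinal lts1.
have neq_ij : i != j by rewrite -val_eqE /= ltn_eqF.
rewrite {2}/feval -(form_tperm _ formlam neq_ij); congr lam.
apply: eq_from_tnth => l; rewrite !tnth_mktuple.
case: (eqVneq l i) => [->|nli].
  by rewrite tpermL /= !nth_cat !ltnn subnn ltnNge leqnSn /= subSnn.
case: (eqVneq l j) => [->|nlj].
  by rewrite tpermR /= !nth_cat ltnn ltnNge leqnSn /= subSnn subnn.
rewrite tpermD 1?eq_sym // !nth_cat; case: ltnP => // le_l.
move: nli nlj; rewrite -!val_eqE /=.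
case dl: (l - size s1)%N => [|[|n]] //.
  by rewrite eqn_leq le_l -subn_eq0 dl.
by rewrite -(subnK le_l) dl add1n eqxx.
Qed.

Lemma is_form_interior k u (lam : kform V k.+1) :
  is_form lam -> is_form (interior u lam).
Proof.
move=> [lin alt]; have cons_set (v : k.-tuple V) i x :
    [tuple of u :: set_tnth v i x] = set_tnth [tuple of u :: v] (lift ord0 i) x.
  apply: eq_from_tnth => j; rewrite tnth_set.
  case: (unliftP ord0 j) => [j' ->|->] //=.
  by rewrite !(tnthS, tnth_set) (inj_eq lift_inj).
split=> [v i a x y|v i j neq_ij vij]; first by rewrite /interior !cons_set lin.
apply: (alt _ (lift ord0 i) (lift ord0 j)); last by rewrite !tnthS.
by rewrite (inj_eq lift_inj).
Qed.

Lemma is_form_plug m k (u : m.-tuple V) (lam : kform V (m + k)) :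
  is_form lam -> is_form (plug u lam).
Proof.
elim: m u lam => [|m IHm] u lam formlam.
  suff -> : plug u lam = lam by [].
  by apply: kform_ext => s _; rewrite feval_plug tuple0.
case: (tupleP u) => x u'.
have -> : plug [tuple of x :: u'] lam = plug u' (interior x lam : kform V (m + k)).
  by apply: kform_ext => s _; rewrite !fevalE.
exact/IHm/is_form_interior.
Qed.

End FormEvaluation.

(** * Multilinear expansion *)

Section Expansion.
Context {R : realType} {V : vectType R}.

Definition fcons (T : Type) k (x : T) (g : {ffun 'I_k -> T}) :
    {ffun 'I_k.+1 -> T} :=
  [ffun i => if unlift ord0 i is Some i' then g i' else x].

Lemma fcons0 (T : Type) k (x : T) (g : {ffun 'I_k -> T}) : fcons x g ord0 = x.
Proof. by rewrite ffunE unlift_none. Qed.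

Lemma fconsS (T : Type) k (x : T) (g : {ffun 'I_k -> T}) i :
  fcons x g (lift ord0 i) = g i.
Proof. by rewrite ffunE liftK. Qed.

Lemma big_ffun_cons (T : finType) k (F : {ffun 'I_k.+1 -> T} -> R) :
  \sum_f F f = \sum_x \sum_(g : {ffun 'I_k -> T}) F (fcons x g).
Proof.
rewrite pair_big /=; apply: (reindex (fun p => fcons p.1 p.2)).
exists (fun f : {ffun 'I_k.+1 -> T} => (f ord0, [ffun i => f (lift ord0 i)])).
  move=> [x g] _; rewrite /= fcons0; congr pair.
  by apply/ffunP => i; rewrite ffunE fconsS.
move=> f _; apply/ffunP => i; rewrite ffunE /=.
by case: unliftP => [i' ->|->] //; rewrite ffunE.
Qed.

Lemma form_expand k n (lam : kform V k) (M : 'I_k -> 'I_n -> R)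
    (b : 'I_n -> V) : is_form lam ->
  lam [tuple \sum_j M i j *: b j | i < k] =
  \sum_(f : {ffun 'I_k -> 'I_n})
     (\prod_i M i (f i)) * lam [tuple b (f i) | i < k].
Proof.
elim: k lam M => [|k IHk] lam M formlam.
  rewrite (big_pred1 (ffun0 (card_ord 0))); last first.
    by move=> f; apply/esym/eqP/ffunP => -[].
  by rewrite big_ord0 mul1r !(tuple0 [tuple _ | _ < 0]).
have tuple_cons (F : 'I_k.+1 -> V) :
    [tuple F i | i < k.+1] = [tuple of F ord0 :: [tuple F (lift ord0 i) | i < k]].
  apply: eq_from_tnth => i; rewrite tnth_mktuple.
  by case: (unliftP ord0 i) => [j ->|->] //; rewrite tnthS tnth_mktuple.
rewrite tuple_cons big_ffun_cons -feval_tuple.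
rewrite [LHS](@feval_slot_sum R V _ lam [::] _ formlam isT).
apply: eq_bigr => j _; rewrite cat0s -feval_interior feval_tuple.
rewrite IHk; last exact: is_form_interior.
rewrite mulr_sumr; apply: eq_bigr => f _.
rewrite big_ord_recl fcons0 -mulrA; congr (_ * (_ * _)).
  by apply: eq_bigr => i _; rewrite fconsS.
rewrite -feval_tuple feval_interior tuple_cons fcons0 -feval_tuple.
congr (feval _ (_ :: _)); congr tval; apply: eq_from_tnth => i.
by rewrite !tnth_mktuple fconsS.
Qed.

(** Only injective choices of indices survive in the multilinear expansion, and
    these are the permutations of the Leibniz formula. *)
Lemma form_det k (lam : kform V k) (M : 'M[R]_k) (v : k.-tuple V) :
  is_form lam ->
  lam [tuple \sum_j M i j *: tnth v j | i < k] = \det M * lam v.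
Proof.
move=> formlam; rewrite form_expand //.
rewrite (bigID (fun f : {ffun _ -> _} => injectiveb f)) /=.
rewrite addrC big1 ?add0r => [|f /injectivePn[i [j neq_ij eqf]]]; last first.
  have [_ alt] := formlam.
  by rewrite (alt _ _ _ neq_ij) ?mulr0 // !tnth_mktuple eqf.
rewrite (reindex (@pval _)) /=; last first.
  pose in_Sn := insubd (1%g : 'S_k).
  by exists in_Sn => /= f Uf; first apply: val_inj; apply: insubdK.
rewrite mulr_suml; apply: eq_big => [s|s _]; first by rewrite (valP s).
rewrite pvalE mulrAC mulrC -form_perm // mulrC; congr (_ * _).
Qed.

(** In the expansion along the generating family b, a choice of indices with a
    repetition contributes nothing, and any other one can be sorted at the cost
    of a sign. *)
Lemma form_eq0 k (lam : kform V k) (b : seq V) : is_form lam ->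
  (forall s, subseq s b -> size s = k -> feval lam s = 0) ->
  forall v : k.-tuple V, {subset v <= <<b>>%VS} -> lam v = 0.
Proof.
move=> formlam lam0 v sub_vb; set n := size b.
have lamI (f : {ffun 'I_k -> 'I_n}) : lam [tuple b`_(f i) | i < k] = 0.
  have [injf|/injectivePn[i [j neq_ij eqf]]] := boolP (injectiveb f); last first.
    have [_ alt] := formlam.
    by apply: (alt _ _ _ neq_ij); rewrite !tnth_mktuple eqf.
  (* The sorted list of the values of f. *)
  pose I := [seq j <- enum 'I_n | j \in codom f].
  have permI : perm_eq (codom f) I.
    apply: uniq_perm; [exact: injf | exact/filter_uniq/enum_uniq |].
    by move=> j; rewrite mem_filter mem_enum andbT.
  have eq_map : tval [tuple b`_(f i) | i < k] = [seq b`_(val j) | j <- codom f].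
    by rewrite codomE -map_comp.
  have perm_b : perm_eq [tuple b`_(f i) | i < k] [seq b`_(val j) | j <- I].
    by rewrite eq_map; apply: perm_map.
  rewrite -feval_tuple.
  have [| s -> ] := feval_perm formlam _ perm_b; first by rewrite size_tuple.
  rewrite lam0 ?mulr0 //; last by rewrite -(perm_size perm_b) size_tuple.
  have {2}-> : b = [seq b`_(val j) | j <- enum 'I_n].
    by rewrite -[LHS](mkseq_nth 0) /mkseq -val_enum_ord -map_comp.
  exact/map_subseq/filter_subseq.
have -> : v = [tuple \sum_j coord (in_tuple b) j (tnth v i) *: b`_j | i < k].
  apply: eq_from_tnth => i; rewrite tnth_mktuple.
  by apply: coord_span; apply/sub_vb/mem_tnth.
rewrite form_expand // big1 // => f _.
by rewrite lamI mulr0.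
Qed.

End Expansion.

(** * The exterior product as a sum over shuffles *)

(** The recursion is the Leibniz rule for the contraction with the first vector.
    On an explicit list it evaluates to an explicit polynomial in the values of
    f and g; the ring K is arbitrary so that integral tables can be computed with
    before being mapped to the reals. *)
Fixpoint shuffle (K : nzRingType) (T : Type) k l (f g : seq T -> K) s : K :=
  if s is x :: s' then
    (if k is k'.+1 then shuffle k' l (fun t => f (x :: t)) g s' else 0) +
    (if l is l'.+1 then
       (-1) ^+ k * shuffle k l' f (fun t => g (x :: t)) s' else 0)
  else f [::] * g [::].

Lemma shuffle_map (T T' : Type) (K K' : nzRingType)
    (m : {rmorphism K' -> K}) (h : T' -> T) k l
    (f g : seq T -> K) (f' g' : seq T' -> K') s :
  (forall t, size t = k -> f (map h t) = m (f' t)) ->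
  (forall t, size t = l -> g (map h t) = m (g' t)) ->
  size s = (k + l)%N ->
  shuffle k l f g (map h s) = m (shuffle k l f' g' s).
Proof.
elim: s k l f g f' g' => [|x s IHs] k l f g f' g' ff gg /=.
  case: k ff => // ff; case: l gg => // gg _.
  by rewrite (ff [::]) // (gg [::]) // rmorphM.
move=> szs; rewrite rmorphD; congr (_ + _).
  case: k ff szs => [|k] ff szs; first by rewrite rmorph0.
  apply: IHs => //; first by move=> t szt; rewrite (ff (x :: t)) //= szt.
  by case: szs.
case: l gg szs => [|l] gg szs; first by rewrite rmorph0.
rewrite rmorphM rmorph_sign; congr (_ * _).
apply: IHs => //; first by move=> t szt; rewrite (gg (x :: t)) //= szt.
by move: szs; rewrite addnS => -[].
Qed.

Section Wedge.
Context {R : realType} {V : vectType R}.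
Implicit Types (x : V) (s t : seq V).

(** When two vectors of the list are equal, composing with their transposition
    changes the sign of every term of the sum, and nothing else. *)
Lemma is_form_wedge k l (lam : kform V k) (mu : kform V l) :
  is_form lam -> is_form mu -> is_form (lam \wedge mu).
Proof.
move=> formlam formmu; have [lin1 alt1] := formlam; have [lin2 alt2] := formmu.
have set1 (q : 'S_(k + l)) (a : 'I_k) (v : (k + l).-tuple V) y :
    [tuple tnth (set_tnth v (q (lshift l a)) y) (q (lshift l i)) | i < k] =
    set_tnth [tuple tnth v (q (lshift l i)) | i < k] a y.
  apply: eq_from_tnth => i; rewrite !(tnth_set, tnth_mktuple).
  by rewrite (inj_eq perm_inj) (inj_eq (@lshift_inj _ _)).
have set2 (q : 'S_(k + l)) (a : 'I_l) (v : (k + l).-tuple V) y :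
    [tuple tnth (set_tnth v (q (rshift k a)) y) (q (rshift k i)) | i < l] =
    set_tnth [tuple tnth v (q (rshift k i)) | i < l] a y.
  apply: eq_from_tnth => i; rewrite !(tnth_set, tnth_mktuple).
  by rewrite (inj_eq perm_inj) (inj_eq (@rshift_inj _ _)).
have set12 (q : 'S_(k + l)) (a : 'I_l) (v : (k + l).-tuple V) y :
    [tuple tnth (set_tnth v (q (rshift k a)) y) (q (lshift l i)) | i < k] =
    [tuple tnth v (q (lshift l i)) | i < k].
  apply: eq_from_tnth => i; rewrite !(tnth_set, tnth_mktuple).
  by rewrite (inj_eq perm_inj) eq_lrshift.
have set21 (q : 'S_(k + l)) (a : 'I_k) (v : (k + l).-tuple V) y :
    [tuple tnth (set_tnth v (q (lshift l a)) y) (q (rshift k i)) | i < l] =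
    [tuple tnth v (q (rshift k i)) | i < l].
  apply: eq_from_tnth => i; rewrite !(tnth_set, tnth_mktuple).
  by rewrite (inj_eq perm_inj) eq_rlshift.
split=> [v i a x y|v i j neq_ij vij]; rewrite /wedge.
  rewrite mulrCA -mulrDr; congr (_ * _); rewrite mulr_sumr -big_split /=.
  apply: eq_bigr => q _; rewrite -(permKV q i); case: (split_ordP (q^-1%g i)) => b ->.
    rewrite !(set1 q b v) !(set21 q b v) lin1.
    set e := (-1) ^+ _; move: (lam _) (lam _) (mu _) e => L1 L2 M e.
    by rewrite mulrDr mulrDl !mulrA [e * a]mulrC.
  rewrite !(set2 q b v) !(set12 q b v) lin2.
  set e := _ * lam _; move: (mu _) (mu _) e => M1 M2 e.
  by rewrite mulrDr [e * _]mulrCA mulrA.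
rewrite (reindex_inj (mulIg (tperm i j))) /=.
set S := \sum_q _; suff: S = - S.
  by move/eqP; rewrite -addr_eq0 -mulr2n mulrn_eq0 /= => /eqP->; rewrite mulr0.
rewrite {2}/S (reindex_inj (mulIg (tperm i j))) /= -sumrN.
apply: eq_bigr => q _; rewrite -mulgA tperm2 mulg1 odd_permM odd_tperm neq_ij.
have tv a : tnth v (tperm i j a) = tnth v a by case: tpermP => // ->.
rewrite addbT signrN !mulNr; congr (- (_ * lam _ * mu _)).
  by apply: eq_from_tnth => a; rewrite !tnth_mktuple permM tv.
by apply: eq_from_tnth => a; rewrite !tnth_mktuple permM tv.
Qed.

(** The sum that defines the exterior product, for a general integrand: the
    recursion in [feval_wedge] passes through integrands that are not products of
    values of forms on consecutive vectors. *)
Definition altsum n (G : seq V -> R) s : R :=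
  \sum_(q : 'S_n) (-1) ^+ q * G [seq s`_(q i) | i <- enum 'I_n].

Lemma wedge_altsum k l (lam : kform V k) (mu : kform V l) s :
  feval (lam \wedge mu) s = (k`! * l`!)%N%:R^-1 *
    altsum (k + l) (fun t => feval lam (take k t) * feval mu (drop k t)) s.
Proof.
rewrite /feval /wedge; congr (_ * _); apply: eq_bigr => q _.
rewrite -mulrA; congr (_ * (lam _ * mu _)).
  apply: eq_from_tnth => i; rewrite !tnth_mktuple nth_take //.
  rewrite (nth_map (lshift l i)) ?size_enum_ord ?ltn_addr //.
  by congr (s`_(q _)); apply/val_inj; rewrite /= nth_enum_ord ?ltn_addr.
apply: eq_from_tnth => i; rewrite !tnth_mktuple nth_drop.
rewrite (nth_map (rshift k i)) ?size_enum_ord ?ltn_add2l //.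
by congr (s`_(q _)); apply/val_inj; rewrite /= nth_enum_ord ?ltn_add2l.
Qed.

(** The permutations of x :: s are sorted by the position p that they give to
    x. *)
Lemma altsum_cons n G x s :
  altsum n.+1 G (x :: s) = \sum_(p < n.+1) (-1) ^+ p *
    altsum n (fun t => G (take p t ++ x :: drop p t)) s.
Proof.
rewrite /altsum (partition_big (fun q : 'S_n.+1 => (q^-1)%g ord0) predT) //=.
apply: eq_bigr => p _; rewrite mulr_sumr (reindex (lift_perm p ord0)) /=; last first.
  pose ulsf i (q : 'S_n.+1) k := odflt k (unlift (q i) (q (lift i k))).
  have ulsfK i (q : 'S_n.+1) k : lift (q i) (ulsf i q k) = q (lift i k).
    rewrite /ulsf; have:= neq_lift i k.
    by rewrite -(can_eq (permK q)) => /unlift_some[] ? ? ->.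
  have inj_ulsf: injective (ulsf p _).
    move=> q; apply: can_inj (ulsf (q p) q^-1%g) _ => k'.
    by rewrite {1}/ulsf ulsfK !permK liftK.
  exists (fun q => perm (inj_ulsf q)) => [q _ | q].
    by apply/permP=> k'; rewrite permE /ulsf lift_perm_lift lift_perm_id liftK.
  move=> /eqP/(congr1 q); rewrite permKV => q0; apply/permP=> k.
  case: (unliftP p k) => [k'|] ->; rewrite ?lift_perm_id //.
  by rewrite lift_perm_lift q0 permE ulsfK.
apply: eq_big => [q|q _].
  by rewrite lift_permV lift_perm_id eqxx.
rewrite odd_lift_perm addbF signr_addb signr_odd -mulrA; congr (_ * (_ * G _)).
set w := [seq s`_(q i) | i <- _].
have szw : size w = n by rewrite size_map size_enum_ord.
apply: (@eq_from_nth _ 0) => [|i].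
  by rewrite size_map size_enum_ord size_cat /= addnS -size_cat cat_take_drop szw.
rewrite size_map size_enum_ord => lti.
rewrite (nth_map ord0) ?size_enum_ord // nth_cat size_takel ?szw -1?ltnS //.
rewrite (_ : nth ord0 (enum 'I_n.+1) i = Ordinal lti); last first.
  by apply/val_inj; rewrite /= nth_enum_ord.
have nthw (j : 'I_n) : w`_j = s`_(q j).
  by rewrite (nth_map j) ?size_enum_ord // nth_ord_enum.
case: (unliftP p (Ordinal lti)) => [j|] dj.
  rewrite dj lift_perm_lift /= -nthw; move/(congr1 val): dj => /= ->.
  rewrite /bump; case: (leqP p j) => [lepj|ltjp].
    rewrite add1n ltnNge leqW // subSn //= nth_drop; congr (w`_ _).
    by rewrite subnKC.
  by rewrite add0n ltnS ltjp nth_take.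
rewrite dj lift_perm_id; move/(congr1 val): dj => /= ->.
by rewrite ltnn subnn.
Qed.

Lemma eq_altsum n (G H : seq V -> R) s :
  (forall t, size t = n -> G t = H t) -> altsum n G s = altsum n H s.
Proof.
move=> eqGH; apply: eq_bigr => q _; rewrite eqGH //.
by rewrite size_map size_enum_ord.
Qed.

Lemma altsumZ n a (G : seq V -> R) s :
  altsum n (fun t => a * G t) s = a * altsum n G s.
Proof. by rewrite /altsum mulr_sumr; apply: eq_bigr => q _; rewrite mulrCA. Qed.

Lemma feval_to_front k (lam : kform V k) s x t : is_form lam ->
  (size s < k)%N ->
  feval lam (s ++ x :: t) = (-1) ^+ size s * feval lam (x :: s ++ t).
Proof.
move=> formlam; elim/last_ind: s t => [|s y IHs] t; first by rewrite mul1r.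
rewrite size_rcons => lts; rewrite cat_rcons feval_swap // IHs 1?ltnW //.
by rewrite exprS -mulNr mulN1r cat_rcons.
Qed.

(** Induction on the list. In the sum over the position p of the first vector x,
    either p < k, and x is an argument of lam, or p >= k, and it is an argument of
    mu. Moving x to the front of that argument list costs a sign that cancels the
    sign of p, up to (-1)^k in the second case. The k (resp. l) positions thus
    contribute equally, which turns the factor 1/k! (resp. 1/l!) into the one
    that suits the contracted form. *)
Lemma feval_wedge k l (lam : kform V k) (mu : kform V l) s :
  is_form lam -> is_form mu -> size s = (k + l)%N ->
  feval (lam \wedge mu) s = shuffle k l (feval lam) (feval mu) s.
Proof.
elim: s k l lam mu => [|x s IHs] k l lam mu formlam formmu szs.
  case: k lam formlam szs => // lam _; case: l mu formmu => // mu _ _.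
  rewrite wedge_altsum /altsum (big_pred1 1%g); last first.
    by move=> q; apply/esym/eqP/permP => -[].
  set t := map _ _.
  have -> : t = [::] by apply/size0nil; rewrite size_map size_enum_ord.
  by rewrite odd_perm1 !mul1r invr1 mul1r.
set n := size s in szs *; have {}szs : n.+1 = (k + l)%N := szs.
rewrite wedge_altsum -szs altsum_cons.
rewrite -(big_mkord xpredT (fun p => (-1) ^+ p * altsum n (fun t =>
  feval lam (take k (take p t ++ x :: drop p t)) *
  feval mu (drop k (take p t ++ x :: drop p t))) s)).
rewrite (big_cat_nat (n := k)) //=; last by rewrite szs leq_addr.
rewrite mulrDr; congr (_ + _).
  case: k lam formlam szs => [|k] lam formlam szs; first by rewrite big_geq ?mulr0.
  have {}szs : n = (k + l)%N by case: szs.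
  have lekn : (k <= n)%N by rewrite szs leq_addr.
  transitivity (feval (interior x lam \wedge mu) s); last first.
    rewrite IHs //; last exact: is_form_interior.
    by congr shuffle; apply/funext => t; rewrite feval_interior.
  rewrite wedge_altsum -szs; set A := altsum _ _ _.
  rewrite (@eq_big_nat _ _ _ _ _ _ (fun=> A)) => [|p /andP[_ ltpk]].
    rewrite sumr_const_nat subn0 -[A *+ _]mulr_natl mulrA; congr (_ * _).
    by rewrite factS -mulnA natrM invfM mulrAC mulVf ?mul1r // pnatr_eq0.
  rewrite -altsumZ; apply: eq_altsum => t szt; rewrite ltnS in ltpk.
  have szp : size (take p t) = p by rewrite size_takel ?szt ?(leq_trans ltpk).
  rewrite take_cat drop_cat szp ltnNge leqW //= subSn //= mulrA.
  congr (_ * _); last by rewrite drop_drop subnK.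
  rewrite feval_to_front ?szp // mulrA -expr2 sqrr_sign mul1r feval_interior.
  congr (feval _ (_ :: _)).
  by rewrite -{3}(cat_take_drop p t) take_cat szp ltnNge ltpk.
case: l mu formmu szs => [|l] mu formmu szs.
  by rewrite szs addn0 big_geq ?mulr0.
have {}szs : n = (k + l)%N by move: szs; rewrite addnS => -[].
transitivity ((-1) ^+ k * feval (lam \wedge interior x mu) s); last first.
  rewrite IHs //; last exact: is_form_interior.
  by congr (_ * shuffle _ _ _ _ _); apply/funext => t; rewrite feval_interior.
rewrite wedge_altsum -szs; set A := altsum _ _ _.
rewrite (@eq_big_nat _ _ _ _ _ _ (fun=> (-1) ^+ k * A)) => [|p /andP[lekp ltpn]].
  rewrite sumr_const_nat szs -addnS addKn -[_ * A *+ _]mulr_natl.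
  rewrite factS mulnCA natrM invfM; set e := (-1) ^+ k; set c := (_ * _)%N%:R^-1.
  have nz_l : l.+1%:R != 0 :> R by rewrite pnatr_eq0.
  by move: e c nz_l => e c; move: (_%:R) => m; move: A => A nz_m; field.
rewrite -!altsumZ; apply: eq_altsum => t szt; rewrite ltnS in ltpn.
have szp : size (take p t) = p by rewrite size_takel ?szt.
have -> : take k (take p t ++ x :: drop p t) = take k t.
  by rewrite takel_cat ?szp // take_takel.
have -> : drop k (take p t ++ x :: drop p t) =
    take (p - k) (drop k t) ++ x :: drop (p - k) (drop k t).
  rewrite drop_cat szp drop_drop subnK // take_drop subnK //.
  case: ltngtP lekp => // -> _; rewrite subnn drop0.
  rewrite (@drop_oversize _ _ (take _ t)) ?cat0s //.
  by rewrite size_take_min geq_minl.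
have szpk : size (take (p - k) (drop k t)) = (p - k)%N.
  by rewrite size_takel // size_drop szt leq_sub2r.
rewrite feval_to_front // ?szpk; last by rewrite ltn_subLR // addnS ltnS -szs.
have <- : (-1) ^+ p * (-1) ^+ (p - k) = (-1) ^+ k :> R.
  by rewrite -exprD -signr_odd oddD oddB // addKb signr_odd.
by rewrite cat_take_drop feval_interior -!mulrA; congr (_ * _); rewrite mulrCA.
Qed.

End Wedge.

(** * Indices in {0, 1, 2} *)

Section Index3.

Lemma ord3P (P : 'I_3 -> Prop) : P 0 -> P 1 -> P 2 -> forall i, P i.
Proof.
move=> P0 P1 P2 [[|[|[|//]]] lti].
- by rewrite (_ : Ordinal _ = 0) //; apply: val_inj.
- by rewrite (_ : Ordinal _ = 1) //; apply: val_inj.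
- by rewrite (_ : Ordinal _ = 2) //; apply: val_inj.
Qed.

Lemma ord3E : (0 + 1 = 1 :> 'I_3) * (1 + 1 = 2 :> 'I_3) *
  (2 + 1 = 0 :> 'I_3) * (0 + 2 = 2 :> 'I_3) * (1 + 2 = 0 :> 'I_3) *
  (2 + 2 = 1 :> 'I_3).
Proof. by do !split; apply: val_inj. Qed.

Lemma eq_ord3E : ((0 == 1 :> 'I_3) = false) * ((0 == 2 :> 'I_3) = false) *
  ((1 == 0 :> 'I_3) = false) * ((1 == 2 :> 'I_3) = false) *
  ((2 == 0 :> 'I_3) = false) * ((2 == 1 :> 'I_3) = false) *
  ((0 == 0 :> 'I_3) = true) * ((1 == 1 :> 'I_3) = true) *
  ((2 == 2 :> 'I_3) = true).
Proof. by []. Qed.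

Lemma sum3 (V : nmodType) (F : 'I_3 -> V) : \sum_i F i = F 0 + F 1 + F 2.
Proof.
rewrite !big_ord_recl big_ord0 addr0 addrA.
by congr (F _ + F _ + F _); apply: val_inj.
Qed.

Let lift3E : (lift (0 : 'I_3) 0 = 1) * (lift (0 : 'I_3) 1 = 2) *
  (lift (1 : 'I_3) 0 = 0) * (lift (1 : 'I_3) 1 = 2) *
  (lift (2 : 'I_3) 0 = 0) * (lift (2 : 'I_3) 1 = 1).
Proof. by do !split; apply: val_inj. Qed.

Lemma det2 (R : comNzRingType) (M : 'M[R]_2) :
  \det M = M 0 0 * M 1 1 - M 0 1 * M 1 0.
Proof.
rewrite (expand_det_row _ 0) !big_ord_recl big_ord0 /cofactor !det_mx11 !mxE /=.
have -> : lift (0 : 'I_2) 0 = 1 by apply: val_inj.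
have -> : lift (1 : 'I_2) 0 = 0 by apply: val_inj.
by rewrite /= expr0 expr1; ring.
Qed.

Lemma det3 (R : comNzRingType) (M : 'M[R]_3) : \det M =
  M 0 0 * (M 1 1 * M 2 2 - M 1 2 * M 2 1)
  - M 0 1 * (M 1 0 * M 2 2 - M 1 2 * M 2 0)
  + M 0 2 * (M 1 0 * M 2 1 - M 1 1 * M 2 0).
Proof.
by rewrite (expand_det_row _ 0) sum3 /cofactor !det2 !mxE !lift3E /=; ring.
Qed.

(** Counting the indices modulo 3 absorbs the signs of the cofactors. *)
Lemma cofactor3 (R : comNzRingType) (M : 'M[R]_3) i j : cofactor M i j =
  M (i + 1) (j + 1) * M (i + 2) (j + 2) - M (i + 1) (j + 2) * M (i + 2) (j + 1).
Proof.
elim/ord3P: i; elim/ord3P: j; rewrite !ord3E /cofactor det2 !mxE ?lift3E /=;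
  ring.
Qed.

(** The sum over permutations is the determinant of the matrix whose rows select
    the entries i, j and k. *)
Lemma levi_civitaE (R : realType) (i j k : 'I_3) : levi_civita R i j k =
  ((j == i + 1) && (k == i + 2))%:R - ((j == i + 2) && (k == i + 1))%:R.
Proof.
have -> : levi_civita R i j k =
    \det (\matrix_(a, b) (b == tnth [tuple i; j; k] a)%:R : 'M[R]_3).
  rewrite /levi_civita /determinant big_mkcond; apply: eq_bigr => s _.
  have -> : \prod_a (\matrix_(a, b) (b == tnth [tuple i; j; k] a)%:R : 'M[R]_3)
      a (s a) = ([tuple s x | x < 3] == [tuple i; j; k])%:R.
    have [eqs|neqs] := eqVneq [tuple s x | x < 3] [tuple i; j; k].
      by rewrite big1 // => a _; rewrite mxE -eqs tnth_mktuple eqxx.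
    have [a nea] : exists a, s a != tnth [tuple i; j; k] a.
      apply/existsP; apply: contraR neqs => /existsPn eqs.
      apply/eqP/eq_from_tnth => a; rewrite tnth_mktuple.
      by apply/eqP; have := eqs a; rewrite negbK.
    by rewrite (bigD1 a) //= mxE (negPf nea) mul0r.
  by case: (_ == _); rewrite ?mulr1 ?mulr0.
rewrite det3 !mxE; have t0 : tnth [tuple i; j; k] 0 = i by [].
have t1 : tnth [tuple i; j; k] 1 = j by [].
have t2 : tnth [tuple i; j; k] 2 = k by [].
rewrite t0 t1 t2.
by elim/ord3P: i {t0 t1 t2}; elim/ord3P: j; elim/ord3P: k;
  rewrite !ord3E !eq_ord3E /=; ring.
Qed.

Lemma levi_civita_sum (R : realType) (W : lmodType R) (F : 'I_3 -> 'I_3 -> W) i :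
  \sum_j \sum_k levi_civita R i j k *: F j k =
  F (i + 1) (i + 2) - F (i + 2) (i + 1).
Proof.
under eq_bigr => j _ do under eq_bigr => k _ do rewrite levi_civitaE.
by elim/ord3P: i; rewrite !sum3 !ord3E !eq_ord3E /=
  ?(mulr1n, mulr0n, subrr, subr0, sub0r, scaleNr, scale1r, scale0r, add0r, addr0);
  rewrite // addrC.
Qed.

Lemma levi_civita_cycle (R : realType) i j k :
  levi_civita R i j k = levi_civita R k i j.
Proof.
rewrite !levi_civitaE.
by elim/ord3P: i; elim/ord3P: j; elim/ord3P: k; rewrite !ord3E !eq_ord3E.
Qed.

End Index3.

(** * Bilinearity of the exterior product and contractions *)

Section WedgeBilinear.
Context {R : realType} {V : vectType R} {k l : nat}.
Implicit Types (lam : kform V k) (mu : kform V l).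

Lemma wedgeDl lam1 lam2 mu :
  (lam1 + lam2) \wedge mu = lam1 \wedge mu + lam2 \wedge mu.
Proof.
apply/funext => v; rewrite /wedge -[RHS]mulrDr; congr (_ * _).
rewrite -big_split; apply: eq_bigr => q _ /=.
by rewrite -mulrDl -mulrDr.
Qed.

Lemma wedgeDr lam mu1 mu2 :
  lam \wedge (mu1 + mu2) = lam \wedge mu1 + lam \wedge mu2.
Proof.
apply/funext => v; rewrite /wedge -[RHS]mulrDr; congr (_ * _).
rewrite -big_split; apply: eq_bigr => q _ /=.
by rewrite -mulrDr.
Qed.

Lemma wedgeZl a lam mu : (a *: lam) \wedge mu = a *: (lam \wedge mu).
Proof.
apply/funext => v; rewrite /wedge -[RHS]mulrCA; congr (_ * _).
rewrite mulr_sumr; apply: eq_bigr => q _.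
by rewrite -[(a *: lam) _]/(a * lam _) mulrCA !mulrA.
Qed.

Lemma wedgeZr a lam mu : lam \wedge (a *: mu) = a *: (lam \wedge mu).
Proof.
apply/funext => v; rewrite /wedge -[RHS]mulrCA; congr (_ * _).
rewrite mulr_sumr; apply: eq_bigr => q _.
by rewrite -[(a *: mu) _]/(a * mu _) mulrCA.
Qed.

Lemma wedgeNr lam mu : lam \wedge (- mu) = - (lam \wedge mu).
Proof. by rewrite -scaleN1r wedgeZr scaleN1r. Qed.

Lemma wedge0l mu : (0 : kform V k) \wedge mu = 0.
Proof. by rewrite -(scale0r (0 : kform V k)) wedgeZl scale0r. Qed.

Lemma wedge0r lam : lam \wedge (0 : kform V l) = 0.
Proof. by rewrite -(scale0r (0 : kform V l)) wedgeZr scale0r. Qed.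

Lemma wedge_suml I (r : seq I) (P : pred I) (F : I -> kform V k) mu :
  (\sum_(i <- r | P i) F i) \wedge mu = \sum_(i <- r | P i) (F i \wedge mu).
Proof.
elim/big_rec2: _ => [|i lam nu _ <-]; first exact: wedge0l.
exact: wedgeDl.
Qed.

Lemma wedge_sumr I (r : seq I) (P : pred I) (F : I -> kform V l) lam :
  lam \wedge (\sum_(i <- r | P i) F i) = \sum_(i <- r | P i) (lam \wedge F i).
Proof.
elim/big_rec2: _ => [|i mu nu _ <-]; first exact: wedge0r.
exact: wedgeDr.
Qed.

(** Why the terms of the decompositions do not depend on the basis: two families
    indexed by the basis that transform by matrices inverse to each other, up to
    transposition and the scalar d, have an invariant contraction, up to d. *)
Lemma wedge_contract n (M N : 'M[R]_n) d (a : 'I_n -> kform V k)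
    (b : 'I_n -> kform V l) : M^T *m N = d%:M ->
  \sum_i (\sum_p M i p *: a p) \wedge (\sum_q N i q *: b q) =
  d *: \sum_p (a p \wedge b p).
Proof.
move=> MN; transitivity (\sum_p \sum_q (M^T *m N) p q *: (a p \wedge b q)).
  transitivity (\sum_i \sum_p \sum_q (M i p * N i q) *: (a p \wedge b q)).
    apply: eq_bigr => i _; rewrite wedge_suml; apply: eq_bigr => p _.
    rewrite wedge_sumr; apply: eq_bigr => q _.
    by rewrite wedgeZl wedgeZr scalerA.
  rewrite exchange_big; apply: eq_bigr => p _.
  rewrite exchange_big; apply: eq_bigr => q _.
  by rewrite mxE scaler_suml; apply: eq_bigr => i _; rewrite mxE.
rewrite MN scaler_sumr; apply: eq_bigr => p _.
rewrite (bigD1 p) //= big1 ?addr0 => [|q neq_qp]; first by rewrite mxE eqxx.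
by rewrite mxE eq_sym (negPf neq_qp) scale0r.
Qed.

End WedgeBilinear.

Section SmallForms.
Context {R : realType} {V : vectType R}.
Implicit Types (x y z : V).

Lemma feval_rep2 k (lam : kform V k.+2) x s : is_form lam ->
  feval lam (x :: x :: s) = 0.
Proof.
move=> [_ alt]; apply: (alt _ ord0 (lift ord0 ord0)) => //.
by rewrite !tnth_mktuple.
Qed.

Lemma feval_swap2 k (lam : kform V k.+2) x y s : is_form lam ->
  feval lam (x :: y :: s) = - feval lam (y :: x :: s).
Proof. by move=> formlam; apply: (feval_swap (s1 := [::])). Qed.

Lemma feval_swap3 k (lam : kform V k.+3) x y z s : is_form lam ->
  feval lam (x :: y :: z :: s) = - feval lam (x :: z :: y :: s).
Proof. by move=> formlam; apply: (feval_swap (s1 := [:: x])). Qed.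

Lemma feval_cycle3 k (lam : kform V k.+3) x y z s : is_form lam ->
  feval lam (x :: y :: z :: s) = feval lam (y :: z :: x :: s).
Proof.
by move=> formlam; rewrite feval_swap2 // feval_swap3 // opprK.
Qed.

Lemma tuple3E (U : 3.-tuple V) :
  U = [:: tnth U 0; tnth U 1; tnth U 2] :> seq V.
Proof.
apply: (@eq_from_nth _ 0) => [|i]; rewrite size_tuple // => lti.
by case: i lti => [|[|[|]]] //= _; rewrite (tnth_nth 0).
Qed.

Lemma feval_sum1 k (lam : kform V k.+1) I (r : seq I) (a : I -> R)
    (F : I -> V) s : is_form lam ->
  feval lam ((\sum_(i <- r) a i *: F i) :: s) =
  \sum_(i <- r) a i * feval lam (F i :: s).
Proof. by move=> formlam; apply: (feval_slot_sum (s1 := [::])). Qed.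

Lemma feval_sum2 k (lam : kform V k.+2) I (r : seq I) (a : I -> R)
    (F : I -> V) x s : is_form lam ->
  feval lam (x :: (\sum_(i <- r) a i *: F i) :: s) =
  \sum_(i <- r) a i * feval lam (x :: F i :: s).
Proof. by move=> formlam; apply: (feval_slot_sum (s1 := [:: x])). Qed.

(** Expanding both rows leaves, by antisymmetry, the 2x2 minors of P, which are
    its cofactors when the pairs of indices are labelled cyclically by the
    missing index. *)
Lemma plug_cofactor k (lam : kform V (2 + k)) (P : 'M[R]_3) (U : 'I_3 -> V) i :
  is_form lam ->
  @plug R V 2 k [tuple \sum_j P (i + 1) j *: U j; \sum_j P (i + 2) j *: U j] lam
  = \sum_j cofactor P i j *: @plug R V 2 k [tuple U (j + 1); U (j + 2)] lam.
Proof.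
move=> formlam; apply: kform_ext => s _; rewrite !fevalE /=.
under [RHS]eq_bigr => j _ do rewrite !fevalE cofactor3 /=.
rewrite feval_sum1 //; under [LHS]eq_bigr => j _ do rewrite feval_sum2 //.
rewrite !sum3 !ord3E !feval_rep2 // (feval_swap2 (U 1) (U 0)) //.
rewrite (feval_swap2 (U 2) (U 1)) // (feval_swap2 (U 0) (U 2)) //.
move: (feval _ _) (feval _ _) (feval _ _) => /= a b c; ring.
Qed.

Lemma is_form_plugr m k (lam : kform V (m + k)) (v : k.-tuple V) :
  is_form lam -> is_form (fun u : m.-tuple V => lam [tuple of u ++ v]).
Proof.
move=> [lin alt].
have set_cat (u : m.-tuple V) i x :
    [tuple of set_tnth u i x ++ v] = set_tnth [tuple of u ++ v] (lshift k i) x.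
  apply: eq_from_tnth => j; rewrite tnth_set.
  case: (split_ordP j) => a ->.
    by rewrite !tnth_lshift tnth_set (inj_eq (@lshift_inj _ _)).
  by rewrite !tnth_rshift eq_rlshift.
split=> [u i a x y|u i j neq_ij uij]; first by rewrite !set_cat lin.
apply: (alt _ (lshift k i) (lshift k j)); last by rewrite !tnth_lshift.
by rewrite (inj_eq (@lshift_inj _ _)).
Qed.

Lemma plug_det m k (lam : kform V (m + k)) (P : 'M[R]_m) (U : m.-tuple V) :
  is_form lam ->
  plug [tuple \sum_j P i j *: tnth U j | i < m] lam = \det P *: plug U lam.
Proof.
move=> formlam; apply/funext => v.
exact: (form_det _ _ (is_form_plugr v formlam)).
Qed.

End SmallForms.

(** * The forms attached to a triple of vectors *)

Lemma half_double (R : numFieldType) (W : lmodType R) (x : W) :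
  2^-1 *: (x + x) = x.
Proof. by rewrite -mulr2n -scaler_nat scalerA mulVf ?scale1r ?pnatr_eq0. Qed.

Section AssociatedFormsTheory.
Context {R : realType} {V : vectType R}.
Variables (phi : kform V 3) (psi : kform V 4).
Hypotheses (formphi : is_form phi) (formpsi : is_form psi).

Section FixedTriple.
Variable U : 3.-tuple V.
Local Notation c := (phi U).
Local Notation al := (alpha phi U).
Local Notation be := (beta psi U).
Local Notation om := (omega phi U).
Local Notation tom := (tomega phi psi U).
Local Notation u i := (tnth U i).

(** In this sum, as in those of omega, tomega and psi_term2, the two orders of a
    pair of indices contribute equally, which compensates the factor 1/2. *)
Lemma alphaE i : al i = @plug R V 2 1 [tuple u (i + 1); u (i + 2)] phi.
Proof.
rewrite /alpha levi_civita_sum; apply: kform_ext => s _; rewrite !fevalE /=.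
by rewrite [feval phi [:: u (i + 2), _ & _]]feval_swap2 // opprK; field.
Qed.

Lemma is_form_alpha i : is_form (al i).
Proof. by rewrite alphaE; apply: is_form_plug. Qed.

Lemma is_form_beta : is_form be.
Proof. exact: is_form_plug. Qed.

Lemma wedge11C (a b : kform V 1) : is_form a -> is_form b ->
  a \wedge b = - (b \wedge a).
Proof.
move=> fa fb; apply: kform_ext => s szs; rewrite fevalN_form !feval_wedge //.
by case: s szs => [|x [|y []]] //= _; ring.
Qed.

Lemma omegaE k : om k =
  - (c *: interior (u k) phi) + al (k + 1) \wedge al (k + 2).
Proof.
rewrite /omega; congr (_ + _).
have -> : \sum_i \sum_j levi_civita R i j k *: (al i \wedge al j) =
    \sum_i \sum_j levi_civita R k i j *: (al i \wedge al j).
  apply: eq_bigr => i _; apply: eq_bigr => j _.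
  by rewrite levi_civita_cycle.
rewrite levi_civita_sum [X in _ - X]wedge11C; try exact: is_form_alpha.
by rewrite opprK half_double.
Qed.

Lemma tomegaE k : tom k =
  - (c *: @plug R V 2 2 [tuple u (k + 1); u (k + 2)] psi) + al k \wedge be.
Proof.
rewrite /tomega; congr (- _ + _).
have -> : \sum_i \sum_j levi_civita R i j k *:
      @plug R V 2 2 [tuple u i; u j] psi =
    \sum_i \sum_j levi_civita R k i j *: @plug R V 2 2 [tuple u i; u j] psi.
  apply: eq_bigr => i _; apply: eq_bigr => j _.
  by rewrite levi_civita_cycle.
rewrite levi_civita_sum; apply: kform_ext => s _; rewrite !fevalE /=.
by rewrite [feval psi [:: u (k + 2), _ & _]]feval_swap2 // opprK; field.
Qed.

Lemma psi_term2E : psi_term2 phi psi U =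
  - ((c ^+ 3)^-1 *: \sum_i tom i \wedge (al (i + 1) \wedge al (i + 2))).
Proof.
rewrite /psi_term2 invfM mulrC -scalerA; congr (- (_ *: _)).
rewrite scaler_sumr; apply: eq_bigr => i _.
rewrite (levi_civita_sum (fun j k => tom i \wedge (al j \wedge al k))).
rewrite (wedge11C (is_form_alpha (i + 2)) (is_form_alpha (i + 1))).
by rewrite wedgeNr opprK half_double.
Qed.

Lemma is_form_omega k : is_form (om k).
Proof.
rewrite omegaE; apply: is_formD.
  by apply/is_formN/is_formZ/is_form_interior.
exact: (is_form_wedge (is_form_alpha _) (is_form_alpha _)).
Qed.

Lemma is_form_tomega k : is_form (tom k).
Proof.
rewrite tomegaE; apply: is_formD.
  by apply/is_formN/is_formZ/is_form_plug.
exact: (is_form_wedge (is_form_alpha _) is_form_beta).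
Qed.

Lemma feval_alpha i s :
  feval (al i) s = feval phi [:: u (i + 1), u (i + 2) & s].
Proof. by rewrite alphaE feval_plug. Qed.

Lemma feval_beta s : feval be s = feval psi [:: u 0, u 1, u 2 & s].
Proof. by rewrite /beta feval_plug tuple3E. Qed.

Lemma fevalU : c = feval phi [:: u 0; u 1; u 2].
Proof. by rewrite -tuple3E feval_tuple. Qed.

(** Either a vector is repeated, or the three vectors are cyclically permuted.
    The horizontality of omega, tomega and Omega rests on this relation. *)
Lemma alphaU i j : feval (al i) [:: u j] = c *+ (i == j).
Proof.
rewrite feval_alpha fevalU.
elim/ord3P: i; elim/ord3P: j; rewrite !ord3E !eq_ord3E ?mulr1n ?mulr0n //=.
- by rewrite -feval_cycle3.
- by apply: feval_repeat => //=; rewrite !inE eqxx ?orbT /= ?andbF.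
- by apply: feval_repeat => //=; rewrite !inE eqxx ?orbT /= ?andbF.
- by apply: feval_repeat => //=; rewrite !inE eqxx ?orbT /= ?andbF.
- by rewrite feval_cycle3.
- by apply: feval_repeat => //=; rewrite !inE eqxx ?orbT /= ?andbF.
- by apply: feval_repeat => //=; rewrite !inE eqxx ?orbT /= ?andbF.
- by apply: feval_repeat => //=; rewrite !inE eqxx ?orbT /= ?andbF.
Qed.

Lemma betaU j : feval be [:: u j] = 0.
Proof.
rewrite feval_beta; elim/ord3P: j; apply: feval_repeat => //=;
by rewrite !inE eqxx ?orbT /= ?andbF.
Qed.

Lemma feval_omega k x y : feval (om k) [:: x; y] =
  - (c * feval phi [:: u k; x; y]) + (feval (al (k + 1)) [:: x] *
     feval (al (k + 2)) [:: y] - feval (al (k + 1)) [:: y] *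
     feval (al (k + 2)) [:: x]).
Proof.
rewrite omegaE fevalD_form (@feval_wedge _ _ 1 1) //; try exact: is_form_alpha.
by rewrite fevalN_form (fevalZ_form c (interior (u k) phi)) feval_interior /=; ring.
Qed.

Lemma feval_tomega k x y : feval (tom k) [:: x; y] =
  - (c * feval psi [:: u (k + 1); u (k + 2); x; y]) +
    (feval (al k) [:: x] * feval be [:: y] -
     feval (al k) [:: y] * feval be [:: x]).
Proof.
rewrite tomegaE fevalD_form (@feval_wedge _ _ 1 1) //; last exact: is_form_beta;
  last exact: is_form_alpha.
rewrite fevalN_form (fevalZ_form c (@plug R V 2 2 _ psi)) feval_plug /=; ring.
Qed.

(** For j != k, contracting alpha^{k+1} /\ alpha^{k+2} with U_j leaves c alpha^i
    up to sign, with i the third index, and this is c phi(U_k, U_j, -). *)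
Lemma omegaU k j x : feval (om k) [:: u j; x] = 0.
Proof.
rewrite feval_omega !alphaU !feval_alpha.
elim/ord3P: k; elim/ord3P: j; rewrite !ord3E !eq_ord3E ?mulr1n ?mulr0n //=.
- by rewrite feval_rep2 //; ring.
- by ring.
- by rewrite [feval phi [:: u 2, _ & _]]feval_swap2 //; ring.
- by rewrite [feval phi [:: u 1, _ & _]]feval_swap2 //; ring.
- by rewrite feval_rep2 //; ring.
- by ring.
- by ring.
- by rewrite [feval phi [:: u 2, _ & _]]feval_swap2 //; ring.
- by rewrite feval_rep2 //; ring.
Qed.

(** Contracting alpha^k /\ beta with U_j leaves c beta for j = k, and
    beta = psi(U_0, U_1, U_2, -) is then also the contraction of the first
    summand, up to its coefficient - c. *)
Lemma tomegaU k j x : feval (tom k) [:: u j; x] = 0.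
Proof.
rewrite feval_tomega alphaU betaU feval_beta mulr0 subr0.
elim/ord3P: k; elim/ord3P: j; rewrite !ord3E !eq_ord3E ?mulr1n ?mulr0n ?mul0r
  ?addr0 /=; try by rewrite [feval _ _]feval_repeat ?mulr0 ?oppr0 //=;
  rewrite !inE eqxx ?orbT /= ?andbF.
- by rewrite -feval_cycle3 // addNr.
- by rewrite feval_cycle3 // addNr.
- by rewrite addNr.
Qed.

End FixedTriple.
End AssociatedFormsTheory.

(** * The remainders of the two decompositions *)

Section Contractions.
Context {R : realType} {V : vectType R}.
Variables (phi : kform V 3) (psi : kform V 4) (U : 3.-tuple V).
Hypotheses (formphi : is_form phi) (formpsi : is_form psi).
Local Notation c := (phi U).
Local Notation al := (alpha phi U).
Local Notation be := (beta psi U).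
Local Notation om := (omega phi U).
Local Notation tom := (tomega phi psi U).
Local Notation u i := (tnth U i).
Local Notation a i x := (feval (alpha phi U i) [:: x]).
Local Notation b x := (feval (beta psi U) [:: x]).
Let fal i : is_form (al i) := is_form_alpha formphi U i.
Let fbe : is_form be := is_form_beta formpsi U.
Let fom i : is_form (om i) := is_form_omega formphi U i.
Let ftom i : is_form (tom i) := is_form_tomega formphi formpsi U i.

Lemma feval_alpha2 i j x y :
  feval (al i \wedge al j) [:: x; y] = a i x * a j y - a i y * a j x.
Proof. by rewrite feval_wedge //=; ring. Qed.

Lemma feval_alpha123 x y z : feval (alpha123 phi U) [:: x; y; z] =
  (a 0 x * a 1 y - a 0 y * a 1 x) * a 2 z
  - (a 0 x * a 1 z - a 0 z * a 1 x) * a 2 y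
  + (a 0 y * a 1 z - a 0 z * a 1 y) * a 2 x.
Proof.
rewrite /alpha123 (@feval_wedge _ _ 2 1) //;
  last exact: (is_form_wedge (fal 0) (fal 1)).
by rewrite /= !feval_alpha2; ring.
Qed.

Lemma is_form_alpha123 : is_form (alpha123 phi U).
Proof. exact: (is_form_wedge (is_form_wedge (fal 0) (fal 1)) (fal 2)). Qed.

Lemma is_form_phi_term1 : is_form (phi_term1 phi U).
Proof. exact/is_formZ/is_form_alpha123. Qed.

Lemma is_form_phi_term2 : is_form (phi_term2 phi U).
Proof.
apply/is_formN/is_formZ/is_form_sum => i _.
exact: (is_form_wedge (fal i) (fom i)).
Qed.

Lemma is_form_Omega : is_form (Omega phi U).
Proof.
by apply: is_formD => //; apply/is_formN/is_formD;
  [apply: is_form_phi_term1 | apply: is_form_phi_term2].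
Qed.

Lemma is_form_barOmega : is_form (barOmega phi psi U).
Proof.
apply: is_formD => //; apply/is_formN/is_formD; first apply/is_formD.
- exact/is_formN/is_formZ/(is_form_wedge fbe)/is_form_alpha123.
- rewrite psi_term2E //; apply/is_formN/is_formZ/is_form_sum => i _.
  exact: (is_form_wedge (ftom i) (is_form_wedge (fal _) (fal _))).
- apply/is_formN/is_formZ/is_form_sum => i _.
  exact: (is_form_wedge (is_form_wedge (fom i) fbe) (fal i)).
Qed.

(** The components of alpha, beta, omega and tomega enter as arbitrary functions
    A, B, O and T, so that the identities below are polynomial identities between
    atoms. *)
Section Components.
Variables (A : 'I_3 -> V -> R) (B : V -> R) (O T : 'I_3 -> V -> V -> R).
Hypotheses (aA : forall i x, a i x = A i x) (bB : forall x, b x = B x).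
Hypothesis oO : forall i x y, feval (om i) [:: x; y] = O i x y.
Hypothesis tT : forall i x y, feval (tom i) [:: x; y] = T i x y.

Let A123 x y z := (A 0 x * A 1 y - A 0 y * A 1 x) * A 2 z
  - (A 0 x * A 1 z - A 0 z * A 1 x) * A 2 y
  + (A 0 y * A 1 z - A 0 z * A 1 y) * A 2 x.

Let a123 x y z : feval (alpha123 phi U) [:: x; y; z] = A123 x y z.
Proof. by rewrite feval_alpha123 !aA. Qed.

Lemma feval_Omega x y z : feval (Omega phi U) [:: x; y; z] =
  feval phi [:: x; y; z] - (c ^+ 2)^-1 *
   (A123 x y z
    - \sum_i (A i x * O i y z - A i y * O i x z + A i z * O i x y)).
Proof.
have -> : feval (Omega phi U) [:: x; y; z] = feval phi [:: x; y; z]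
  - ((c ^+ 2)^-1 * feval (alpha123 phi U) [:: x; y; z]
    - (c ^+ 2)^-1 * feval (\sum_i (al i \wedge om i)) [:: x; y; z]) by [].
rewrite -mulrBr feval_sum_form a123; congr (_ - _ * (_ - _)).
by apply: eq_bigr => i _; rewrite (@feval_wedge _ _ 1 2) //= !aA !oO; ring.
Qed.

Lemma feval_barOmega x y z w : feval (barOmega phi psi U) [:: x; y; z; w] =
  feval psi [:: x; y; z; w] + (c ^+ 3)^-1 *
   ((B x * A123 y z w - B y * A123 x z w + B z * A123 x y w - B w * A123 x y z)
   + \sum_i
    (T i x y * (A (i + 1) z * A (i + 2) w - A (i + 1) w * A (i + 2) z)
    - T i x z * (A (i + 1) y * A (i + 2) w - A (i + 1) w * A (i + 2) y)
    + T i x w * (A (i + 1) y * A (i + 2) z - A (i + 1) z * A (i + 2) y)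
    + T i y z * (A (i + 1) x * A (i + 2) w - A (i + 1) w * A (i + 2) x)
    - T i y w * (A (i + 1) x * A (i + 2) z - A (i + 1) z * A (i + 2) x)
    + T i z w * (A (i + 1) x * A (i + 2) y - A (i + 1) y * A (i + 2) x))
   + \sum_i
    (O i x y * (B z * A i w - B w * A i z)
    - O i x z * (B y * A i w - B w * A i y)
    + O i x w * (B y * A i z - B z * A i y)
    + O i y z * (B x * A i w - B w * A i x)
    - O i y w * (B x * A i z - B z * A i x)
    + O i z w * (B x * A i y - B y * A i x))).
Proof.
rewrite /barOmega psi_term2E //.
have E (f f1 f2 f3 : kform V 4) (d : R) s :
   feval (f - (- (d *: f1) - (d *: f2) - (d *: f3))) s =
   feval f s + d * (feval f1 s + feval f2 s + feval f3 s).
  transitivity (feval f s -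
    (- (d * feval f1 s) - (d * feval f2 s) - (d * feval f3 s))) => //.
  by ring.
rewrite [LHS]E !feval_sum_form; congr (_ + _ * (_ + _ + _)).
- rewrite (@feval_wedge _ _ 1 3) //=; last exact: is_form_alpha123.
  by rewrite !a123 !bB; ring.
- apply: eq_bigr => i _.
  rewrite (@feval_wedge _ _ 2 2) //; last exact: (is_form_wedge (fal _) (fal _)).
  by rewrite /= !feval_alpha2 !aA !tT; ring.
apply: eq_bigr => i _.
rewrite (@feval_wedge _ _ 3 1) //; last exact: (is_form_wedge (fom _) fbe).
have omb p q r : feval (om i \wedge be) [:: p; q; r] =
    O i p q * B r - O i p r * B q + O i q r * B p.
  by rewrite (@feval_wedge _ _ 2 1) //= !oO !bB; ring.
by rewrite /= !omb !aA; ring.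
Qed.

End Components.

(** Hides the definitions of the forms behind the functions used in
    [feval_barOmega]. *)
Lemma components :
  (exists A : 'I_3 -> V -> R, forall i x, a i x = A i x) /\
  (exists B : V -> R, forall x, b x = B x) /\
  (exists O : 'I_3 -> V -> V -> R, forall i x y, feval (om i) [:: x; y] = O i x y) /\
  (exists T : 'I_3 -> V -> V -> R, forall i x y, feval (tom i) [:: x; y] = T i x y).
Proof.
split; first by exists (fun i x => a i x).
split; first by exists (fun x => b x).
split; first by exists (fun i x y => feval (om i) [:: x; y]).
by exists (fun i x y => feval (tom i) [:: x; y]).
Qed.

(** By horizontality of omega, the contraction of the two terms subtracted from
    phi with U_j is that of alpha123 / c^2 minus omega_j / c. The definition
    of omega_j makes it phi(U_j, -, -). *)
Lemma OmegaU j x y : c != 0 -> feval (Omega phi U) [:: u j; x; y] = 0.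
Proof.
have [A aA] : exists A : 'I_3 -> V -> R, forall i x, a i x = A i x.
  by exists (fun i x => a i x).
have [Om oO] : exists O : 'I_3 -> V -> V -> R,
    forall i x y, feval (om i) [:: x; y] = O i x y.
  by exists (fun i x y => feval (om i) [:: x; y]).
move=> nz_c.
have AU i k : A i (u k) = c *+ (i == k) by rewrite -aA alphaU.
have OU i k z : Om i (u k) z = 0 by rewrite -oO omegaU.
have OE k z w : Om k z w = - (c * feval phi [:: u k; z; w]) +
    (A (k + 1) z * A (k + 2) w - A (k + 1) w * A (k + 2) z).
  by rewrite -oO feval_omega // !aA.
rewrite (feval_Omega aA oO) sum3 !OU !AU OE OE OE.
by elim/ord3P: j; rewrite !ord3E !eq_ord3E ?mulr1n ?mulr0n /=; field.
Qed.

(** After contraction with U_j and U_k, j != k, the three terms subtracted from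
    psi leave a multiple of beta /\ alpha^i, a multiple of tomega^i, and 0, with i
    the third index. By the definition of tomega^i their sum is
    psi(U_j, U_k, -, -). *)
Lemma barOmegaUU j k x y : c != 0 ->
  feval (barOmega phi psi U) [:: u j; u k; x; y] = 0.
Proof.
case: components => -[A aA] [[B bB]] [[Om oO]] [T tT] nz_c.
have AU i l : A i (u l) = c *+ (i == l) by rewrite -aA alphaU.
have BU l : B (u l) = 0 by rewrite -bB betaU.
have OU i l z : Om i (u l) z = 0 by rewrite -oO omegaU.
have TU i l z : T i (u l) z = 0 by rewrite -tT tomegaU.
have TE i z w : T i z w = - (c * feval psi [:: u (i + 1); u (i + 2); z; w])
    + (A i z * B w - A i w * B z).
  by rewrite -tT feval_tomega // !aA !bB.
rewrite (feval_barOmega aA bB oO tT) !sum3 !TU !OU !BU !AU !ord3E.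
have simp := (mul0r, mulr0, subr0, sub0r, add0r, addr0, oppr0).
elim/ord3P: j; elim/ord3P: k; rewrite !eq_ord3E ?mulr1n ?mulr0n /= ?simp.
- by rewrite feval_rep2.
- by rewrite TE !ord3E; field.
- by rewrite TE !ord3E feval_swap2 //; field.
- by rewrite TE !ord3E feval_swap2 //; field.
- by rewrite feval_rep2.
- by rewrite TE !ord3E; field.
- by rewrite TE !ord3E; field.
- by rewrite TE !ord3E feval_swap2 //; field.
- by rewrite feval_rep2.
Qed.

End Contractions.

(** * Change of basis *)

Section ChangeOfBasis.
Context {R : realType} {V : vectType R}.
Variables (phi : kform V 3) (psi : kform V 4) (U : 3.-tuple V) (P : 'M[R]_3).
Hypotheses (formphi : is_form phi) (formpsi : is_form psi).
Let U' : 3.-tuple V := [tuple \sum_j P i j *: tnth U j | i < 3].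
Local Notation d := (\det P).

Let U'E i : tnth U' i = \sum_j P i j *: tnth U j.
Proof. by rewrite tnth_mktuple. Qed.

Lemma vol_change : phi U' = d * phi U.
Proof. exact: form_det. Qed.

Lemma alpha_change i : alpha phi U' i = \sum_j cofactor P i j *: alpha phi U j.
Proof.
rewrite alphaE // !U'E (@plug_cofactor _ _ 1) //.
by apply: eq_bigr => j _; rewrite alphaE.
Qed.

Lemma beta_change : beta psi U' = d *: beta psi U.
Proof. exact: (@plug_det _ _ 3 1). Qed.

(** The 2x2 minors of the cofactor matrix are the entries of P, up to the factor
    d. *)
Lemma alpha2_change i :
  alpha phi U' (i + 1) \wedge alpha phi U' (i + 2) = d *: \sum_j P i j *:
    (alpha phi U (j + 1) \wedge alpha phi U (j + 2)).
Proof.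
have fal := is_form_alpha formphi U.
apply: kform_ext => s szs; case: s szs => [|x [|y []]] // _.
rewrite !alpha_change [RHS](fevalZ_form d) feval_sum_form.
transitivity (\sum_p \sum_q cofactor P (i + 1) p * (cofactor P (i + 2) q *
    feval (alpha phi U p \wedge alpha phi U q) [:: x; y])).
  rewrite wedge_suml feval_sum_form; apply: eq_bigr => p _.
  rewrite wedge_sumr feval_sum_form; apply: eq_bigr => q _.
  by rewrite wedgeZl wedgeZr.
under eq_bigr => p _ do under eq_bigr => q _ do rewrite feval_alpha2 //.
transitivity (d * \sum_j P i j * feval (alpha phi U (j + 1) \wedge
  alpha phi U (j + 2)) [:: x; y]) => //.
under [in RHS]eq_bigr => j _ do rewrite feval_alpha2 //.
rewrite !sum3 !cofactor3 det3.
move: (feval (alpha phi U 0) [:: x]) (feval (alpha phi U 1) [:: x])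
  (feval (alpha phi U 2) [:: x]) (feval (alpha phi U 0) [:: y])
  (feval (alpha phi U 1) [:: y]) (feval (alpha phi U 2) [:: y]) => x0 x1 x2 y0 y1 y2.
by elim/ord3P: i; rewrite !ord3E; ring.
Qed.

Let scale_comb (W : lmodType R) a b (x y : W) :
  - (a *: (b *: x)) + b *: y = b *: (- (a *: x) + y).
Proof. by rewrite scalerDr scalerN !scalerA mulrC. Qed.

Lemma omega_change k : omega phi U' k = d *: \sum_j P k j *: omega phi U j.
Proof.
have intE : interior (tnth U' k) phi = \sum_j P k j *: interior (tnth U j) phi.
  apply: kform_ext => s _; rewrite feval_interior U'E feval_sum1 // feval_sum_form.
  by apply: eq_bigr => j _; rewrite -feval_interior.
under eq_bigr => j _ do rewrite omegaE //.
rewrite omegaE // alpha2_change vol_change intE -scalerA -scalerN -scalerDr.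
congr (_ *: _); rewrite scaler_sumr -sumrN -big_split; apply: eq_bigr => j _ /=.
exact: scale_comb.
Qed.

Lemma tomega_change k :
  tomega phi psi U' k = d *: \sum_j cofactor P k j *: tomega phi psi U j.
Proof.
under eq_bigr => j _ do rewrite tomegaE //.
rewrite tomegaE // !U'E (@plug_cofactor _ _ 2) // alpha_change beta_change vol_change.
rewrite wedgeZr wedge_suml -scalerA -scalerN -scalerDr.
congr (_ *: _); rewrite scaler_sumr -sumrN -big_split; apply: eq_bigr => j _ /=.
by rewrite wedgeZl; apply: scale_comb.
Qed.

Let contract_adj : (\adj P)^T^T *m P = d%:M.
Proof. by rewrite trmxK mul_adj_mx. Qed.

Let contract_adj' : P^T *m (\adj P)^T = d%:M.
Proof. by rewrite -trmx_mul mul_adj_mx tr_scalar_mx. Qed.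

Hypothesis nz_d : d != 0.

(** The determinant of the cofactor matrix is d^2. *)
Lemma alpha123_change : alpha123 phi U' = d ^+ 2 *: alpha123 phi U.
Proof.
have fal := is_form_alpha formphi U; have fal' := is_form_alpha formphi U'.
apply: kform_ext => s szs; case: s szs => [|x [|y [|z []]]] // _.
rewrite feval_alpha123 // (fevalZ_form (d ^+ 2)) feval_alpha123 //.
pose M W : 'M[R]_3 := \matrix_(i, j) feval (alpha phi W i) [:: tnth [tuple x; y; z] j].
have detM W :
    let a i v := feval (alpha phi W i) [:: v] in
    (a 0 x * a 1 y - a 0 y * a 1 x) * a 2 z
    - (a 0 x * a 1 z - a 0 z * a 1 x) * a 2 y
    + (a 0 y * a 1 z - a 0 z * a 1 y) * a 2 x = \det (M W).
  by rewrite /= det3 !mxE; ring.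
rewrite !detM; have -> : M U' = (\adj P)^T *m M U.
  apply/matrixP => i j; rewrite !mxE alpha_change feval_sum_form.
  by apply: eq_bigr => l _; rewrite !mxE.
rewrite det_mulmx; congr (_ * _); apply: (mulIf nz_d).
by rewrite -det_tr -det_mulmx contract_adj det_scalar -exprSr.
Qed.

Let cancel_d n : ((d * phi U) ^+ n)^-1 * d ^+ n = (phi U ^+ n)^-1.
Proof.
by rewrite exprMn invfM mulrAC mulVf ?mul1r // expf_eq0 (negPf nz_d) andbF.
Qed.

Lemma phi_term1_change : phi_term1 phi U' = phi_term1 phi U.
Proof.
by rewrite /phi_term1 alpha123_change vol_change scalerA cancel_d.
Qed.

Lemma phi_term2_change : phi_term2 phi U' = phi_term2 phi U.
Proof.
rewrite /phi_term2; congr (- _).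
have -> : \sum_i alpha phi U' i \wedge omega phi U' i =
    d ^+ 2 *: \sum_i alpha phi U i \wedge omega phi U i.
  under eq_bigr => i _ do rewrite alpha_change omega_change wedgeZr.
  rewrite -scaler_sumr expr2 -scalerA; congr (_ *: _).
  rewrite -(wedge_contract _ _ contract_adj).
  by apply: eq_bigr => i _; congr wedge; apply: eq_bigr => j _; rewrite !mxE.
by rewrite vol_change scalerA cancel_d.
Qed.

Lemma Omega_change : Omega phi U' = Omega phi U.
Proof. by rewrite /Omega phi_term1_change phi_term2_change. Qed.

Lemma psi_term1_change : psi_term1 phi psi U' = psi_term1 phi psi U.
Proof.
rewrite /psi_term1 alpha123_change beta_change wedgeZl wedgeZr vol_change.
by rewrite (scalerA d) -exprS scalerA cancel_d.
Qed.

Lemma psi_term2_change : psi_term2 phi psi U' = psi_term2 phi psi U.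
Proof.
rewrite !psi_term2E //; congr (- _).
have -> : \sum_i tomega phi psi U' i \wedge
      (alpha phi U' (i + 1) \wedge alpha phi U' (i + 2)) =
    d ^+ 3 *: \sum_i tomega phi psi U i \wedge
      (alpha phi U (i + 1) \wedge alpha phi U (i + 2)).
  under eq_bigr => i _ do rewrite tomega_change alpha2_change wedgeZl wedgeZr.
  rewrite -2!scaler_sumr scalerA -expr2 (exprSr d 2) -(scalerA (d ^+ 2) d).
  congr (_ *: _).
  rewrite -(wedge_contract _ _ contract_adj).
  by apply: eq_bigr => i _; congr wedge; apply: eq_bigr => j _; rewrite !mxE.
by rewrite vol_change scalerA cancel_d.
Qed.

Lemma psi_term3_change : psi_term3 phi psi U' = psi_term3 phi psi U.
Proof.
rewrite /psi_term3; congr (- _).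
have -> : \sum_i (omega phi U' i \wedge beta psi U' \wedge alpha phi U' i) =
    d ^+ 3 *: \sum_i (omega phi U i \wedge beta psi U \wedge alpha phi U i).
  have omega_beta i : omega phi U' i \wedge beta psi U' =
      d ^+ 2 *: \sum_j P i j *: (omega phi U j \wedge beta psi U).
    rewrite omega_change beta_change wedgeZr wedgeZl scalerA -expr2 wedge_suml.
    by congr (_ *: _); apply: eq_bigr => j _; rewrite wedgeZl.
  under eq_bigr => i _ do rewrite omega_beta alpha_change wedgeZl.
  rewrite -scaler_sumr (exprSr d 2) -(scalerA (d ^+ 2) d); congr (_ *: _).
  rewrite -(wedge_contract _ _ contract_adj').
  apply: eq_bigr => i _; congr wedge; apply: eq_bigr => j _.
  by rewrite !mxE.
by rewrite vol_change scalerA cancel_d.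
Qed.

Lemma barOmega_change : barOmega phi psi U' = barOmega phi psi U.
Proof.
by rewrite /barOmega psi_term1_change psi_term2_change psi_term3_change.
Qed.

End ChangeOfBasis.

(** * Adapted bases *)

Section StandardForm.
Context {R : realType} {V : vectType R}.

(** The value of the standard 3-form on three vectors with coordinates X, Y, Z in
    the basis dual to e^1, ..., e^7, the indices being counted from 0. *)
Definition standard_form (K : comNzRingType) (X Y Z : nat -> K) : K :=
  let D p q r := X p * (Y q * Z r - Z q * Y r) - Y p * (X q * Z r - Z q * X r)
     + Z p * (X q * Y r - Y q * X r) in
  D 0%N 1%N 2%N - (D 0%N 3%N 4%N + D 0%N 5%N 6%N)
    - (D 1%N 3%N 5%N + D 1%N 6%N 4%N) - (D 2%N 3%N 6%N + D 2%N 4%N 5%N).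

(** The multiplication table of the imaginary octonions in an adapted basis: the
    entry (s, k) in position (i, j) stands for the cross product
    b_i x b_j = s b_k. *)
Definition cross7 (i j : nat) : int * nat :=
  nth (0, 0%N) (nth [::]
    [:: [:: (0, 0%N); (1, 2%N); (- 1, 1%N); (- 1, 4%N); (1, 3%N); (- 1, 6%N); (1, 5%N)];
      [:: (- 1, 2%N); (0, 0%N); (1, 0%N); (- 1, 5%N); (1, 6%N); (1, 3%N); (- 1, 4%N)];
      [:: (1, 1%N); (- 1, 0%N); (0, 0%N); (- 1, 6%N); (- 1, 5%N); (1, 4%N); (1, 3%N)];
      [:: (1, 4%N); (1, 5%N); (1, 6%N); (0, 0%N); (- 1, 0%N); (- 1, 1%N); (- 1, 2%N)];
      [:: (- 1, 3%N); (- 1, 6%N); (1, 5%N); (1, 0%N); (0, 0%N); (- 1, 2%N); (1, 1%N)];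
      [:: (1, 6%N); (- 1, 3%N); (- 1, 4%N); (1, 1%N); (1, 2%N); (0, 0%N); (- 1, 0%N)];
      [:: (- 1, 5%N); (1, 4%N); (- 1, 3%N); (1, 2%N); (- 1, 1%N); (1, 0%N); (0, 0%N)]] i) j.

Definition phi7 (i j k : nat) : int :=
  (cross7 i j).1 * (k == (cross7 i j).2)%:Z.

Definition adapted (phi : kform V 3) (b : seq V) :=
  forall i j k, feval phi [:: b`_i; b`_j; b`_k] = (phi7 i j k)%:~R.

(** The default values of lists and table entries make the extension to large
    indices hold. *)
Lemma adapted7 (phi : kform V 3) (b : seq V) : is_form phi -> size b = 7%N ->
  (forall i j k, (i < 7)%N -> (j < 7)%N -> (k < 7)%N ->
    feval phi [:: b`_i; b`_j; b`_k] = (phi7 i j k)%:~R) ->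
  adapted phi b.
Proof.
move=> formphi szb small i j k.
have [lti|gei] := ltnP i 7; last first.
  rewrite (nth_default 0) ?szb // (@feval_slot0 _ _ _ phi [::]) //.
  by rewrite /phi7 /cross7 (nth_default [::]) // nth_nil mul0r.
have [ltj|gej] := ltnP j 7; last first.
  rewrite (nth_default 0 (n := j)) ?szb // (@feval_slot0 _ _ _ phi [:: _]) //.
  suff -> : phi7 i j k = 0 by [].
  rewrite /phi7 /cross7.
  by do 7?[case: i lti => [|i] lti]; rewrite // (nth_default (0, 0%N)) ?mul0r.
have [ltk|gek] := ltnP k 7; first exact: small.
rewrite (nth_default 0 (n := k)) ?szb // (@feval_slot0 _ _ _ phi [:: _; _]) //.
suff -> : phi7 i j k = 0 by [].
have : ((cross7 i j).2 < 7)%N.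
  by case: i lti => [|[|[|[|[|[|[|]]]]]]] // _;
     case: j ltj => [|[|[|[|[|[|[|]]]]]]].
rewrite /phi7; case: (cross7 i j) => s l /= ltl.
by rewrite gtn_eqF ?mulr0 // (leq_trans ltl).
Qed.

Lemma is_form_of (f : 'Hom(V, R^o)) : is_form (form_of f).
Proof.
split=> [v i a x y|v i j]; last by rewrite !ord1.
by rewrite /form_of /thead !tnth_set !ord1 eqxx linearP.
Qed.

Lemma feval_of (f : 'Hom(V, R^o)) x : feval (form_of f) [:: x] = f x.
Proof. by rewrite /feval /form_of /thead tnth_mktuple. Qed.

Section FromDefinition.
Variables (phi : kform V 3) (e : 7.-tuple 'Hom(V, R^o)).
Local Notation E i := (form_of e`_i).
Hypothesis phiE : phi = (E 0 \wedge E 1 \wedge E 2 : kform V 3)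
  - (E 0 \wedge (E 3 \wedge E 4 + E 5 \wedge E 6) : kform V 3)
  - (E 1 \wedge (E 3 \wedge E 5 + E 6 \wedge E 4) : kform V 3)
  - (E 2 \wedge (E 3 \wedge E 6 + E 4 \wedge E 5) : kform V 3).

Lemma is_form_standard : is_form phi.
Proof.
have f2 (a b a' b' : 'Hom(V, R^o)) :=
  is_formD (is_form_wedge (is_form_of a) (is_form_of b))
    (is_form_wedge (is_form_of a') (is_form_of b')).
rewrite phiE; apply: is_formD; first apply: is_formD; first apply: is_formD.
- exact: (is_form_wedge (is_form_wedge (is_form_of _) (is_form_of _)) (is_form_of _)).
- exact/is_formN/(is_form_wedge (is_form_of _))/f2.
- exact/is_formN/(is_form_wedge (is_form_of _))/f2.
- exact/is_formN/(is_form_wedge (is_form_of _))/f2.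
Qed.

Lemma feval_standard x y z : feval phi [:: x; y; z] =
  standard_form (fun i => e`_i x : R) (fun i => e`_i y) (fun i => e`_i z).
Proof.
rewrite /standard_form.
have w2 (a b : 'Hom(V, R^o)) x1 x2 :
  feval (form_of a \wedge form_of b) [:: x1; x2] = (a x1 : R) * b x2 - (a x2 : R) * b x1.
  rewrite feval_wedge //=; try exact: is_form_of.
  by rewrite !feval_of; ring.
have f2 (a b : 'Hom(V, R^o)) := is_form_wedge (is_form_of a) (is_form_of b).
have w21 (a b d : 'Hom(V, R^o)) :
  feval (form_of a \wedge form_of b \wedge form_of d) [:: x; y; z] =
  ((a x : R) * b y - (a y : R) * b x) * d z - ((a x : R) * b z - (a z : R) * b x) * d y
  + ((a y : R) * b z - (a z : R) * b y) * d x.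
  rewrite (feval_wedge (f2 a b) (is_form_of d)) //=.
  by rewrite !w2 !feval_of; ring.
have w12 (a b d b' d' : 'Hom(V, R^o)) :
  feval (form_of a \wedge (form_of b \wedge form_of d + form_of b' \wedge form_of d'))
     [:: x; y; z] =
  let D u v := ((b u : R) * d v - (b v : R) * d u)
    + ((b' u : R) * d' v - (b' v : R) * d' u) in
  (a x : R) * D y z - (a y : R) * D x z + (a z : R) * D x y.
  rewrite wedgeDr fevalD_form (feval_wedge (is_form_of a) (f2 b d)) //.
  rewrite (feval_wedge (is_form_of a) (f2 b' d')) //=.
  by rewrite !w2 !feval_of; ring.
rewrite phiE; set p := _ \wedge _; set q := _ \wedge _.
set r := _ \wedge _; set t := _ \wedge _.
transitivity (feval p [:: x; y; z] - feval q [:: x; y; z] - feval r [:: x; y; z]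
 - feval t [:: x; y; z]) => //.
rewrite /p /q /r /t w21 !w12 /=; ring.
Qed.

(** A finite verification on integers. *)
Lemma standard_form_delta i j k : (i < 7)%N -> (j < 7)%N -> (k < 7)%N ->
  standard_form (fun p => (p == i)%:Z) (fun p => (p == j)%:Z)
    (fun p => (p == k)%:Z) = phi7 i j k.
Proof.
move=> lti ltj ltk; apply/eqP; move: i lti j ltj k ltk.
suff /allP all7 : all (fun i => all (fun j => all (fun k =>
    standard_form (fun p => (p == i)%:Z) (fun p => (p == j)%:Z)
      (fun p => (p == k)%:Z) == phi7 i j k)
    (iota 0 7)) (iota 0 7)) (iota 0 7).
  have mem7 p : (p < 7)%N -> p \in iota 0 7 by rewrite mem_iota.
  move=> i /mem7/all7/allP all7i j /mem7/all7i/allP all7j k /mem7.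
  exact: all7j.
by vm_compute.
Qed.

Lemma adapted_dual (b : seq V) : size b = 7%N ->
  (forall i j, (i < 7)%N -> (j < 7)%N -> e`_i b`_j = (i == j)%:R :> R) ->
  adapted phi b.
Proof.
move=> szb dual; apply: adapted7 => // [|i j k lti ltj ltk].
  exact: is_form_standard.
rewrite -standard_form_delta // feval_standard /standard_form !dual //.
rewrite !(rmorphB, rmorphD, rmorphM) /=; ring.
Qed.

End FromDefinition.

End StandardForm.

(** * Inner products *)

Section DotProduct.
Context {R : realType} {V : vectType R}.
Variable g : {dot V for @idfun R}.
Implicit Types (x y z : V) (s : seq V).

Lemma dotC x y : g x y = g y x.
Proof. by rewrite hermC mul1r. Qed.

Lemma dotDl x y z : g (x + y) z = g x z + g y z.
Proof. exact: linearDl. Qed.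

Lemma dotZl a x y : g (a *: x) y = a * g x y.
Proof. exact: linearZl_LR. Qed.

Lemma dotDr x y z : g x (y + z) = g x y + g x z.
Proof. by rewrite dotC dotDl !(dotC _ x). Qed.

Lemma dotZr a x y : g x (a *: y) = a * g x y.
Proof. by rewrite dotC dotZl dotC. Qed.

Lemma dotNl x y : g (- x) y = - g x y.
Proof. by rewrite -scaleN1r dotZl mulN1r. Qed.

Lemma dot0l x : g 0 x = 0.
Proof. by rewrite -(scale0r 0) dotZl mul0r. Qed.

Lemma dot_suml I (r : seq I) (P : pred I) (a : I -> R) (F : I -> V) y :
  g (\sum_(i <- r | P i) a i *: F i) y = \sum_(i <- r | P i) a i * g (F i) y.
Proof.
elim/big_rec2: _ => [|i b x Pi <-]; first exact: dot0l.
by rewrite dotDl dotZl.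
Qed.

Lemma dot_gt0 x : x != 0 -> 0 < g x x.
Proof. exact: neq0_dnorm_gt0. Qed.

Lemma dot_eq0 x : (g x x == 0) = (x == 0).
Proof.
have [->|nzx] := eqVneq x 0; first by rewrite dot0l eqxx.
by rewrite gt_eqF // dot_gt0.
Qed.

Lemma orthonormalE s : orthonormal g s <->
  forall i j, (i < size s)%N -> (j < size s)%N -> g s`_i s`_j = (i == j)%:R.
Proof.
elim: s => [|x s IHs]; first by [].
have -> : orthonormal g (x :: s) =
    [&& g x x == 1, all (fun y => g x y == 0) s & orthonormal g s].
  rewrite /orthonormal /= /ortho_rec /= andbT.
  by rewrite -!andbA; congr (_ && _); rewrite andbCA.
split=> [/and3P[/eqP gx /allP gxs /IHs ons] [|i] [|j] //= lti ltj|ons].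
- by apply/eqP/gxs/mem_nth.
- by rewrite dotC; apply/eqP/gxs/mem_nth.
- by rewrite ons // eqSS.
apply/and3P; split; first by rewrite (ons 0%N 0%N).
  apply/(all_nthP 0) => i lti; have := ons 0%N i.+1 isT lti => /= ->; exact: eqxx.
by apply/IHs => i j lti ltj; have := ons i.+1 j.+1 lti ltj; rewrite eqSS.
Qed.

Lemma orthonormal_cat' s1 s2 : orthonormal g s1 -> orthonormal g s2 ->
  {in s1 & s2, forall x y, g x y = 0} -> orthonormal g (s1 ++ s2).
Proof.
move=> /orthonormalE on1 /orthonormalE on2 on12; apply/orthonormalE => i j.
rewrite size_cat !nth_cat => lti ltj.
case: (ltnP i (size s1)) => lt1; case: (ltnP j (size s1)) => lt2.
- exact: on1.
- rewrite ltn_eqF ?(leq_trans lt1) // on12 ?mem_nth //.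
  by rewrite ltn_subLR.
- rewrite gtn_eqF ?(leq_trans lt2) // dotC on12 ?mem_nth //.
  by rewrite ltn_subLR.
- rewrite on2 ?ltn_subLR //.
  by rewrite -(eqn_add2r (size s1)) !subnK.
Qed.

Lemma mem_orthovE (W : {vspace V}) x :
  x \in orthov g W <-> forall y, y \in W -> g x y = 0.
Proof.
split=> [/mem_orthovP xW y yW|xW]; first exact: xW.
by apply/mem_orthovP => y yW; apply: xW.
Qed.

(** Each vector of s cuts the dimension by at most one. *)
Lemma exists_unit_orthogonal (W : {vspace V}) s : (size s < \dim W)%N ->
  exists x, [/\ x \in W, g x x = 1 & {in s, forall y, g x y = 0}].
Proof.
move=> lt_sW.
have [X [subXW ltX orthX]] : exists X : {vspace V}, [/\ (X <= W)%VS,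
    (\dim W <= size s + \dim X)%N & forall x y, x \in X -> y \in s -> g x y = 0].
  elim: s {lt_sW} => [|y s [X [subXW ltX orthX]]].
    by exists W; split; rewrite ?add0n.
  exists (X :&: orthov g <[y]>)%VS; split.
  - exact: (subv_trans (capvSl _ _)).
  - apply: (leq_trans ltX); rewrite /= addSnnS leq_add2l.
    by have := leq_dim_orthov1 g y X; rewrite -ltnS; apply: leq_trans; apply: leqSpred.
  - move=> x z; rewrite memv_cap => /andP[xX /mem_orthovE xy].
    by rewrite inE => /predU1P[->|/orthX ->] //; apply/xy/memv_line.
have nzX : X != 0%VS.
  by rewrite -dimv_eq0 -lt0n -(ltn_add2l (size s)) addn0 (leq_trans lt_sW).
have nzx : vpick X != 0 by rewrite vpick0.
have xX := memv_pick X; set x := vpick X in nzx xX.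
have gx := dot_gt0 nzx; pose r := Num.sqrt (g x x).
have nzr : r != 0 by rewrite gt_eqF // sqrtr_gt0.
exists (r^-1 *: x); split.
- by rewrite memvZ // (subvP subXW).
- rewrite dotZl dotZr -[g x x]sqr_sqrtr ?ltW // -/r; by field.
- by move=> y ys; rewrite dotZl (orthX x y) // mulr0.
Qed.

Lemma gram_orthonormal n (P : 'M[R]_n) (e : n.-tuple V) :
  (forall i j, g (tnth e i) (tnth e j) = (i == j)%:R) ->
  gram g [tuple \sum_j P i j *: tnth e j | i < n] = P *m P^T.
Proof.
move=> one; apply/matrixP => i j; rewrite !mxE !tnth_mktuple dot_suml.
apply: eq_bigr => l _; rewrite mxE; congr (_ * _).
rewrite dotC dot_suml (bigD1 l) //= one eqxx mulr1 big1 ?addr0 // => m neq_ml.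
by rewrite one (negPf neq_ml) mulr0.
Qed.

End DotProduct.

(** * Dual bases, and the metric of an adapted basis *)

Section DualBasis.
Context {R : realType} {V : vectType R}.

Lemma functionals_separate (x : V) :
  (forall f : 'Hom(V, R^o), f x = 0) -> x = 0.
Proof.
move=> fx0; rewrite (coord_vbasis (memvf x)) big1 // => i _.
have := fx0 (linfun (coord (vbasis {:V}) i : V -> R^o)).
by rewrite lfunE /= => ->; rewrite scale0r.
Qed.

(** The evaluation map of the basis e is injective, hence onto, as its target has
    the same dimension. *)
Lemma dual_vectors n (e : n.-tuple 'Hom(V, R^o)) :
  basis_of fullv e -> \dim {:V} = n ->
  exists b : n.-tuple V, forall i j : 'I_n, e`_i b`_j = (i == j)%:R :> R.
Proof.
move=> basis_e dimV.
have eval_lin : linear (fun x => \row_(i < n) (e`_i x : R)).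
  by move=> a x y; apply/rowP => i; rewrite !mxE linearP.
pose ev0 : {linear V -> 'rV[R]_n} :=
  HB.pack (fun x => \row_(i < n) (e`_i x : R))
    (GRing.isLinear.Build R V 'rV[R]_n *:%R _ eval_lin).
pose ev := linfun ev0.
have evE x i : ev x 0 i = e`_i x by rewrite lfunE /= mxE.
have ker0 : lker ev = 0%VS.
  apply/eqP; rewrite -subv0; apply/subvP => x; rewrite memv_ker memv0 => /eqP evx.
  apply/eqP/functionals_separate => f.
  rewrite (coord_basis basis_e (memvf f)) sum_lfunE big1 // => i _.
  by rewrite scale_lfunE -evE evx mxE scaler0.
have img : limg ev = fullv.
  apply/eqP; rewrite eqEdim subvf limg_dim_eq ?ker0 ?capv0 //.
  by rewrite dimV dimvf dim_matrix mul1r leqnn.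
have pre (j : 'I_n) : exists x, ev x = \row_i (i == j)%:R.
  have : \row_i (i == j)%:R \in limg ev by rewrite img memvf.
  by case/memv_imgP => x _ ->; exists x.
have [b bE] := choice pre; exists [tuple b j | j < n] => i j.
rewrite -(tnth_nth 0 [tuple _ | _ < n]) tnth_mktuple.
by rewrite -evE bE mxE.
Qed.

Lemma coord_dual n (e : n.-tuple 'Hom(V, R^o)) (b : n.-tuple V) :
  basis_of fullv e -> (forall i j : 'I_n, e`_i b`_j = (i == j)%:R :> R) ->
  forall x, x = \sum_(i < n) (e`_i x : R) *: b`_i.
Proof.
move=> basis_e dual x; apply/eqP; rewrite -subr_eq0; apply/eqP.
apply: functionals_separate => f.
rewrite (coord_basis basis_e (memvf f)) sum_lfunE big1 // => i _.
rewrite scale_lfunE linearB linear_sum /= (bigD1 i) //= big1 => [|j neq_ji].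
  by rewrite linearZ /= dual eqxx addr0 [X in _ - X]mulr1 subrr scaler0.
by rewrite linearZ /= dual eq_sym (negPf neq_ji) scaler0.
Qed.

End DualBasis.

Section Metric.
Context {R : realType} {V : vectType R}.
Variables (phi : kform V 3) (g : {dot V for @idfun R}) (vol : kform V 7).

Let phi7l (t : seq nat) : int := if t is [:: i; j; k] then phi7 i j k else 0.

(** The two sides of the definition of the metric are evaluated on b. The right
    one is a shuffle sum of values of phi on b, which are the integers of a fixed
    table: what remains is a computation in int, with result 6 delta_ij. *)
Lemma adapted_metric (b : seq V) i j : is_form phi -> G2_metric phi g vol ->
  adapted phi b -> size b = 7%N -> (i < 7)%N -> (j < 7)%N ->
  g b`_i b`_j * feval vol b = (i == j)%:R.
Proof.
move=> formphi [_ metric] adb szb lti ltj.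
have -> : g b`_i b`_j * feval vol b = feval (g b`_i b`_j *: vol) b by [].
have eb : b = map (nth 0 b) (iota 0 7) by rewrite -szb -/(mkseq _ _) mkseq_nth.
rewrite metric [LHS](fevalZ_form 6^-1) [X in feval _ X]eb.
have fint u : is_form (interior u phi) := is_form_interior u formphi.
rewrite (@feval_wedge _ _ 4 3) //; last exact: (is_form_wedge (fint _) (fint _)).
pose M : int := shuffle 4 3
  (shuffle 2 2 (fun t => phi7l (i :: t)) (fun t => phi7l (j :: t))) phi7l
  (iota 0 7).
have phil t : size t = 3%N -> feval phi (map (nth 0 b) t) = (phi7l t)%:~R.
  by case: t => [|p [|q [|r []]]] // _; apply: adb.
have inl p t : size t = 2%N ->
    feval (interior b`_p phi) (map (nth 0 b) t) = (phi7l (p :: t))%:~R.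
  by move=> szt; rewrite feval_interior -(phil (p :: t)) //= szt.
rewrite (@shuffle_map _ _ _ _ intr _ _ _ _ _
  (shuffle 2 2 (fun t => phi7l (i :: t)) (fun t => phi7l (j :: t))) phi7l) //; last first.
  move=> t szt; rewrite (@feval_wedge _ _ 2 2) ?size_map //.
  by apply: (@shuffle_map _ _ _ _ intr) => // t' szt'; apply: inl.
rewrite -/M; have -> : M = 6 * (i == j)%:Z.
  rewrite /M; move: i j lti ltj {M inl adb phil eb}.
  by do 7?[case=> [|]] => //; do 7?[case=> [|]] => // _ _; vm_compute.
by rewrite rmorphM /= mulKf // pnatr_eq0.
Qed.

End Metric.

(** * Adapted orthonormal bases and the cross product *)

Section Frame.
Context {R : realType} {V : vectType R}.
Variables (phi : kform V 3) (g : {dot V for @idfun R}) (vol : kform V 7).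
Hypotheses (dimV : \dim {:V} = 7%N) (G2phi : G2_structure phi).
Hypothesis metric : G2_metric phi g vol.

Lemma G2_is_form : is_form phi.
Proof. by have [e _ /is_form_standard] := G2phi. Qed.

Lemma sum7 (F : nat -> R) : \sum_(i < 7) F i =
  F 0%N + F 1%N + F 2%N + F 3%N + F 4%N + F 5%N + F 6%N.
Proof. by rewrite !big_ord_recl big_ord0 addr0 !addrA. Qed.

(** With nu = vol(b), the definition of the metric gives g(b_i, b_j) nu = delta_ij.
    Hence nu > 0, the vectors b_i sqrt(nu) are orthonormal, and vol takes on them
    the value nu^(9/2), which is 1 by the normalisation of vol. *)
Lemma adapted_orthonormal (b : seq V) : size b = 7%N -> adapted phi b ->
  (forall i j, (i < 7)%N -> (j < 7)%N -> g b`_i b`_j = (i == j)%:R) /\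
  feval vol b = 1.
Proof.
move=> szb adb.
have gb i j lti ltj := adapted_metric (i := i) (j := j) G2_is_form metric adb szb lti ltj.
have [[_ formvol normvol] _] := metric.
set nu := feval vol b in gb *.
have nz_nu : nu != 0.
  apply: contra_eq_neq (gb 0%N 0%N isT isT) => ->.
  by rewrite mulr0 eq_sym oner_neq0.
have nu_gt0 : 0 < nu.
  have := gb 0%N 0%N isT isT; rewrite eqxx => g00.
  have : 0 < g b`_0 b`_0 * nu by rewrite g00 ltr01.
  rewrite pmulr_rgt0 // dot_gt0 //; apply: contra_eq_neq g00 => ->.
  by rewrite dot0l mul0r eq_sym oner_neq0.
pose r := Num.sqrt nu; have r2 : r ^+ 2 = nu by rewrite sqr_sqrtr // ltW.
have r_ge0 : 0 <= r by apply: sqrtr_ge0.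
have gE i j : (i < 7)%N -> (j < 7)%N -> g b`_i b`_j = (i == j)%:R / nu.
  by move=> lti ltj; rewrite -(gb i j lti ltj) mulfK.
pose E := [tuple r *: b`_i | i < 7].
have szE : size E = 7%N by rewrite size_tuple.
have nthE i : (i < 7)%N -> E`_i = r *: b`_i.
  by move=> lti; rewrite -(tnth_nth 0 E (Ordinal lti)) tnth_mktuple.
have onE : orthonormal g E.
  apply/orthonormalE => i j; rewrite szE => lti ltj.
  rewrite !nthE // dotZl dotZr gE // mulrA -expr2 r2.
  by rewrite mulrCA mulfV // mulr1.
have volE : vol E = r ^+ 7 * nu.
  rewrite -(det_scalar) -[vol E](_ : vol [tuple \sum_j (r%:M : 'M[R]_7) i j *:
    tnth [tuple b`_i | i < 7] j | i < 7] = _).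
    rewrite form_det //; congr (_ * _).
  congr vol; apply: eq_from_tnth => i; rewrite !tnth_mktuple (bigD1 i) //= big1.
    by rewrite addr0 mxE eqxx tnth_mktuple.
  by move=> j neq_ji; rewrite mxE eq_sym (negPf neq_ji) scale0r.
have subE : {subset E <= fullv} by move=> x _; apply: memvf.
have := normvol E subE onE.
rewrite volE ger0_norm; last by rewrite mulr_ge0 ?exprn_ge0 // ltW.
rewrite -{1}r2 -exprD => /eqP; rewrite pexpr_eq1 // => /eqP r1.
have nu1 : nu = 1 by rewrite -r2 r1 expr1n.
by rewrite nu1; split=> // i j lti ltj; rewrite gE // nu1 divr1.
Qed.

Lemma adapted_frame : exists b : seq V, [/\ size b = 7%N, adapted phi b,
  forall x, x = \sum_(i < 7) g x b`_i *: b`_i &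
  forall x y z, feval phi [:: x; y; z] =
    standard_form (fun i => g x b`_i) (fun i => g y b`_i) (fun i => g z b`_i)].
Proof.
have [e basis_e phiE] := G2phi.
have [b dual] := dual_vectors basis_e dimV.
have adb : adapted phi b.
  apply: (adapted_dual phiE); first exact: size_tuple.
  by move=> i j lti ltj; apply: (dual (Ordinal lti) (Ordinal ltj)).
have [onb _] := adapted_orthonormal (size_tuple b) adb.
have coordE x i : (i < 7)%N -> g x b`_i = e`_i x.
  move=> lti; rewrite {1}(coord_dual basis_e dual x) dot_suml.
  rewrite (bigD1 (Ordinal lti)) //= onb // eqxx mulr1 big1 ?addr0 // => j neq_ji.
  by rewrite onb // -[i]/(val (Ordinal lti)) val_eqE (negPf neq_ji) mulr0.
exists b; split=> //; first exact: size_tuple.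
  move=> x; rewrite {1}(coord_dual basis_e dual x).
  by apply: eq_bigr => i _; rewrite coordE.
by move=> x y z; rewrite (feval_standard phiE) /standard_form !coordE.
Qed.

Section CrossCoordinates.
Variable b : seq V.
Hypothesis onb : forall i j, (i < 7)%N -> (j < 7)%N -> g b`_i b`_j = (i == j)%:R.
Hypothesis phiE : forall x y z, feval phi [:: x; y; z] =
    standard_form (fun i => g x b`_i) (fun i => g y b`_i) (fun i => g z b`_i).

Lemma feval_cross x y :
  let X i := g x b`_i in let Y i := g y b`_i in
  let m i j := X i * Y j - X j * Y i in
  (feval phi [:: x; y; b`_0] = m 1%N 2%N - m 3%N 4%N - m 5%N 6%N) *
  (feval phi [:: x; y; b`_1] = m 4%N 6%N - m 0%N 2%N - m 3%N 5%N) *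
  (feval phi [:: x; y; b`_2] = m 0%N 1%N - m 3%N 6%N - m 4%N 5%N) *
  (feval phi [:: x; y; b`_3] = m 0%N 4%N + m 1%N 5%N + m 2%N 6%N) *
  (feval phi [:: x; y; b`_4] = m 2%N 5%N - m 0%N 3%N - m 1%N 6%N) *
  (feval phi [:: x; y; b`_5] = m 0%N 6%N - m 1%N 3%N - m 2%N 4%N) *
  (feval phi [:: x; y; b`_6] = m 1%N 4%N - m 0%N 5%N - m 2%N 3%N).
Proof. by rewrite /=; do !split; rewrite phiE /standard_form !onb //=; ring. Qed.

End CrossCoordinates.

(** The second property polarises the octonion identity
    x * (x * y) = <x, y> x - <x, x> y. It is a polynomial identity in the
    coordinates of x, y and z in an adapted orthonormal basis, where the values
    of phi are the standard ones. *)
Lemma cross_product : exists cr : V -> V -> V,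
  (forall x y z, g (cr x y) z = feval phi [:: x; y; z]) /\
  (forall x y z, cr x (cr y z) + cr (cr x y) z =
     (2 * g x z) *: y - g x y *: z - g y z *: x).
Proof.
have [b [szb adb coordE phiE]] := adapted_frame.
have [onb _] := adapted_orthonormal szb adb.
have formphi := G2_is_form.
pose cr x y := \sum_(k < 7) feval phi [:: x; y; b`_k] *: b`_k.
have crE x y z : g (cr x y) z = feval phi [:: x; y; z].
  rewrite {2}(coordE z) (feval_slot_sum (s1 := [:: x; y])) // dot_suml.
  by apply: eq_bigr => k _; rewrite mulrC dotC.
exists cr; split=> // x y z.
have dotE u v : g u v = g u b`_0 * g v b`_0 + g u b`_1 * g v b`_1 +
    g u b`_2 * g v b`_2 + g u b`_3 * g v b`_3 + g u b`_4 * g v b`_4 +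
    g u b`_5 * g v b`_5 + g u b`_6 * g v b`_6.
  rewrite {1}(coordE u) dot_suml -(sum7 (fun i => g u b`_i * g v b`_i)).
  by apply: eq_bigr => i _; rewrite (dotC _ v).
apply/eqP; rewrite -subr_eq0; apply/eqP; set w := _ - _.
suff gw k : (k < 7)%N -> g w b`_k = 0.
  by rewrite (coordE w) big1 // => i _; rewrite gw // scale0r.
move=> ltk; rewrite /w !(dotDl, dotNl, dotZl) !crE (dotE x y) (dotE x z) (dotE y z).
have crossE := feval_cross onb phiE.
case: k ltk => [|[|[|[|[|[|[|]]]]]]] // _;
  rewrite !(crossE x) !(crossE (cr x y)) /= !crE !crossE /=.
all: move: (g x b`_0) (g x b`_1) (g x b`_2) (g x b`_3) (g x b`_4) (g x b`_5) (g x b`_6).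
all: move: (g y b`_0) (g y b`_1) (g y b`_2) (g y b`_3) (g y b`_4) (g y b`_5) (g y b`_6).
all: move: (g z b`_0) (g z b`_1) (g z b`_2) (g z b`_3) (g z b`_4) (g z b`_5) (g z b`_6).
all: move=> z0 z1 z2 z3 z4 z5 z6 y0 y1 y2 y3 y4 y5 y6 x0 x1 x2 x3 x4 x5 x6; ring.
Qed.

End Frame.

(** * Cross products and the Cayley-Dickson basis *)

Section CrossProduct.
Context {R : realType} {V : vectType R}.
Variables (phi : kform V 3) (g : {dot V for @idfun R}) (cr : V -> V -> V).
Hypothesis formphi : is_form phi.
Hypothesis crE : forall x y z, g (cr x y) z = feval phi [:: x; y; z].
Hypothesis crD : forall x y z, cr x (cr y z) + cr (cr x y) z =
  (2 * g x z) *: y - g x y *: z - g y z *: x.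
Local Notation "x ** y" := (cr x y) (at level 40, left associativity).

Lemma dot_inj x y : (forall z, g x z = g y z) -> x = y.
Proof.
move=> gxy; apply/eqP; rewrite -subr_eq0 -(dot_eq0 g).
by rewrite dotDl dotNl gxy subrr.
Qed.

Lemma crC x y : x ** y = - (y ** x).
Proof. by apply: dot_inj => z; rewrite dotNl !crE feval_swap2. Qed.

Lemma crNl x y : (- x) ** y = - (x ** y).
Proof.
by apply: dot_inj => z; rewrite dotNl !crE (@feval_slotN _ _ _ phi [::]).
Qed.

Lemma crNr x y : x ** (- y) = - (x ** y).
Proof. by rewrite crC crNl -crC. Qed.

Lemma crxx x : x ** x = 0.
Proof. by apply: dot_inj => z; rewrite crE feval_rep2 // dot0l. Qed.

Lemma dot_cr_cycle x y z : g (x ** y) z = g (y ** z) x.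
Proof. by rewrite !crE feval_cycle3. Qed.

Lemma dot_crl x y : g (x ** y) x = 0.
Proof. by rewrite dot_cr_cycle dot_cr_cycle crxx dot0l. Qed.

Lemma dot_crr x y : g (x ** y) y = 0.
Proof. by rewrite dot_cr_cycle crxx dot0l. Qed.

Lemma cr_cr x y : x ** (x ** y) = g x y *: x - g x x *: y.
Proof.
have cr0 : 0 ** y = 0.
  apply: dot_inj => z.
  by rewrite crE (@feval_slot0 _ _ _ phi [::]) // dot0l.
have := crD x x y; rewrite crxx cr0 addr0 => ->.
by rewrite mulrDl mul1r scalerDl -!addrA; congr (_ + _); rewrite addrCA subrr addr0.
Qed.

Lemma cr_assoc x y z : g x y = 0 -> g x z = 0 -> g y z = 0 ->
  x ** (y ** z) = - (x ** y ** z).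
Proof.
move=> xy xz yz; have := crD x y z.
by rewrite xy xz yz mulr0 !scale0r !subr0 => /eqP; rewrite addr_eq0 => /eqP.
Qed.

Lemma dot_cr_cr x y z : g (x ** y) (x ** z) = g x x * g y z - g x y * g x z.
Proof.
rewrite dot_cr_cycle dot_cr_cycle crC dotNl cr_cr dotDl dotNl !dotZl (dotC _ z).
by ring.
Qed.

Variables f0 f1 f3 : V.
Let f2 := f0 ** f1.
Hypotheses (n0 : g f0 f0 = 1) (n1 : g f1 f1 = 1) (n3 : g f3 f3 = 1).
Hypotheses (o01 : g f0 f1 = 0) (o03 : g f0 f3 = 0) (o13 : g f1 f3 = 0).
Hypothesis o23 : g f2 f3 = 0.

(** The Cayley-Dickson construction: f0, f1 and f2 span an associative subspace,
    f3 is orthogonal to it, and multiplication by f3 exchanges the two halves of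
    the octonions. The rules above determine all the products of the seven vectors,
    and the value of phi on three of them is a product followed by an inner
    product. *)
Lemma cross_frame : adapted phi
  [:: f0; f1; f2; f3; - (f0 ** f3); - (f1 ** f3); - (f2 ** f3)].
Proof.
set f4 := - (f0 ** f3); set f5 := - (f1 ** f3); set f6 := - (f2 ** f3).
(* n, o and c stand for norms, orthogonality relations and cross products. *)
have n2 : g f2 f2 = 1 by rewrite dot_cr_cr n0 n1 o01; ring.
have o02 : g f0 f2 = 0 by rewrite dotC dot_crl.
have o12 : g f1 f2 = 0 by rewrite dotC dot_crr.
have c01 : f0 ** f1 = f2 by [].
have c02 : f0 ** f2 = - f1 by rewrite cr_cr n0 o01 scale0r scale1r sub0r.
have c12 : f1 ** f2 = f0.
  by rewrite /f2 [f0 ** f1]crC crNr cr_cr n1 dotC o01 scale0r scale1r sub0r opprK.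
have c10 : f1 ** f0 = - f2 by rewrite crC.
have c20 : f2 ** f0 = f1 by rewrite crC c02 opprK.
have c21 : f2 ** f1 = - f0 by rewrite crC c12.
have c03 : f0 ** f3 = - f4 by rewrite opprK.
have c13 : f1 ** f3 = - f5 by rewrite opprK.
have c23 : f2 ** f3 = - f6 by rewrite opprK.
have c04 : f0 ** f4 = f3 by rewrite crNr cr_cr n0 o03 scale0r scale1r sub0r opprK.
have c15 : f1 ** f5 = f3 by rewrite crNr cr_cr n1 o13 scale0r scale1r sub0r opprK.
have c26 : f2 ** f6 = f3 by rewrite crNr cr_cr n2 o23 scale0r scale1r sub0r opprK.
have o10 : g f1 f0 = 0 by rewrite dotC.
have o20 : g f2 f0 = 0 by rewrite dotC.
have o21 : g f2 f1 = 0 by rewrite dotC.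
have c05 : f0 ** f5 = - f6 by rewrite crNr cr_assoc // opprK c01.
have c14 : f1 ** f4 = f6 by rewrite crNr cr_assoc // opprK c10 crNl.
have c06 : f0 ** f6 = f5 by rewrite crNr cr_assoc // opprK c02 crNl.
have c16 : f1 ** f6 = - f4 by rewrite crNr cr_assoc // opprK c12.
have c24 : f2 ** f4 = - f5 by rewrite crNr cr_assoc // opprK c20.
have c25 : f2 ** f5 = f4 by rewrite crNr cr_assoc // opprK c21 crNl.
have f4E : f4 = f3 ** f0 by rewrite crC c03 opprK.
have f5E : f5 = f3 ** f1 by rewrite crC c13 opprK.
have f6E : f6 = f3 ** f2 by rewrite crC c23 opprK.
have o30 : g f3 f0 = 0 by rewrite dotC.
have o31 : g f3 f1 = 0 by rewrite dotC.
have o32 : g f3 f2 = 0 by rewrite dotC.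
have c34 : f3 ** f4 = - f0 by rewrite f4E cr_cr n3 o30 scale0r scale1r sub0r.
have c35 : f3 ** f5 = - f1 by rewrite f5E cr_cr n3 o31 scale0r scale1r sub0r.
have c36 : f3 ** f6 = - f2 by rewrite f6E cr_cr n3 o32 scale0r scale1r sub0r.
have o04 : g f0 f4 = 0 by rewrite dotC dotNl dot_crl oppr0.
have o15 : g f1 f5 = 0 by rewrite dotC dotNl dot_crl oppr0.
have o26 : g f2 f6 = 0 by rewrite dotC dotNl dot_crl oppr0.
have o34 : g f3 f4 = 0 by rewrite dotC dotNl dot_crr oppr0.
have o35 : g f3 f5 = 0 by rewrite dotC dotNl dot_crr oppr0.
have o36 : g f3 f6 = 0 by rewrite dotC dotNl dot_crr oppr0.
have o14 : g f1 f4 = 0 by rewrite dotC f4E dot_cr_cycle c01.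
have o24 : g f2 f4 = 0 by rewrite dotC f4E dot_cr_cycle c02 dotNl o13 oppr0.
have o05 : g f0 f5 = 0 by rewrite dotC f5E dot_cr_cycle c10 dotNl o23 oppr0.
have o25 : g f2 f5 = 0 by rewrite dotC f5E dot_cr_cycle c12.
have o06 : g f0 f6 = 0 by rewrite dotC f6E dot_cr_cycle c20.
have o16 : g f1 f6 = 0 by rewrite dotC f6E dot_cr_cycle c21 dotNl o03 oppr0.
have n4 : g f4 f4 = 1 by rewrite f4E dot_cr_cr n3 n0 o30; ring.
have n5 : g f5 f5 = 1 by rewrite f5E dot_cr_cr n3 n1 o31; ring.
have n6 : g f6 f6 = 1 by rewrite f6E dot_cr_cr n3 n2 o32; ring.
have o45 : g f4 f5 = 0 by rewrite f4E f5E dot_cr_cr n3 o01 o30; ring.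
have o46 : g f4 f6 = 0 by rewrite f4E f6E dot_cr_cr n3 o02 o30; ring.
have o56 : g f5 f6 = 0 by rewrite f5E f6E dot_cr_cr n3 o12 o31; ring.
have o41 : g f4 f1 = 0 by rewrite dotC.
have o42 : g f4 f2 = 0 by rewrite dotC.
have o43 : g f4 f3 = 0 by rewrite dotC.
have o52 : g f5 f2 = 0 by rewrite dotC.
have o53 : g f5 f3 = 0 by rewrite dotC.
have c43 : f4 ** f3 = f0 by rewrite crC c34 opprK.
have c53 : f5 ** f3 = f1 by rewrite crC c35 opprK.
have c45 : f4 ** f5 = - f2 by rewrite f5E cr_assoc // c43 c01.
have c46 : f4 ** f6 = f1 by rewrite f6E cr_assoc // c43 c02 opprK.
have c56 : f5 ** f6 = - f0 by rewrite f6E cr_assoc // c53 c12.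
clear f4E f5E f6E.
move: (dotC g) (crC) (crxx) (crE) => gC cC cxx cE.
clearbody f2 f4 f5 f6; set f := [:: _; _; _; _; _; _; _].
have dotf i j : (i < 7)%N -> (j < 7)%N -> g f`_i f`_j = (i == j)%:R.
  move=> lti ltj; case: i lti => [|[|[|[|[|[|[|]]]]]]] // _;
    case: j ltj => [|[|[|[|[|[|[|]]]]]]] // _; rewrite /f /=; first [by [] | by rewrite gC].
have crf i j : (i < 7)%N -> (j < 7)%N ->
    f`_i ** f`_j = (cross7 i j).1%:~R *: f`_(cross7 i j).2.
  move=> lti ltj; case: i lti => [|[|[|[|[|[|[|]]]]]]] // _;
    case: j ltj => [|[|[|[|[|[|[|]]]]]]] // _; rewrite /cross7 /f /=
      ?rmorphN ?rmorph1 ?rmorph0 ?scaleN1r ?scale1r ?scale0r;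
    first [exact: cxx | by [] | by rewrite cC ?opprK; congr (- _)
          | by rewrite cC; apply: oppr_inj; rewrite opprK ].
apply: adapted7 => // i j k lti ltj ltk.
rewrite -cE crf // dotZl /phi7 rmorphM /=; congr (_ * _).
have lt7 : ((cross7 i j).2 < 7)%N.
  by case: i lti => [|[|[|[|[|[|[|]]]]]]] // _;
     case: j ltj => [|[|[|[|[|[|[|]]]]]]].
by rewrite dotf // eq_sym.
Qed.

End CrossProduct.

(** * The Hodge star in orthonormal bases *)

Section HodgeOrthonormal.
Context {R : realType} {V : vectType R}.
Variables (n : nat) (g : {dot V for @idfun R}) (h : 'I_n -> V).
Hypothesis onh : forall a b, g (h a) (h b) = (a == b)%:R.
Hypothesis genh : forall x, x = \sum_a g x (h a) *: h a.

Let b := vbasis {:V}.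
Let B : 'M[R]_(\dim {:V}, n) := \matrix_(i, a) g (tnth b i) (h a).

(** B and the matrix C of the coordinates of the h_a are inverse to each other,
    and the Gram matrix of b is B B^T. *)
Let gram_vbasis : B^T *m invmx (gram g b) *m B = 1%:M.
Proof.
pose C : 'M[R]_(n, \dim {:V}) := \matrix_(a, i) coord b i (h a).
have CB : C *m B = 1%:M.
  apply/matrixP => a c; rewrite !mxE -onh {1}(coord_vbasis (memvf (h a))) dot_suml.
  by apply: eq_bigr => i _; rewrite !mxE (tnth_nth 0).
have BC : B *m C = 1%:M.
  apply/matrixP => i j; rewrite !mxE.
  rewrite -(coord_free i j (basis_free (vbasisP {:V}))) {1}[b`_i]genh linear_sum /=.
  apply: eq_bigr => a _; rewrite !mxE linearZ /= (tnth_nth 0) //.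
have gramE : gram g b = B *m B^T.
  apply/matrixP => i j; rewrite !mxE {1}[tnth b i]genh dot_suml.
  by apply: eq_bigr => a _; rewrite !mxE [g (h a) _]dotC.
have -> : invmx (gram g b) = C^T *m C.
  have mul1 : gram g b *m (C^T *m C) = 1%:M.
    by rewrite gramE -mulmxA (mulmxA B^T) -trmx_mul CB trmx1 mul1mx BC.
  have [unitg _] := mulmx1_unit mul1.
  by rewrite -[C^T *m C]mul1mx -(mulVmx unitg) -mulmxA mul1 mulmx1.
by rewrite mulmxA -trmx_mul -mulmxA CB trmx1 mul1mx.
Qed.

(** The definition of the Hodge star does not depend on the basis: the arguments of
    lam and vol are expanded along h, and for each argument the two matrices of the
    change of basis absorb the inverse Gram matrix. *)
Lemma hodge_orthonormal k l (vol : kform V (k + l)) (lam : kform V k) v :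
  is_form vol -> is_form lam ->
  hodge g vol lam v = k`!%:R^-1 * \sum_(K : {ffun 'I_k -> 'I_n})
    lam [tuple h (K a) | a < k] * vol [tuple of [tuple h (K a) | a < k] ++ v].
Proof.
move=> formvol formlam; congr (_ * _); rewrite -/b.
set ginv := invmx _.
have expand (mu : kform V k) (I : {ffun 'I_k -> 'I_(\dim {:V})}) : is_form mu ->
    mu [tuple tnth b (I a) | a < k] =
    \sum_(K : {ffun 'I_k -> 'I_n}) (\prod_a B (I a) (K a)) * mu [tuple h (K a) | a < k].
  move=> formmu; rewrite -(form_expand (fun a c => B (I a) c) h formmu).
  congr mu; apply: eq_from_tnth => a; rewrite !tnth_mktuple [LHS]genh.
  by apply: eq_bigr => c _; rewrite mxE.
have formvolv := is_form_plugr v formvol.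
(* The sum over I and J is a product of matrix entries, one per argument. *)
have contractE (K L : {ffun 'I_k -> 'I_n}) :
    \sum_(I : {ffun 'I_k -> _}) \sum_(J : {ffun 'I_k -> _})
      \prod_a (ginv (I a) (J a) * (B (I a) (K a) * B (J a) (L a))) =
    \prod_a (B^T *m ginv *m B) (K a) (L a).
  have mxE' a : (B^T *m ginv *m B) (K a) (L a) =
      \sum_i \sum_j ginv i j * (B i (K a) * B j (L a)).
    rewrite mxE; under eq_bigr => j _ do rewrite mxE mulr_suml.
    rewrite exchange_big; apply: eq_bigr => i _; apply: eq_bigr => j _.
    by rewrite mxE; ring.
  rewrite (eq_bigr _ (fun a _ => mxE' a)) bigA_distr_bigA /=.
  by apply: eq_bigr => I _; rewrite bigA_distr_bigA.
transitivity (\sum_(K : {ffun 'I_k -> 'I_n}) \sum_(L : {ffun 'I_k -> 'I_n})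
    (\sum_(I : {ffun 'I_k -> 'I_(\dim {:V})})
      \sum_(J : {ffun 'I_k -> 'I_(\dim {:V})})
      \prod_a (ginv (I a) (J a) * (B (I a) (K a) * B (J a) (L a)))) *
    (lam [tuple h (K a) | a < k] * vol [tuple of [tuple h (L a) | a < k] ++ v])).
  transitivity (\sum_(I : {ffun 'I_k -> 'I_(\dim {:V})})
    \sum_(J : {ffun 'I_k -> 'I_(\dim {:V})})
    \sum_(K : {ffun 'I_k -> 'I_n}) \sum_(L : {ffun 'I_k -> 'I_n})
    \prod_a (ginv (I a) (J a) * (B (I a) (K a) * B (J a) (L a))) *
    (lam [tuple h (K a) | a < k] * vol [tuple of [tuple h (L a) | a < k] ++ v])).
    apply: eq_bigr => I _; apply: eq_bigr => J _.
    rewrite (expand lam I formlam) (expand _ J formvolv) -mulrA big_distrlr mulr_sumr.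
    apply: eq_bigr => K _; rewrite mulr_sumr; apply: eq_bigr => L _.
    by rewrite !big_split /=; ring.
  under eq_bigr => I _ do rewrite exchange_big; rewrite exchange_big.
  apply: eq_bigr => K _.
  under eq_bigr => I _ do rewrite exchange_big; rewrite exchange_big.
  apply: eq_bigr => L _; rewrite mulr_suml; apply: eq_bigr => I _.
  by rewrite mulr_suml.
apply: eq_bigr => K _; rewrite (bigD1 K) //= [X in _ + X]big1 ?addr0 => [|L neq_LK].
  by rewrite contractE big1 ?mul1r // => a _; rewrite gram_vbasis mxE eqxx.
suff -> : \sum_(I : {ffun 'I_k -> 'I_(\dim {:V})})
    \sum_(J : {ffun 'I_k -> 'I_(\dim {:V})})
    \prod_a (ginv (I a) (J a) * (B (I a) (K a) * B (J a) (L a))) = 0.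
  by rewrite mul0r.
have [a neq_a] : exists a, K a != L a.
  apply/existsP; apply: contraR neq_LK => /existsPn eqKL.
  by apply/eqP/ffunP => a; have := eqKL a; rewrite negbK => /eqP.
by rewrite contractE (bigD1 a) //= gram_vbasis mxE (negPf neq_a) mul0r.
Qed.

End HodgeOrthonormal.

Section HodgeBasis.
Context {R : realType} {V : vectType R}.

(** The arguments of lam must be the basis vectors that do not occur among the
    arguments of the dual. Their k! orders contribute equally, since lam and vol
    change sign together. *)
Lemma hodge_complement k l (g : {dot V for @idfun R}) (h : 'I_(k + l) -> V)
    (vol : kform V (k + l)) (lam : kform V k) (p : 'S_(k + l)) :
  (forall a b, g (h a) (h b) = (a == b)%:R) ->
  (forall x, x = \sum_a g x (h a) *: h a) -> is_form vol -> is_form lam ->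
  hodge g vol lam [tuple h (p (rshift k j)) | j < l] =
  lam [tuple h (p (lshift l i)) | i < k] * vol [tuple h (p i) | i < k + l].
Proof.
move=> onh genh formvol formlam; rewrite (hodge_orthonormal onh genh) //.
set v := [tuple h (p (rshift k j)) | j < l].
pose T (t : 'S_k) : {ffun 'I_k -> 'I_(k + l)} := [ffun a => p (lshift l (t a))].
have T_inj : injective T.
  move=> t t' /ffunP eqT; apply/permP => a; have := eqT a.
  by rewrite !ffunE => /perm_inj/lshift_inj.
rewrite (bigID (fun K => K \in [set T t | t : 'S_k])) /=.
rewrite [X in _ + X]big1 ?addr0 => [|K KnT]; last first.
  suff -> : vol [tuple of [tuple h (K a) | a < k] ++ v] = 0 by rewrite mulr0.
  have [_ alt] := formvol.
  (* K repeats an index, meets the arguments of the dual, or is some T t. *)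
  have [[a [b [neq_ab eqK]]]|injK] := pselect (exists a b, a != b /\ K a = K b).
    apply: (alt _ (lshift l a) (lshift l b)); first by
      rewrite (inj_eq (@lshift_inj _ _)).
    by rewrite !tnth_lshift !tnth_mktuple eqK.
  have [[a [j eqK]]|disjK] := pselect (exists a j, K a = p (rshift k j)).
    apply: (alt _ (lshift l a) (rshift k j)); first by rewrite eq_lrshift.
    by rewrite tnth_lshift tnth_rshift !tnth_mktuple eqK.
  have pre a : exists i, K a = p (lshift l i).
    rewrite -(permKV p (K a)); case: (split_ordP (p^-1%g (K a))) => i Ei.
      by exists i; rewrite Ei.
    by case: disjK; exists a, i; rewrite -Ei permKV.
  have [t tE] := choice pre.
  have t_inj : injective t.
    move=> a b eqt; have [//|neq_ab] := eqVneq a b.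
    by case: injK; exists a, b; rewrite !tE eqt.
  case/negP: KnT; apply/imsetP; exists (perm t_inj) => //.
  by apply/ffunP => a; rewrite ffunE permE tE.
rewrite (big_imset _ (in2W T_inj)) /=.
transitivity (k`!%:R^-1 * \sum_(t : 'S_k) (lam [tuple h (p (lshift l i)) | i < k] *
    vol [tuple h (p i) | i < k + l])); last first.
  set F := lam _ * _; rewrite sumr_const card_Sn -(mulr_natl F) mulKf //.
congr (_ * _); apply: eq_bigr => t _.
have -> : lam [tuple h (T t a) | a < k] =
    (-1) ^+ t * lam [tuple h (p (lshift l i)) | i < k].
  rewrite -form_perm //; congr lam; apply: eq_from_tnth => a.
  by rewrite !tnth_mktuple ffunE.
have formvolv := is_form_plugr v formvol.
have -> : vol [tuple of [tuple h (T t a) | a < k] ++ v] =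
    (-1) ^+ t * vol [tuple of [tuple h (p (lshift l i)) | i < k] ++ v].
  rewrite -(form_perm _ t formvolv); congr (vol [tuple of tval _ ++ _]).
  by apply: eq_from_tnth => a; rewrite !tnth_mktuple ffunE.
rewrite mulrACA -expr2 sqrr_sign mul1r; congr (_ * vol _).
apply: eq_from_tnth => i; rewrite tnth_mktuple; case: (split_ordP i) => j ->.
  by rewrite tnth_lshift tnth_mktuple.
by rewrite tnth_rshift tnth_mktuple.
Qed.

(** Insertion sort with the parity of its number of exchanges, so that the signs
    of permutations of explicit lists are found by computation. *)
Fixpoint ins (x : nat) (s : seq nat) : bool * seq nat :=
  if s is y :: s' then
    if (x <= y)%N then (false, x :: s)
    else let bs := ins x s' in (~~ bs.1, y :: bs.2)
  else (false, [:: x]).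

Fixpoint isort (s : seq nat) : bool * seq nat :=
  if s is x :: s' then
    let bs := isort s' in let bt := ins x bs.2 in (bs.1 (+) bt.1, bt.2)
  else (false, [::]).

Lemma size_ins x s : size (ins x s).2 = (size s).+1.
Proof. by elim: s => //= y s IHs; case: ifP => //= _; rewrite IHs. Qed.

Lemma size_isort s : size (isort s).2 = size s.
Proof. by elim: s => //= x s IHs; rewrite size_ins IHs. Qed.

Lemma perm_ins x s : perm_eq (ins x s).2 (x :: s).
Proof.
elim: s => //= y s IHs; case: ifP => //= _.
by rewrite (perm_trans (y := y :: x :: s)) ?perm_cons // (perm_catCA [:: y] [:: x]).
Qed.

Lemma perm_isort s : perm_eq (isort s).2 s.
Proof.
elim: s => //= x s IHs; apply: (perm_trans (perm_ins _ _)).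
by rewrite perm_cons.
Qed.

Lemma feval_ins k (lam : kform V k) (h : seq V) r x s : is_form lam ->
  (size r + (size s).+1 = k)%N ->
  feval lam (r ++ map (nth 0 h) (x :: s)) =
  (-1) ^+ (ins x s).1 * feval lam (r ++ map (nth 0 h) (ins x s).2).
Proof.
move=> formlam; elim: s r => [|y s IHs] r szr /=; first by rewrite mul1r.
case: ifP => _ /=; first by rewrite mul1r.
rewrite feval_swap //; last by rewrite -szr /= !addnS !ltnS leq_addr.
rewrite -cat_rcons IHs; last by rewrite size_rcons -szr /= addSnnS.
by rewrite cat_rcons signrN mulNr.
Qed.

Lemma feval_isort k (lam : kform V k) (h : seq V) r s : is_form lam ->
  (size r + size s = k)%N ->
  feval lam (r ++ map (nth 0 h) s) =
  (-1) ^+ (isort s).1 * feval lam (r ++ map (nth 0 h) (isort s).2).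
Proof.
move=> formlam; elim: s r => [|x s IHs] r szr /=; first by rewrite mul1r.
rewrite -cat_rcons IHs; last by rewrite size_rcons addSnnS.
rewrite cat_rcons signr_addb -mulrA; congr (_ * _).
by rewrite -feval_ins // size_isort.
Qed.

(** The form of [hodge_complement] for explicit lists of indices. *)
Lemma hodge_sorted k l (g : {dot V for @idfun R}) (h : seq V)
    (vol : kform V (k + l)) (lam : kform V k) (I J : seq nat) :
  size h = (k + l)%N ->
  (forall i j, (i < k + l)%N -> (j < k + l)%N -> g h`_i h`_j = (i == j)%:R) ->
  (forall x, x = \sum_(i < k + l) g x h`_i *: h`_i) ->
  is_form vol -> is_form lam -> size I = k -> size J = l ->
  (isort (I ++ J)).2 = iota 0 (k + l) ->
  feval (hodge g vol lam) (map (nth 0 h) J) =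
  (-1) ^+ (isort (I ++ J)).1 * feval lam (map (nth 0 h) I) * feval vol h.
Proof.
move=> szh onh genh formvol formlam szI szJ sortIJ; set L := I ++ J.
have szL : size L = (k + l)%N by rewrite size_cat szI szJ.
have permL : perm_eq L (iota 0 (k + l)) by rewrite -sortIJ perm_sym perm_isort.
have ltL i : (i < k + l)%N -> (nth 0%N L i < k + l)%N.
  move=> lti; have : nth 0%N L i \in iota 0 (k + l).
    by rewrite -(perm_mem permL) mem_nth ?szL.
  by rewrite mem_iota.
pose q (i : 'I_(k + l)) := Ordinal (ltL i (ltn_ord i)).
have q_inj : injective q.
  move=> i j /(congr1 val)/eqP /=.
  by rewrite nth_uniq ?szL // ?(perm_uniq permL) ?iota_uniq // => /eqP/val_inj.
have eqL (mu : kform V (k + l)) : feval mu (map (nth 0 h) L) =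
    mu [tuple h`_(perm q_inj i) | i < k + l].
  congr mu; apply: eq_from_tnth => i; rewrite !tnth_mktuple permE.
  by rewrite (nth_map 0%N) ?szL.
have eqI : feval lam (map (nth 0 h) I) =
    lam [tuple h`_(perm q_inj (lshift l i)) | i < k].
  congr lam; apply: eq_from_tnth => i; rewrite !tnth_mktuple permE.
  by rewrite (nth_map 0%N) ?szI //= nth_cat szI ltn_ord.
have eqJ (mu : kform V l) : feval mu (map (nth 0 h) J) =
    mu [tuple h`_(perm q_inj (rshift k j)) | j < l].
  congr mu; apply: eq_from_tnth => j; rewrite !tnth_mktuple permE.
  rewrite (nth_map 0%N) ?szJ //= nth_cat szI.
  by rewrite ltnNge leq_addr /= addKn.
rewrite eqJ (hodge_complement (h := fun a => h`_a)) // => [|a c].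
  rewrite eqI -eqL (feval_isort h (r := [::])) // sortIJ.
  have -> : [seq h`_i | i <- iota 0 (k + l)] = h by rewrite -szh -/(mkseq _ _) mkseq_nth.
  by rewrite mulrCA mulrA.
by rewrite onh.
Qed.

End HodgeBasis.

(** * The tables of phi and its dual in a rotated adapted basis *)

Section BaseCase.
Context {R : realType} {V : vectType R}.
Variables (phi : kform V 3) (g : {dot V for @idfun R}) (vol : kform V 7).
Hypothesis dimV : \dim {:V} = 7%N.
Hypotheses (formphi : is_form phi) (formvol : is_form vol).
Variable f : seq V.
Hypotheses (szf : size f = 7%N) (adf : adapted phi f).
Hypothesis onf : forall i j, (i < 7)%N -> (j < 7)%N -> g f`_i f`_j = (i == j)%:R.
Hypothesis volf : feval vol f = 1.
Variables c s : R.
Hypothesis cs1 : c ^+ 2 + s ^+ 2 = 1.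

Lemma orthonormal_coord n (h : seq V) : \dim {:V} = n -> size h = n ->
  (forall i j, (i < n)%N -> (j < n)%N -> g h`_i h`_j = (i == j)%:R) ->
  forall x, x = \sum_(i < n) g x h`_i *: h`_i.
Proof.
move=> dimn szh onh x; move/eqP: szh => szh; pose t := Tuple szh.
have dot_t (k : 'I_n -> R) (j : 'I_n) : g (\sum_(i < n) k i *: t`_i) t`_j = k j.
  rewrite dot_suml (bigD1 j) //= onh // eqxx mulr1 big1 ?addr0 // => i neq_ij.
  by rewrite onh // val_eqE (negPf neq_ij) mulr0.
have free_t : free t.
  by apply/freeP => k k0 i; rewrite -(dot_t k) k0 dot0l.
have basis_t : basis_of fullv t.
  by rewrite basisEfree free_t subvf size_tuple dimn leqnn.
by rewrite {1}(coord_basis basis_t (memvf x)); apply: eq_bigr => i _;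
  rewrite {2}(coord_basis basis_t (memvf x)) dot_t.
Qed.

(** As f_2 is the cross product of f_0 and f_1 and as f_3 may be any unit vector
    orthogonal to f_0, f_1 and f_2, the first three vectors form a general
    orthonormal triple. Their span is associative for s = 0 and isotropic for
    c = 0. *)
Definition rotated : seq V := [:: f`_0; f`_1; c *: f`_2 + s *: f`_3;
  - s *: f`_2 + c *: f`_3; f`_4; f`_5; f`_6].
Local Notation h := rotated.

Lemma dot_rotated i j : (i < 7)%N -> (j < 7)%N -> g h`_i h`_j = (i == j)%:R.
Proof.
have s2 : c * c + s * s = 1 by rewrite -!expr2.
move=> lti ltj; case: i lti => [|[|[|[|[|[|[|]]]]]]] // _;
  case: j ltj => [|[|[|[|[|[|[|]]]]]]] // _; 
  rewrite /rotated /= ?(dotDl, dotDr, dotZl, dotZr) !onf //=; lra.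
Qed.

Lemma rotated_coord x : x = \sum_(i < 7) g x h`_i *: h`_i.
Proof. exact: (orthonormal_coord dimV _ dot_rotated). Qed.

Lemma vol_rotated : feval vol h = 1.
Proof.
rewrite /rotated.
rewrite (@feval_slotD _ _ _ vol [:: f`_0; f`_1]) //.
rewrite !(@feval_slotZ _ _ _ vol [:: f`_0; f`_1]) //.
rewrite /= !(@feval_slotD _ _ _ vol [:: f`_0; f`_1; _]) //.
rewrite !(@feval_slotZ _ _ _ vol [:: f`_0; f`_1; _]) //=.
rewrite [feval vol [:: _, _, f`_3, f`_2 & _]](@feval_swap _ _ _ vol [:: f`_0; f`_1]) //=.
rewrite [feval vol [:: _, _, f`_2, f`_2 & _]](feval_repeat formvol) //; last first.
  by rewrite /= !inE eqxx /= ?andbF.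
rewrite [feval vol [:: _, _, f`_3, f`_3 & _]](feval_repeat formvol) //; last first.
  by rewrite /= !inE eqxx /= ?andbF.
have -> : feval vol [:: f`_0; f`_1; f`_2; f`_3; f`_4; f`_5; f`_6] = 1.
  by rewrite -[RHS]volf -{8}(mkseq_nth 0 f) szf.
by rewrite -[RHS]cs1; ring.
Qed.

(** The components of phi in the rotated basis, for increasing indices. *)
Definition phih (i j k : nat) : R := match i, j, k with
  | 0%N, 1%N, 2%N => c
  | 0%N, 1%N, 3%N => - s
  | 0%N, 2%N, 4%N => - s
  | 0%N, 3%N, 4%N => - c
  | 0%N, 5%N, 6%N => - 1
  | 1%N, 2%N, 5%N => - s
  | 1%N, 3%N, 5%N => - c
  | 1%N, 4%N, 6%N => 1
  | 2%N, 3%N, 6%N => - 1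
  | 2%N, 4%N, 5%N => - c
  | 3%N, 4%N, 5%N => s
  | _, _, _ => 0
  end.

Lemma phi_rotated i j k : (i < j < k)%N -> (k < 7)%N ->
  feval phi [:: h`_i; h`_j; h`_k] = phih i j k.
Proof.
have s2 : c * c + s * s = 1 by rewrite -!expr2.
have D1 x y t : feval phi (x + y :: t) = feval phi (x :: t) + feval phi (y :: t).
  exact: (@feval_slotD _ _ _ phi [::]).
have D2 z x y t : feval phi (z :: x + y :: t) =
    feval phi (z :: x :: t) + feval phi (z :: y :: t).
  exact: (@feval_slotD _ _ _ phi [:: z]).
have D3 w z x y t : feval phi (w :: z :: x + y :: t) =
    feval phi (w :: z :: x :: t) + feval phi (w :: z :: y :: t).
  exact: (@feval_slotD _ _ _ phi [:: w; z]).
have Z1 a x t : feval phi (a *: x :: t) = a * feval phi (x :: t).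
  exact: (@feval_slotZ _ _ _ phi [::]).
have Z2 z a x t : feval phi (z :: a *: x :: t) = a * feval phi (z :: x :: t).
  exact: (@feval_slotZ _ _ _ phi [:: z]).
have Z3 w z a x t : feval phi (w :: z :: a *: x :: t) =
    a * feval phi (w :: z :: x :: t).
  exact: (@feval_slotZ _ _ _ phi [:: w; z]).
have E p q r : feval phi [:: f`_p; f`_q; f`_r] =
   (cross7 p q).1%:~R * (r == (cross7 p q).2)%:R.
  by rewrite adf /phi7 rmorphM.
move=> /andP[ltij ltjk] ltk7; have ltik := ltn_trans ltij ltjk.
move: ltik ltij ltjk ltk7; case: k => [|[|[|[|[|[|[|]]]]]]] //;
  case: j => [|[|[|[|[|[|[|]]]]]]] //; case: i => [|[|[|[|[|[|[|]]]]]]] // _ _ _ _;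
  rewrite /rotated /phih /= ?(D1, D2, D3, Z1, Z2, Z3) !E /=; lra.
Qed.

(** The components of the Hodge dual: each is a component of phi with the
    complementary indices, up to the sign of the permutation. *)
Definition psih (i j k l : nat) : R := match i, j, k, l with
  | 0%N, 1%N, 2%N, 6%N => - s
  | 0%N, 1%N, 3%N, 6%N => - c
  | 0%N, 1%N, 4%N, 5%N => - 1
  | 0%N, 2%N, 3%N, 5%N => 1
  | 0%N, 2%N, 4%N, 6%N => - c
  | 0%N, 3%N, 4%N, 6%N => s
  | 1%N, 2%N, 3%N, 4%N => - 1
  | 1%N, 2%N, 5%N, 6%N => - c
  | 1%N, 3%N, 5%N, 6%N => s
  | 2%N, 4%N, 5%N, 6%N => s
  | 3%N, 4%N, 5%N, 6%N => c
  | _, _, _, _ => 0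
  end.

Let psi : kform V 4 := @hodge R V 3 4 g vol phi.

Lemma psi_rotated i j k l : (i < j < k)%N -> (k < l < 7)%N ->
  feval psi [:: h`_i; h`_j; h`_k; h`_l] = psih i j k l.
Proof.
have E (I J : seq nat) : size I = 3%N -> size J = 4%N ->
    (isort (I ++ J)).2 = iota 0 7 -> feval psi (map (nth 0 h) J) =
    (-1) ^+ (isort (I ++ J)).1 * feval phi (map (nth 0 h) I).
  move=> szI szJ sortIJ; rewrite (@hodge_sorted _ _ 3 4 g h vol phi I J) //.
  - by rewrite vol_rotated mulr1.
  - exact: dot_rotated.
  - exact: rotated_coord.
pose I := [seq p <- iota 0 7 | p \notin [:: i; j; k; l]].
have E' : I = [:: nth 0%N I 0; nth 0%N I 1; nth 0%N I 2] ->
    (nth 0%N I 0 < nth 0%N I 1 < nth 0%N I 2)%N -> (nth 0%N I 2 < 7)%N ->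
    (isort (I ++ [:: i; j; k; l])).2 = iota 0 7 ->
    feval psi [:: h`_i; h`_j; h`_k; h`_l] = (-1) ^+ (isort (I ++ [:: i; j; k; l])).1 *
      phih (nth 0%N I 0) (nth 0%N I 1) (nth 0%N I 2).
  move=> IE lt1 lt2 sortI.
  rewrite -[LHS]/(feval psi (map (nth 0 h) [:: i; j; k; l])) (E I) //; last by rewrite IE.
  by congr (_ * _); rewrite [in LHS]IE; apply: phi_rotated.
move=> /andP[ltij ltjk] /andP[ltkl ltl].
have ltik := ltn_trans ltij ltjk; have ltil := ltn_trans ltik ltkl.
have ltjl := ltn_trans ltjk ltkl; move: ltil ltjl ltik ltij ltjk ltkl ltl @I E'.
case: l => [|[|[|[|[|[|[|]]]]]]] //; case: k => [|[|[|[|[|[|[|]]]]]]] //;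
  case: j => [|[|[|[|[|[|[|]]]]]]] //; 
  case: i => [|[|[|[|[|[|[|]]]]]]] // _ _ _ _ _ _ _ /= ->;
  rewrite // /phih /psih /=; ring.
Qed.

End BaseCase.

(** * The products of the 2-forms in a rotated adapted basis *)

Section RotatedFrame.
Context {R : realType} {V : vectType R}.
Variables (phi : kform V 3) (psi : kform V 4) (h : seq V) (c s : R).
Hypotheses (formphi : is_form phi) (formpsi : is_form psi).
Hypothesis phi_h : forall i j k, (i < j < k)%N -> (k < 7)%N ->
  feval phi [:: h`_i; h`_j; h`_k] = phih c s i j k.
Hypothesis psi_h : forall i j k l, (i < j < k)%N -> (k < l < 7)%N ->
  feval psi [:: h`_i; h`_j; h`_k; h`_l] = psih c s i j k l.
Hypothesis cs1 : c ^+ 2 + s ^+ 2 = 1.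
Let U : 3.-tuple V := [tuple h`_0; h`_1; h`_2].
Local Notation al := (alpha phi U).
Local Notation be := (beta psi U).
Local Notation om := (omega phi U).
Local Notation tom := (tomega phi psi U).

Let U0 : tnth U 0 = h`_0. Proof. by []. Qed.
Let U1 : tnth U 1 = h`_1. Proof. by []. Qed.
Let U2 : tnth U 2 = h`_2. Proof. by []. Qed.
Let UE := (U0, U1, U2).

Lemma phiU : phi U = c.
Proof. by rewrite fevalU !UE phi_h. Qed.

(** The components of alpha on the last four vectors of the basis h, and, below,
    those of omega and tomega on increasing pairs of them. *)
Definition alpha_h (i : 'I_3) (a : nat) : R :=
  if i == 0 then - s *+ (a == 5%N) else
  if i == 1 then s *+ (a == 4%N) else - s *+ (a == 3%N).

Definition omega_h (i : 'I_3) (a b : nat) : R :=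
  if i == 0 then (a == 3%N)%:R * (b == 4%N)%:R + c * (a == 5%N)%:R * (b == 6%N)%:R else
  if i == 1 then (a == 3%N)%:R * (b == 5%N)%:R - c * (a == 4%N)%:R * (b == 6%N)%:R else
  (a == 4%N)%:R * (b == 5%N)%:R + c * (a == 3%N)%:R * (b == 6%N)%:R.

Definition tomega_h (i : 'I_3) (a b : nat) : R :=
  if i == 0 then (a == 5%N)%:R * (b == 6%N)%:R + c * (a == 3%N)%:R * (b == 4%N)%:R else
  if i == 1 then c * (a == 3%N)%:R * (b == 5%N)%:R - (a == 4%N)%:R * (b == 6%N)%:R else
  (a == 3%N)%:R * (b == 6%N)%:R + c * (a == 4%N)%:R * (b == 5%N)%:R.

Let four a : (2 < a < 7)%N -> [\/ a = 3%N, a = 4%N, a = 5%N | a = 6%N].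
Proof.
by case: a => [|[|[|[|[|[|[|]]]]]]] // _;
  [apply: Or41 | apply: Or42 | apply: Or43 | apply: Or44].
Qed.

Lemma feval_alpha_h i a : (2 < a < 7)%N -> feval (al i) [:: h`_a] = alpha_h i a.
Proof.
move=> lta; rewrite feval_alpha //.
elim/ord3P: i; rewrite !ord3E !UE ?[feval phi [:: h`_2, h`_0 & _]]feval_swap2 //;
  case/four: lta => ->; rewrite phi_h //= /alpha_h /phih /=; ring.
Qed.

Lemma feval_beta_h a : (2 < a < 7)%N -> feval be [:: h`_a] = - s *+ (a == 6%N).
Proof.
by move=> lta; rewrite feval_beta // !UE; case/four: lta => ->; rewrite psi_h.
Qed.

Lemma feval_omega_h i a b : (2 < a < b)%N -> (b < 7)%N ->
  feval (om i) [:: h`_a; h`_b] = omega_h i a b.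
Proof.
move=> /andP[lta ltab] ltb.
have ra : (2 < a < 7)%N by rewrite lta (ltn_trans ltab).
have rb : (2 < b < 7)%N by rewrite ltb (ltn_trans lta).
rewrite feval_omega // !feval_alpha_h // phiU.
have s2 : c * c + s * s = 1 by rewrite -!expr2.
move: ltab; case/four: ra => ->; case/four: rb => -> //= _;
elim/ord3P: i; rewrite !ord3E !UE phi_h //= /omega_h /alpha_h /phih /=; lra.
Qed.

Lemma feval_tomega_h i a b : (2 < a < b)%N -> (b < 7)%N ->
  feval (tom i) [:: h`_a; h`_b] = tomega_h i a b.
Proof.
move=> /andP[lta ltab] ltb.
have ra : (2 < a < 7)%N by rewrite lta (ltn_trans ltab).
have rb : (2 < b < 7)%N by rewrite ltb (ltn_trans lta).
rewrite feval_tomega // !feval_alpha_h // !feval_beta_h // phiU.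
have s2 : c * c + s * s = 1 by rewrite -!expr2.
move: ltab; case/four: ra => ->; case/four: rb => -> //= _;
elim/ord3P: i; rewrite !ord3E !UE ?[feval psi [:: h`_2, h`_0 & _]]feval_swap2 //
  psi_h //= /tomega_h /alpha_h /psih /=; lra.
Qed.

Lemma wedge_omega_h i j : feval (om i \wedge om j) [:: h`_3; h`_4; h`_5; h`_6] =
  2 * c *+ (i == j).
Proof.
rewrite (@feval_wedge _ _ 2 2) //=; try exact: is_form_omega.
rewrite !feval_omega_h // /omega_h.
by elim/ord3P: i; elim/ord3P: j; rewrite !eq_ord3E /=; ring.
Qed.

Lemma wedge_tomega_h i j : feval (tom i \wedge tom j) [:: h`_3; h`_4; h`_5; h`_6] =
  2 * c *+ (i == j).
Proof.
rewrite (@feval_wedge _ _ 2 2) //=; try exact: is_form_tomega.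
rewrite !feval_tomega_h // /tomega_h.
by elim/ord3P: i; elim/ord3P: j; rewrite !eq_ord3E /=; ring.
Qed.

(** The forms take on U and on the last four vectors the values of the tables, so
    this is a finite verification, which uses c^2 + s^2 = 1. *)
Lemma barOmega_h j x y z : c != 0 -> (2 < x < y)%N -> (y < z < 7)%N ->
  feval (barOmega phi psi U) [:: tnth U j; h`_x; h`_y; h`_z] = 0.
Proof.
case: (components phi psi U) => -[A aA] [[B bB]] [[Om oO]] [T tT] nz_c.
have phiUc := phiU.
have AU i l : A i (tnth U l) = c *+ (i == l) by rewrite -aA alphaU // phiU.
have BU l : B (tnth U l) = 0 by rewrite -bB betaU.
have OU i l w : Om i (tnth U l) w = 0 by rewrite -oO omegaU.
have TU i l w : T i (tnth U l) w = 0 by rewrite -tT tomegaU.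
move=> /andP[ltx ltxy] /andP[ltyz ltz].
have lty := ltn_trans ltx ltxy; have ltz2 := ltn_trans lty ltyz.
have rz : (2 < z < 7)%N by rewrite ltz2.
have ry : (2 < y < 7)%N by rewrite lty (ltn_trans ltyz).
have rx : (2 < x < 7)%N by rewrite ltx (ltn_trans ltxy) // (ltn_trans ltyz).
have AE i a : (2 < a < 7)%N -> A i h`_a = alpha_h i a.
  by move=> lta; rewrite -aA feval_alpha_h.
have BE a : (2 < a < 7)%N -> B h`_a = - s *+ (a == 6%N).
  by move=> lta; rewrite -bB feval_beta_h.
have OE i a b : (2 < a < b)%N -> (b < 7)%N -> Om i h`_a h`_b = omega_h i a b.
  by move=> lta ltb; rewrite -oO feval_omega_h.
have TE i a b : (2 < a < b)%N -> (b < 7)%N -> T i h`_a h`_b = tomega_h i a b.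
  by move=> lta ltb; rewrite -tT feval_tomega_h.
rewrite (feval_barOmega formphi formpsi aA bB oO tT) !sum3 !TU !OU !BU !AU !ord3E phiUc.
have ltxz := ltn_trans ltxy ltyz.
have lt7 : (y < 7)%N by case/andP: ry.
rewrite !AE // !BE // !OE ?ltx ?lty ?ltxy ?ltyz ?ltxz //.
rewrite !TE ?ltx ?lty ?ltxy ?ltyz ?ltxz //.
(* Multiples of the relation between c and s for the final linear arithmetic. *)
have K1 : c * s * (c * c + s * s) = c * s by rewrite -!expr2 cs1 mulr1.
have K2 : c * c * (c * c + s * s) = c * c by rewrite -!expr2 cs1 mulr1.
have K0 : c * (c * c + s * s) = c by rewrite -!expr2 cs1 mulr1.
(* Clears the denominator. *)
have Y0 p q : q = - c ^+ 3 * p -> p + (c ^+ 3)^-1 * q = 0.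
  by move=> ->; field.
apply: Y0.
move: ltxy ltyz; case/four: rx => ->; case/four: ry => -> //= _;
  case/four: rz => -> //= _;
  elim/ord3P: j; rewrite !UE psi_h //= /psih /alpha_h /omega_h /tomega_h !eq_ord3E /=.
all: lra.
Qed.

End RotatedFrame.

(** * Subspaces in general position *)

Section Adaptation.
Context {R : realType} {V : vectType R}.
Variables (phi : kform V 3) (g : {dot V for @idfun R}) (vol : kform V 7).
Hypotheses (dimV : \dim {:V} = 7%N) (G2phi : G2_structure phi).
Hypothesis metric : G2_metric phi g vol.
Variable UU : {vspace V}.
Hypothesis dimU : \dim UU = 3%N.

Let formphi : is_form phi := G2_is_form G2phi.

(** Take an orthonormal basis u0, u1, u2 of UU and f2 = u0 x u1, a unit vector
    orthogonal to u0 and u1. The component of u2 orthogonal to f2 is a multiple s f3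
    of a unit vector f3, and u0, u1 and f3 generate an adapted basis by
    [cross_frame]. *)
Lemma exists_rotated_frame : exists (f : seq V) (c s : R),
  [/\ size f = 7%N, adapted phi f, c ^+ 2 + s ^+ 2 = 1 &
      forall i, (i < 3)%N -> (rotated f c s)`_i \in UU].
Proof.
have [cr [crE crD]] := cross_product dimV G2phi metric.
have [u0 [U0 n0 _]] := @exists_unit_orthogonal _ _ g UU [::] ltac:(by rewrite dimU).
have [u1 [U1 n1 o1]] := @exists_unit_orthogonal _ _ g UU [:: u0] ltac:(by rewrite dimU).
have [u2 [U2 n2 o2]] := @exists_unit_orthogonal _ _ g UU [:: u0; u1] ltac:(by rewrite dimU).
have o01 : g u0 u1 = 0 by rewrite dotC o1 ?mem_head.
have o20 : g u2 u0 = 0 by rewrite o2 ?mem_head.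
have o21 : g u2 u1 = 0 by rewrite o2 // !inE eqxx orbT.
pose f2 := cr u0 u1.
have f22 : g f2 f2 = 1.
  by rewrite (dot_cr_cr formphi crE crD) n0 n1 o01 mulr1 mulr0 subr0.
have f20 : g f2 u0 = 0 by rewrite (dot_crl formphi crE).
have f21 : g f2 u1 = 0 by rewrite (dot_crr formphi crE).
pose c := g u2 f2; pose d := u2 - c *: f2.
have d0 : g d u0 = 0 by rewrite dotDl dotNl dotZl o20 f20; ring.
have d1 : g d u1 = 0 by rewrite dotDl dotNl dotZl o21 f21; ring.
have d2 : g d f2 = 0 by rewrite dotDl dotNl dotZl f22 -/c; ring.
have [f3 [s [n3 [ o30 [ o31 [ o32 ds]]]]]] : exists (f3 : V) (s : R), g f3 f3 = 1 /\
    g f3 u0 = 0 /\ g f3 u1 = 0 /\ g f3 f2 = 0 /\ d = s *: f3.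
  (* For d = 0 the subspace is associative, and f3 is an arbitrary orthogonal unit
     vector. *)
  have [d_eq0|nzd] := eqVneq d 0.
    have [f3 [_ n3 o3]] :=
      @exists_unit_orthogonal _ _ g fullv [:: u0; u1; f2] ltac:(by rewrite dimV).
    exists f3, 0; rewrite n3 scale0r d_eq0; split=> //.
    by rewrite !o3 // !inE eqxx ?orbT.
  have gd := dot_gt0 g nzd; pose s := Num.sqrt (g d d).
  have nzs : s != 0 by rewrite gt_eqF // sqrtr_gt0.
  exists (s^-1 *: d), s; rewrite !dotZl d0 d1 d2 !mulr0 scalerA mulfV // scale1r.
  split=> //; rewrite dotZr -[g d d]sqr_sqrtr ?ltW // -/s; by field.
have u2E : u2 = c *: f2 + s *: f3 by rewrite -ds addrC subrK.
have adf := cross_frame formphi crE crD n0 n1 n3 o01 (etrans (dotC _ _ _) o30)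
  (etrans (dotC _ _ _) o31) (etrans (dotC _ _ _) o32).
set f := [:: u0; _; _; _; _; _; _] in adf; exists f, c, s; split=> //.
  have := n2; rewrite {1 2}u2E !(dotDl, dotDr, dotZl, dotZr) f22 n3 o32 (dotC _ f2) o32.
  by move=> <-; ring.
by case=> [|[|[|]]] // _; rewrite /rotated /f /= -?u2E.
Qed.

Lemma basis_change (U U' : 3.-tuple V) : basis_of UU U -> basis_of UU U' ->
  exists2 P : 'M[R]_3, \det P != 0 &
    U' = [tuple \sum_j P i j *: tnth U j | i < 3].
Proof.
move=> basisU basisU'.
pose P : 'M[R]_3 := \matrix_(i, j) coord U j (tnth U' i).
have U'E i : tnth U' i = \sum_j P i j *: tnth U j.
  rewrite [LHS](coord_basis basisU); last by apply: (basis_mem basisU'); apply: mem_tnth.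
  by apply: eq_bigr => j _; rewrite mxE -(tnth_nth 0 U).
exists P; last by apply: eq_from_tnth => i; rewrite tnth_mktuple.
apply/negP => /det0P[x nzx xP].
have /freeP/(_ (fun i => x 0 i)) x0 := basis_free basisU'.
move/negP: nzx; apply; apply/eqP/rowP => i; rewrite mxE; apply: x0.
transitivity (\sum_j (x *m P) 0 j *: tnth U j); last first.
  by rewrite xP big1 // => j _; rewrite mxE scale0r.
under [RHS]eq_bigr => j _ do rewrite mxE scaler_suml.
rewrite exchange_big; apply: eq_bigr => j _.
rewrite -(tnth_nth 0) U'E scaler_sumr; apply: eq_bigr => l _.
by rewrite scalerA.
Qed.

Lemma phi_basis_neq0 (U : 3.-tuple V) : basis_of UU U -> ~ isotropic phi UU ->
  phi U != 0.
Proof.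
move=> basisU noniso; apply/eqP => phiU0; apply: noniso.
apply/funext => v; rewrite /restr.
have -> : map_tuple vsval v =
    [tuple \sum_j (\matrix_(i, j) coord U j (vsval (tnth v i)) : 'M[R]_3) i j *:
      tnth U j | i < 3].
  apply: eq_from_tnth => i; rewrite tnth_map tnth_mktuple.
  rewrite [LHS](coord_basis basisU) ?subvsP //.
  by apply: eq_bigr => j _; rewrite mxE -(tnth_nth 0 U).
by rewrite form_det // phiU0 mulr0.
Qed.

End Adaptation.

Section HodgeDecomposable.
Context {R : realType} {V : vectType R}.

(** The Hodge dual of w_1^* /\ ... /\ w_k^*, for the 1-forms w_i^* = <w_i, ->, is
    the contraction of vol with w_1, ..., w_k: the Leibniz expansion of the
    determinant turns the sum over the basis into k! expansions of the w_i. *)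
Lemma hodge_decomposable n k l (g : {dot V for @idfun R}) (h : 'I_n -> V)
    (vol : kform V (k + l)) (lam : kform V k) (w : 'I_k -> V) (v : l.-tuple V) :
  (forall a b, g (h a) (h b) = (a == b)%:R) ->
  (forall x, x = \sum_a g x (h a) *: h a) -> is_form vol -> is_form lam ->
  (forall u : k.-tuple V, lam u = \det (\matrix_(i, j) g (w i) (tnth u j))) ->
  hodge g vol lam v = vol [tuple of [tuple w i | i < k] ++ v].
Proof.
move=> onh genh formvol formlam lamE; rewrite (hodge_orthonormal onh genh) //.
have formvolv := is_form_plugr v formvol.
set W := vol _.
have volw (t : 'S_k) : (-1) ^+ t * W = \sum_(K : {ffun 'I_k -> 'I_n})
    (\prod_i g (w (t i)) (h (K i))) * vol [tuple of [tuple h (K i) | i < k] ++ v].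
  rewrite -(form_expand (fun i a => g (w (t i)) (h a)) h formvolv).
  rewrite -(form_perm _ t formvolv); congr (vol [tuple of tval _ ++ _]).
  by apply: eq_from_tnth => i; rewrite !tnth_mktuple -genh.
transitivity (k`!%:R^-1 * \sum_(t : 'S_k) (-1) ^+ t * ((-1) ^+ t * W)); last first.
  under eq_bigr do rewrite mulrA -expr2 sqrr_sign mul1r.
  by rewrite sumr_const card_Sn -(mulr_natl W) mulKf // pnatr_eq0 -lt0n fact_gt0.
congr (_ * _); under [RHS]eq_bigr => t _ do rewrite volw mulr_sumr.
rewrite exchange_big; apply: eq_bigr => K _.
rewrite lamE -det_tr mulr_suml; apply: eq_bigr => t _.
rewrite mulrA; congr (_ * _ * _); apply: eq_bigr => i _.
by rewrite !mxE tnth_mktuple.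
Qed.

End HodgeDecomposable.

(** * Horizontal forms *)

Section Horizontal.
Context {R : realType} {V : vectType R}.

Lemma is_form_hodge k l (g : V -> V -> R) (vol : kform V (k + l)) (lam : kform V k) :
  is_form vol -> is_form (hodge g vol lam).
Proof.
move=> formvol.
have -> : hodge g vol lam = k`!%:R^-1 *: \sum_(I : {ffun 'I_k -> 'I_(\dim {:V})})
    \sum_(J : {ffun 'I_k -> 'I_(\dim {:V})})
    ((\prod_(a < k) invmx (gram g (vbasis {:V})) (I a) (J a)) *
      lam [tuple tnth (vbasis {:V}) (I a) | a < k]) *:
     plug [tuple tnth (vbasis {:V}) (J a) | a < k] vol.
  apply: kform_ext => s _; rewrite [RHS]fevalZ_form [in RHS]feval_sum_form.
  congr (_ * _).
  apply: eq_bigr => I _; exact/esym/feval_sum_form.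
apply/is_formZ/is_form_sum => I _; apply/is_form_sum => J _.
exact/is_formZ/is_form_plug.
Qed.

Variables (UU : {vspace V}) (U : 3.-tuple V).
Hypothesis basisU : basis_of UU U.

Lemma horizontalP k (lam : kform V k.+1) : is_form lam ->
  horizontal UU lam <-> (forall j s, size s = k -> feval lam (tnth U j :: s) = 0).
Proof.
move=> formlam; split=> [hor j s szs|hor u uU].
  rewrite -feval_interior hor //; apply: (basis_mem basisU); exact: mem_tnth.
apply: kform_ext => s szs; rewrite feval_interior (coord_basis basisU uU).
rewrite feval_sum1 // big1 // => j _.
by rewrite -(tnth_nth 0) hor // mulr0.
Qed.

Lemma horizontal_plug m (vol : kform V (3 + m.+1)) : is_form vol ->
  horizontal UU (plug U vol).
Proof.
move=> formvol; apply/horizontalP; first exact: is_form_plug.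
move=> j s szs; rewrite feval_plug feval_repeat //.
  by rewrite size_cat size_tuple /= szs.
rewrite cat_uniq /= negb_and negb_and negbK; apply/orP; right.
by rewrite mem_tnth.
Qed.

(** The families extracted from U ++ E either contain a vector of U or are
    extracted from E. *)
Lemma horizontal_eq0 k (E : seq V) (lam : kform V k.+1) : is_form lam ->
  horizontal UU lam -> (<<U ++ E>> = fullv)%VS ->
  (forall s, subseq s E -> size s = k.+1 -> feval lam s = 0) -> lam = 0.
Proof.
move=> formlam /horizontalP -/(_ formlam) hor gen lamE; apply/funext => v.
apply: (form_eq0 (b := U ++ E) formlam) => [s|]; last by move=> x _; rewrite gen memvf.
rewrite tuple3E => /subseqP[m szm ->].
case: m szm => [|b0 [|b1 [|b2 m]]] //= [szm].
case: b0 => /= [[szs]|]; first exact: hor.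
case: b1 => /= [[szs]|]; first exact: hor.
case: b2 => /= [[szs]|szs]; first exact: hor.
by rewrite lamE // mask_subseq.
Qed.

Lemma horizontal_eq k (E : seq V) (lam mu : kform V k.+1) :
  is_form lam -> is_form mu -> horizontal UU lam -> horizontal UU mu ->
  (<<U ++ E>> = fullv)%VS -> size E = k.+1 -> feval lam E = feval mu E -> lam = mu.
Proof.
move=> formlam formmu horlam hormu gen szE eqE; apply/eqP; rewrite -subr_eq0; apply/eqP.
have formdiff : is_form (lam - mu) by apply/is_formD/is_formN.
apply: (horizontal_eq0 formdiff _ gen) => [|s subs szs].
  move=> u uU; apply: kform_ext => s _.
  rewrite feval_interior fevalD_form fevalN_form -!feval_interior.
  by rewrite horlam // hormu // subrr.
have -> : s = E by apply/eqP; rewrite -(size_subseq_leqif subs) szs szE.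
by rewrite fevalD_form fevalN_form eqE subrr.
Qed.

End Horizontal.

(** * A base case for each subspace *)

Section Core.
Context {R : realType} {V : vectType R}.
Variables (phi : kform V 3) (g : {dot V for @idfun R}) (vol : kform V 7).
Hypotheses (dimV : \dim {:V} = 7%N) (G2phi : G2_structure phi).
Hypothesis metric : G2_metric phi g vol.
Variable UU : {vspace V}.
Hypotheses (dimU : \dim UU = 3%N) (noniso : ~ isotropic phi UU).
Local Notation psi := (@hodge R V 3 4 g vol phi).

Let formphi : is_form phi := G2_is_form G2phi.
Let formvol : is_form vol. Proof. by have [[]] := metric. Qed.
Let formpsi : is_form psi. Proof. exact: is_form_hodge. Qed.

(** U is an orthonormal basis of UU and E a basis of its orthogonal complement, on
    which the identities to be proved hold. *)
Definition base_triple (U : 3.-tuple V) (E : seq V) :=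
  [/\ basis_of UU U, forall i j, g (tnth U i) (tnth U j) = (i == j)%:R,
      (<<U ++ E>> = fullv)%VS, {subset E <= orthov g UU} & size E = 4%N] /\
  [/\ feval vol (U ++ E) = 1,
      forall i j, feval (omega phi U i \wedge omega phi U j) E = 2 * phi U *+ (i == j),
      forall i j, feval (tomega phi psi U i \wedge tomega phi psi U j) E =
        2 * phi U *+ (i == j) &
      forall j s, subseq s E -> size s = 3%N ->
        feval (barOmega phi psi U) (tnth U j :: s) = 0].

(** U and E are the first three and the last four vectors of a rotated adapted
    basis, where all values are known. *)
Lemma exists_base_triple : exists U E, base_triple U E.
Proof.
have [f [c [s [szf adf cs1 UUf]]]] := exists_rotated_frame dimV G2phi metric dimU.
have [onf volf] := adapted_orthonormal G2phi metric szf adf.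
set h := rotated f c s in UUf.
have onh i j : (i < 7)%N -> (j < 7)%N -> g h`_i h`_j = (i == j)%:R.
  exact: dot_rotated.
have genh : forall x, x = \sum_(i < 7) g x h`_i *: h`_i by apply: rotated_coord.
have volh : feval vol h = 1 by apply: vol_rotated.
have phih := phi_rotated formphi adf cs1.
have psih := psi_rotated dimV formphi formvol szf adf onf volf cs1.
pose U : 3.-tuple V := [tuple h`_0; h`_1; h`_2].
pose E := [:: h`_3; h`_4; h`_5; h`_6].
have hE : U ++ E = h by [].
have tU (l : 'I_3) : tnth U l = h`_l by elim/ord3P: l.
have onU i j : g (tnth U i) (tnth U j) = (i == j)%:R.
  by rewrite !tU onh // (leq_trans (ltn_ord _)).
have basisU : basis_of UU U.
  rewrite basisEfree size_tuple dimU leqnn andbT; apply/andP; split.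
    apply/freeP => k k0 i.
    have : g (\sum_(i < 3) k i *: U`_i) (tnth U i) = 0 by rewrite k0 dot0l.
    rewrite dot_suml (bigD1 i) //= big1 => [|j neq_ji].
      by rewrite -(tnth_nth 0 U) onU eqxx mulr1 addr0.
    by rewrite -(tnth_nth 0 U) onU (negPf neq_ji) mulr0.
  apply/span_subvP => x /tnthP[i ->].
  by rewrite tU UUf.
have nz_c := phi_basis_neq0 G2phi basisU noniso.
exists U, E; split; split=> //.
- apply/eqP; rewrite eqEsubv subvf; apply/subvP => x _; rewrite (genh x).
  apply: memv_suml => i _; apply/memvZ/memv_span; rewrite hE.
  exact: mem_nth.
- move=> x Ex; apply/mem_orthovE => y yU; rewrite (coord_basis basisU yU) dotC.
  rewrite dot_suml big1 // => j _; rewrite -(tnth_nth 0 U) tU.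
  have [a lta ->] : exists2 a, (a < 4)%N & x = h`_(3 + a).
    by exists (index x E); [rewrite index_mem | rewrite -[LHS](nth_index 0 Ex)].
  have lt3a : (3 + a < 7)%N by rewrite -[7%N]/(3 + 4)%N ltn_add2l.
  rewrite onh ?(leq_trans (ltn_ord j)) //.
  by rewrite ltn_eqF ?mulr0 // (leq_trans (ltn_ord j)) // leq_addr.
- by move=> i j; rewrite (wedge_omega_h (h := h) formphi phih cs1) (phiU (h := h) phih).
- move=> i j; rewrite (wedge_tomega_h (h := h) formphi formpsi phih psih cs1).
  by rewrite (phiU (h := h) phih).
have nz : c != 0 by rewrite -(phiU (h := h) phih).
have barE := barOmega_h (h := h) formphi formpsi phih psih cs1.
move=> j t /subseqP[m]; case: m => [|b3 [|b4 [|b5 [|b6 [|]]]]] //= _ -> {t}.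
by case: b3; case: b4; case: b5; case: b6 => //= _;
  [exact: (barE j 3 4 5 nz)%N | exact: (barE j 3 4 6 nz)%N
  | exact: (barE j 3 5 6 nz)%N | exact: (barE j 4 5 6 nz)%N].
Qed.

End Core.

(** * The identities for an arbitrary basis of the subspace *)

Section CoreIdentities.
Context {R : realType} {V : vectType R}.
Variables (phi : kform V 3) (g : {dot V for @idfun R}) (vol : kform V 7).
Hypotheses (dimV : \dim {:V} = 7%N) (G2phi : G2_structure phi).
Hypothesis metric : G2_metric phi g vol.
Variable UU : {vspace V}.
Hypotheses (dimU : \dim UU = 3%N) (noniso : ~ isotropic phi UU).
Local Notation psi := (@hodge R V 3 4 g vol phi).

Let formphi : is_form phi := G2_is_form G2phi.
Let formvol : is_form vol. Proof. by have [[]] := metric. Qed.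
Let formpsi : is_form psi. Proof. exact: is_form_hodge. Qed.

Section HorizontalForms.
Variable U : 3.-tuple V.
Hypothesis basisU : basis_of UU U.
Let nz_c : phi U != 0 := phi_basis_neq0 G2phi basisU noniso.

Lemma horizontal_beta : horizontal UU (beta psi U).
Proof.
apply/(horizontalP basisU); first exact: is_form_beta.
by move=> j s /size0nil ->; apply: betaU.
Qed.

Lemma horizontal_omega k : horizontal UU (omega phi U k).
Proof.
apply/(horizontalP basisU); first exact: is_form_omega.
by move=> j [|x []] // _; apply: omegaU.
Qed.

Lemma horizontal_tomega k : horizontal UU (tomega phi psi U k).
Proof.
apply/(horizontalP basisU); first exact: is_form_tomega.
by move=> j [|x []] // _; apply: tomegaU.
Qed.

Lemma horizontal_Omega : horizontal UU (Omega phi U).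
Proof.
apply/(horizontalP basisU); first exact: is_form_Omega.
by move=> j [|x [|y []]] // _; apply: OmegaU.
Qed.

Lemma horizontal_wedge22 (a b : kform V 2) : is_form a -> is_form b ->
  horizontal UU a -> horizontal UU b -> horizontal UU (a \wedge b : kform V 4).
Proof.
move=> fa fb /(horizontalP basisU fa) ha /(horizontalP basisU fb) hb.
have fab : is_form (a \wedge b : kform V 4) := is_form_wedge fa fb.
apply/(horizontalP basisU fab) => j [|x [|y [|z []]]] // _.
by rewrite (@feval_wedge _ _ 2 2) //= !ha // !hb //; ring.
Qed.

End HorizontalForms.

(** Both sides are horizontal 4-forms, and such forms are determined by their value
    on a basis of one complement of UU. *)
Lemma wedge_plug_vol (U : 3.-tuple V) (E : seq V) (a b : kform V 2) x :
  basis_of UU U -> (<<U ++ E>> = fullv)%VS -> size E = 4%N ->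
  feval vol (U ++ E) = 1 -> is_form a -> is_form b ->
  horizontal UU a -> horizontal UU b -> feval (a \wedge b) E = x ->
  (a \wedge b : kform V 4) = x *: plug U vol.
Proof.
move=> basisU gen szE volE fa fb ha hb abE.
have fplug : is_form (plug U vol : kform V 4) by apply: is_form_plug.
apply: (horizontal_eq basisU (E := E)) => //.
- exact: (is_form_wedge fa fb).
- exact: is_formZ.
- exact: (horizontal_wedge22 basisU fa fb ha hb).
- move=> u uU; apply: kform_ext => s szs; rewrite feval_interior fevalZ_form.
  rewrite -feval_interior (horizontal_plug basisU (m := 3) formvol uU).
  by rewrite feval0_form mulr0.
- by rewrite abE [RHS]fevalZ_form feval_plug volE mulr1.
Qed.

Lemma base_omega U E i j : base_triple phi g vol UU U E ->
  (omega phi U i \wedge omega phi U j : kform V 4) =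
  (2 * phi U *+ (i == j)) *: plug U vol.
Proof.
move=> [[basisU onU gen subE szE] [volE omE _ _]].
have fo k := is_form_omega formphi U k.
by apply: (wedge_plug_vol basisU gen szE volE (fo i) (fo j)) (omE i j);
  apply: horizontal_omega.
Qed.

Lemma base_tomega U E i j : base_triple phi g vol UU U E ->
  (tomega phi psi U i \wedge tomega phi psi U j : kform V 4) =
  (2 * phi U *+ (i == j)) *: plug U vol.
Proof.
move=> [[basisU onU gen subE szE] [volE _ omE _]].
have fo k := is_form_tomega formphi formpsi U k.
by apply: (wedge_plug_vol basisU gen szE volE (fo i) (fo j)) (omE i j);
  apply: horizontal_tomega.
Qed.

(** The contractions with two vectors of UU vanish in general, those with one
    vector of UU by the choice of U and E. *)
Lemma base_barOmega U E : base_triple phi g vol UU U E ->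
  horizontal UU (barOmega phi psi U).
Proof.
move=> [[basisU onU gen subE szE] [_ _ _ barE]].
have nz_c := phi_basis_neq0 G2phi basisU noniso.
have fbar := is_form_barOmega U formphi formpsi.
apply/(horizontalP basisU fbar) => j s szs.
have fint : is_form (interior (tnth U j) (barOmega phi psi U) : kform V 3).
  exact: is_form_interior.
rewrite -feval_interior.
suff -> : (interior (tnth U j) (barOmega phi psi U) : kform V 3) = 0 by [].
apply: (horizontal_eq0 basisU fint _ gen) => [|t subt szt].
  apply/(horizontalP basisU fint) => l [|x [|y []]] // _.
  by rewrite feval_interior; apply: barOmegaUU.
by rewrite feval_interior barE.
Qed.

Variables (U : 3.-tuple V).
Hypothesis basisU : basis_of UU U.
Local Notation A := (gram g U).

Let base_change : exists U0 E (P : 'M[R]_3), [/\ base_triple phi g vol UU U0 E,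
  \det P != 0, U = [tuple \sum_j P i j *: tnth U0 j | i < 3], A = P *m P^T &
  phi U0 != 0].
Proof.
have [U0 [E baseU]] := exists_base_triple dimV G2phi metric dimU noniso.
have [[basisU0 onU0 _ _ _] _] := baseU.
have [P nzP UE] := basis_change basisU0 basisU.
exists U0, E, P; split=> //; last exact: phi_basis_neq0 basisU0 noniso.
by rewrite UE; apply: gram_orthonormal.
Qed.

Lemma det_gram_gt0 : 0 < \det A.
Proof.
have [U0 [E [P [_ nzP _ -> _]]]] := base_change.
by rewrite det_mulmx det_tr -expr2 exprn_even_gt0.
Qed.

Lemma posdef_gram : posdefmx A.
Proof.
move=> x nzx; have -> : (x *m A *m x^T) 0 0 =
    g (\sum_i x 0 i *: tnth U i) (\sum_i x 0 i *: tnth U i).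
  rewrite dot_suml mxE; under eq_bigr => j _ do rewrite mxE mulr_suml.
  rewrite exchange_big; apply: eq_bigr => i _.
  rewrite dotC dot_suml mulr_sumr; apply: eq_bigr => j _.
  by rewrite !mxE (dotC _ (tnth U j)); ring.
apply: dot_gt0; apply: contra_neq nzx => x0; apply/rowP => i; rewrite mxE.
have /freeP := basis_free basisU; apply.
by under eq_bigr => j _ do rewrite -(tnth_nth 0 U).
Qed.

Lemma horizontal_barOmega : horizontal UU (barOmega phi psi U).
Proof.
have [U0 [E [P [baseU nzP UE _ _]]]] := base_change.
by rewrite UE barOmega_change //; apply: base_barOmega baseU.
Qed.

Let wedge_diag (o : 'I_3 -> kform V 2) (mu : kform V 4) d x (M : 'M[R]_3) i j :
  (forall l m, (o l \wedge o m : kform V 4) = (x *+ (l == m)) *: mu) ->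
  (d *: \sum_l M i l *: o l) \wedge (d *: \sum_l M j l *: o l) =
  (d ^+ 2 * x * (M *m M^T) i j) *: mu :> kform V 4.
Proof.
move=> diag; rewrite wedgeZl wedgeZr scalerA -expr2 -mulrA -scalerA.
congr (_ *: _); rewrite mxE mulr_sumr wedge_suml scaler_suml.
apply: eq_bigr => l _; rewrite wedge_sumr (bigD1 l) //= big1 ?addr0 => [|m].
  by rewrite wedgeZl wedgeZr diag eqxx mulr1n !scalerA mxE mulrC.
rewrite eq_sym => /negPf neq_lm.
by rewrite wedgeZl wedgeZr diag neq_lm scale0r !scaler0.
Qed.

(** In the base case A is the identity; the general case follows by the change of
    basis P, for which A = P P^T. *)
Lemma wedge_omega i j : (omega phi U i \wedge omega phi U j : kform V 4) =
  (2 * phi U * A i j) *: plug U vol.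
Proof.
have [U0 [E [P [baseU nzP UE AE _]]]] := base_change.
rewrite AE UE !omega_change // vol_change // plug_det //.
rewrite (wedge_diag _ _ _ _ (fun l m => base_omega l m baseU)) scalerA.
by congr (_ *: _); ring.
Qed.

(** The matrix of the change of basis is now that of the cofactors of P, and
    adj(P)^T adj(P) is the adjugate of A. *)
Lemma wedge_tomega i j : (tomega phi psi U i \wedge tomega phi psi U j : kform V 4) =
  (2 * phi U * (\det A * invmx A i j)) *: plug U vol.
Proof.
have [U0 [E [P [baseU nzP UE AE _]]]] := base_change.
have unitA : A \in unitmx by rewrite unitmxE unitfE gt_eqF ?det_gram_gt0.
pose C : 'M[R]_3 := (\adj P)^T.
have adjA : \det A * invmx A i j = (C *m C^T) i j.
  have -> : \det A * invmx A i j = (\det A *: invmx A) i j by rewrite mxE.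
  suff -> : \det A *: invmx A = C *m C^T by [].
  have AC : A *m (C *m C^T) = \det A *: 1%:M.
    rewrite [in LHS]AE trmxK -mulmxA (mulmxA P^T) -trmx_mul mul_adj_mx.
    rewrite tr_scalar_mx mul_scalar_mx -scalemxAr mul_mx_adj AE det_mulmx det_tr.
    by rewrite -scalerA scalemx1.
  by rewrite -[RHS]mul1mx -(mulVmx unitA) -mulmxA AC -scalemxAr mulmx1.
have tomegaC k : tomega phi psi U k = \det P *: \sum_l C k l *: tomega phi psi U0 l.
  by rewrite UE tomega_change //; congr (_ *: _); apply: eq_bigr => l _; rewrite !mxE.
rewrite adjA !tomegaC UE vol_change // plug_det //.
rewrite (wedge_diag _ _ _ _ (fun l m => base_tomega l m baseU)) scalerA.
by congr (_ *: _); ring.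
Qed.

End CoreIdentities.

(** * Definite triples *)

Section Definite.
Context {R : realType} {V : vectType R}.

Lemma restr_wedge (W : {vspace V}) k l (lam : kform V k) (mu : kform V l) :
  restr W lam \wedge restr W mu = restr W (lam \wedge mu).
Proof.
apply/funext => v; rewrite /wedge /restr; congr (_ * _).
apply: eq_bigr => q _; congr (_ * lam _ * mu _).
  by apply: eq_from_tnth => i; rewrite !(tnth_mktuple, tnth_map).
by apply: eq_from_tnth => i; rewrite !(tnth_mktuple, tnth_map).
Qed.

Lemma is_form_restr (W : {vspace V}) k (lam : kform V k) :
  is_form lam -> is_form (restr W lam).
Proof.
move=> [lin alt]; have map_set (v : k.-tuple (subvs_of W)) i x :
    map_tuple vsval (set_tnth v i x) = set_tnth (map_tuple vsval v) i (vsval x).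
  apply: eq_from_tnth => j; rewrite tnth_map !tnth_set tnth_map.
  by case: eqP.
split=> [v i a x y|v i j neq_ij vij].
  by rewrite /restr !map_set linearP lin.
by apply: (alt _ _ _ neq_ij); rewrite !tnth_map vij.
Qed.

Lemma posdef_inv n (M : 'M[R]_n) : M \in unitmx -> M^T = M -> posdefmx M ->
  posdefmx (invmx M).
Proof.
move=> unitM symM posM x nzx.
have -> : x *m invmx M *m x^T = (x *m invmx M) *m M *m (x *m invmx M)^T.
  by rewrite mulmxKV // trmx_mul trmx_inv symM mulmxA.
apply: posM; apply: contra_neq nzx => x0.
by rewrite -[x](mulmxKV unitM) x0 mul0mx.
Qed.

Lemma definite_scale n (M : 'M[R]_n) a : a != 0 -> posdefmx M -> definitemx (a *: M).
Proof.
move=> nza posM.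
have posa b : 0 < b -> posdefmx (b *: M).
  move=> b_gt0 x nzx; rewrite -scalemxAr -scalemxAl mxE.
  by rewrite mulr_gt0 // posM.
case: (ltrgt0P a) nza => // [a_gt0|a_lt0] _; first by left; apply: posa.
by right; rewrite -scaleNr; apply: posa; rewrite oppr_gt0.
Qed.

Lemma dim_complement (W1 W2 : {vspace V}) : (forall x, x \in W1 -> x \in W2 -> x = 0) ->
  (W1 + W2 = fullv)%VS -> (\dim W1 + \dim W2 = \dim {:V})%N.
Proof.
move=> dis sum; rewrite -sum dimv_disjoint_sum //.
apply/eqP; rewrite -subv0; apply/subvP => x; rewrite memv_cap memv0 => /andP[x1 x2].
by apply/eqP/dis.
Qed.

Lemma add_fullv (W1 W2 : {vspace V}) :
  (forall x, exists2 y, y \in W1 & x - y \in W2) -> (W1 + W2 = fullv)%VS.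
Proof.
move=> dec; apply/eqP; rewrite eqEsubv subvf; apply/subvP => x _.
by have [y y1 y2] := dec x; rewrite -[x](subrKC y) memv_add.
Qed.

(** A nonzero horizontal 4-form restricts to a volume form on every complement of
    UU: this is why the triples are definite on both complements of the
    theorem. *)
Lemma definite_on_complement (UU W : {vspace V}) (U : 3.-tuple V)
    (om : 'I_3 -> kform V 2) (nu : kform V 4) (M : 'M[R]_3) :
  basis_of UU U -> is_form nu -> horizontal UU nu -> nu != 0 ->
  (UU + W = fullv)%VS -> \dim W = 4%N ->
  (forall i j, (om i \wedge om j : kform V 4) = (2 * M i j) *: nu) ->
  definitemx M -> definite_triple_on W om.
Proof.
move=> basisU formnu hornu nznu sumW dimW omM defM; split=> //.
exists (restr W nu), M; split=> //.
- exact: is_form_restr.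
- apply: contra_neq nznu => nu0.
  apply: (horizontal_eq0 basisU (E := vbasis W) formnu hornu) => [|s subs szs].
    by rewrite span_cat (span_basis basisU) (span_basis (vbasisP W)).
  have sW x : x \in s -> x \in W.
    by move=> xs; apply: (basis_mem (vbasisP W)); apply: mem_subseq subs _ xs.
  move/eqP: szs => szs; have -> : s = map_tuple vsval (map_tuple (vsproj W) (Tuple szs)).
    rewrite /= -map_comp -[LHS]map_id; apply/eq_in_map => x xs.
    by rewrite /= vsprojK ?sW.
  by rewrite feval_tuple -[LHS]/(restr W nu _) nu0.
- by move=> i j; rewrite restr_wedge omM.
Qed.

End Definite.

(** * Two complements and the volume form of the orthogonal one *)

Section Final.
Context {R : realType} {V : vectType R}.
Variables (phi : kform V 3) (g : {dot V for @idfun R}) (vol : kform V 7).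
Hypotheses (dimV : \dim {:V} = 7%N) (G2phi : G2_structure phi).
Hypothesis metric : G2_metric phi g vol.
Variable UU : {vspace V}.
Hypotheses (dimU : \dim UU = 3%N) (noniso : ~ isotropic phi UU).
Variable U : 3.-tuple V.
Hypothesis basisU : basis_of UU U.
Local Notation psi := (@hodge R V 3 4 g vol phi).
Local Notation A := (gram g U).
Local Notation Uperp := (orthov g UU).
Local Notation c := (phi U).

Let formphi : is_form phi := G2_is_form G2phi.
Let formvol : is_form vol. Proof. by have [[]] := metric. Qed.
Let formpsi : is_form psi. Proof. exact: is_form_hodge. Qed.
Let nz_c : c != 0 := phi_basis_neq0 G2phi basisU noniso.
Let detA_gt0 : 0 < \det A := det_gram_gt0 dimV G2phi metric dimU noniso basisU.

Let unitA : A \in unitmx.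
Proof. by rewrite unitmxE unitfE gt_eqF. Qed.

Let basisE x : x \in UU -> x = \sum_j coord U j x *: tnth U j.
Proof.
move=> xU; rewrite {1}(coord_basis basisU xU); apply: eq_bigr => j _.
by rewrite (tnth_nth 0).
Qed.

(** The orthogonal projection to UU, with the inverse Gram matrix. *)
Lemma orthogonal_decomposition x : exists2 y, y \in UU & x - y \in Uperp.
Proof.
pose y := \sum_i (\sum_j g x (tnth U j) * invmx A j i) *: tnth U i.
exists y.
  apply: memv_suml => i _; apply/memvZ/(basis_mem basisU); exact: mem_tnth.
apply/mem_orthovE => z zU; rewrite (basisE zU) dotC dot_suml big1 // => k _.
suff -> : g (tnth U k) (x - y) = 0 by rewrite mulr0.
rewrite dotC dotDl dotNl dot_suml; apply/eqP; rewrite subr_eq0; apply/eqP.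
under eq_bigr => i _ do rewrite mulr_suml.
rewrite exchange_big /= (bigD1 k) //= [X in _ + X]big1 ?addr0 => [|j neq_jk].
  transitivity (g x (tnth U k) * (invmx A *m A) k k).
    by rewrite mulVmx // mxE eqxx mulr1.
  rewrite mxE mulr_sumr; apply: eq_bigr => i _.
  by rewrite [X in _ * (_ * X)]mxE mulrA.
transitivity (g x (tnth U j) * (invmx A *m A) j k).
  rewrite mxE mulr_sumr; apply: eq_bigr => i _.
  by rewrite [X in _ = _ * (_ * X)]mxE mulrA.
by rewrite mulVmx // mxE (negPf neq_jk) mulr0.
Qed.

Lemma sum_orthogonal : (UU + Uperp = fullv)%VS.
Proof. exact/add_fullv/orthogonal_decomposition. Qed.

Lemma dim_orthogonal : \dim Uperp = 4%N.
Proof.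
apply/eqP; rewrite -(eqn_add2l 3) -[X in (X + _ == _)%N]dimU.
rewrite dim_complement ?sum_orthogonal ?dimV // => x xU /mem_orthovE xperp.
by apply/eqP; rewrite -(dot_eq0 g) xperp.
Qed.

Let alpha_sub i x y : feval (alpha phi U i) [:: x - y] =
  feval (alpha phi U i) [:: x] - feval (alpha phi U i) [:: y].
Proof.
have fal := is_form_alpha formphi U i.
by rewrite (@feval_slotD _ _ _ _ [::]) // (@feval_slotN _ _ _ _ [::]).
Qed.

Lemma mem_kerU x : x \in kerU phi U <-> forall i, feval (alpha phi U i) [:: x] = 0.
Proof.
have cov i : covector (alpha phi U i) x = feval (alpha phi U i) [:: x].
  by rewrite covectorE ?feval_tuple //; apply: is_form_alpha.
rewrite memvE; split=> [/subv_bigcapP xK i|xK].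
  by have := xK i isT; rewrite -memvE memv_ker cov => /eqP.
by apply/subv_bigcapP => i _; rewrite -memvE memv_ker cov xK eqxx.
Qed.

Let alpha_UU (k : 'I_3 -> R) i :
  feval (alpha phi U i) [:: \sum_j k j *: tnth U j] = k i * c.
Proof.
have fal := is_form_alpha formphi U i.
rewrite feval_sum1 // (bigD1 i) //= alphaU // eqxx big1 ?addr0 // => j neq_ji.
by rewrite alphaU // eq_sym (negPf neq_ji) mulr0.
Qed.

Lemma sum_kerU : (UU + kerU phi U = fullv)%VS.
Proof.
apply: add_fullv => x.
(* The alpha^i / c are dual to the U_j. *)
pose y := \sum_j (feval (alpha phi U j) [:: x] / c) *: tnth U j.
exists y.
  apply: memv_suml => i _; apply/memvZ/(basis_mem basisU); exact: mem_tnth.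
by apply/mem_kerU => i; rewrite alpha_sub alpha_UU divfK // subrr.
Qed.

Lemma dim_kerU : \dim (kerU phi U) = 4%N.
Proof.
apply/eqP; rewrite -(eqn_add2l 3) -[X in (X + _ == _)%N]dimU.
rewrite dim_complement ?sum_kerU ?dimV // => x xU /mem_kerU xK.
have coord0 i : coord U i x = 0.
  have /eqP := xK i; rewrite {1}(basisE xU) alpha_UU mulf_eq0 (negPf nz_c) orbF.
  by move=> /eqP.
by rewrite (basisE xU) big1 // => i _; rewrite coord0 scale0r.
Qed.

Local Notation nu := (plug U vol : kform V 4).

Let formnu : is_form nu. Proof. exact: is_form_plug. Qed.
Let hornu : horizontal UU nu. Proof. exact: horizontal_plug. Qed.

(** U = P U0 for an orthonormal basis U0 of UU, so that nu is det P times the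
    contraction of vol with U0, and det A = (det P)^2. *)
Lemma nu_orthonormal (E : 4.-tuple V) : {subset E <= Uperp} -> orthonormal g E ->
  `|nu E| = Num.sqrt (\det A).
Proof.
move=> subE onE.
have [U0 [E0 [[basisU0 onU0 _ _ _] _]]] :=
  exists_base_triple dimV G2phi metric dimU noniso.
have [P nzP UE] := basis_change basisU0 basisU.
have AE : A = P *m P^T by rewrite UE; apply: gram_orthonormal.
have [[_ _ volon] _] := metric.
have on0 : orthonormal g (U0 ++ E).
  apply: orthonormal_cat' => //.
    apply/orthonormalE => i j; rewrite size_tuple => lti ltj.
    by rewrite -(tnth_nth 0 U0 (Ordinal lti)) -(tnth_nth 0 U0 (Ordinal ltj)) onU0.
  move=> x y xU0 /subE/mem_orthovE yE; rewrite dotC yE //.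
  exact: (basis_mem basisU0).
rewrite UE plug_det // -[(_ *: _) E]/(\det P * plug U0 vol E) normrM.
rewrite [X in _ * X](volon [tuple of U0 ++ E]) ?mulr1 //; last by move=> x _; apply: memvf.
by rewrite -UE AE det_mulmx det_tr -expr2 sqrtr_sqr.
Qed.

Lemma nu_neq0 : nu != 0.
Proof.
have [U0 [E0 [[basisU0 _ _ _ _] [volE _ _ _]]]] :=
  exists_base_triple dimV G2phi metric dimU noniso.
have [P nzP UE] := basis_change basisU0 basisU.
apply: contra_neq (oner_neq0 R) => nu0; rewrite -volE.
have : feval nu E0 = 0 by rewrite nu0.
by rewrite UE plug_det // fevalZ_form feval_plug volE mulr1 => d0; rewrite d0 eqxx in nzP.
Qed.

(** theta^i is the inner product with the vector w_i = A^{ij} U_j of UU, so that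
    the Hodge dual of their exterior product is the contraction of vol with w_0, w_1
    and w_2. *)
Lemma hodge_theta (theta : 'I_3 -> 'Hom(V, R^o)) :
  (forall i j, theta i (tnth U j) = (i == j)%:R) ->
  (forall i v, v \in Uperp -> theta i v = 0) ->
  @hodge R V 3 4 g vol
    (form_of (theta 0) \wedge form_of (theta 1) \wedge form_of (theta 2) : kform V 3)
  = (\det A)^-1 *: nu.
Proof.
move=> thetaU thetaperp.
pose w (i : 'I_3) := \sum_j invmx A i j *: tnth U j.
have thetaE i x : theta i x = g (w i) x.
  have wU j : g (w i) (tnth U j) = (i == j)%:R.
    rewrite dot_suml; transitivity ((invmx A *m A) i j); last by rewrite mulVmx // mxE.
    by rewrite mxE; apply: eq_bigr => l _; rewrite [in RHS]mxE.
  have [y yU xy] := orthogonal_decomposition x.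
  rewrite -(subrKC y x) dotDr.
  have -> : theta i (y + (x - y)) = theta i y.
    by rewrite [LHS]linearD [X in _ + X]thetaperp // [LHS]addr0.
  have -> : g (w i) (x - y) = 0.
    rewrite dotC; move/mem_orthovE: xy; apply.
    apply: memv_suml => j _; apply/memvZ/(basis_mem basisU); exact: mem_tnth.
  rewrite addr0 (basisE yU) linear_sum /= dotC dot_suml; apply: eq_bigr => j _.
  by rewrite linearZ /= thetaU dotC wU.
have [b [szb adb coordE _]] := adapted_frame dimV G2phi metric.
have [onb _] := adapted_orthonormal G2phi metric szb adb.
set th := _ \wedge _ \wedge _.
have f2 := is_form_wedge (is_form_of (theta 0)) (is_form_of (theta 1)).
have formth : is_form (th : kform V 3) := is_form_wedge f2 (is_form_of (theta 2)).
apply/funext => v.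
rewrite (hodge_decomposable (h := fun a : 'I_7 => b`_a) (k := 3) (l := 4) (w := w)) //.
- have := congr1 (fun f : kform V 4 => f v) (@plug_det _ _ 3 4 _ (invmx A) U formvol).
  by rewrite det_inv => <-.
- by move=> a a'; rewrite onb.
- move=> u; rewrite -feval_tuple tuple3E (feval_wedge f2 (is_form_of _)) //=.
  rewrite !(feval_wedge (is_form_of _) (is_form_of _)) //= !feval_of det3 !mxE !thetaE.
  by ring.
Qed.

Lemma volUperpE (theta : 'I_3 -> 'Hom(V, R^o)) :
  (forall i j, theta i (tnth U j) = (i == j)%:R) ->
  (forall i v, v \in Uperp -> theta i v = 0) ->
  (\det A `^ (1 / 2)) *: @hodge R V 3 4 g vol
    (form_of (theta 0) \wedge form_of (theta 1) \wedge form_of (theta 2) : kform V 3)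
  = (Num.sqrt (\det A))^-1 *: nu.
Proof.
move=> thetaU thetaperp; rewrite hodge_theta // scalerA; congr (_ *: _).
rewrite mul1r powR12_sqrt ?ltW // -[in X in _ / X](sqr_sqrtr (ltW detA_gt0)).
by field; rewrite gt_eqF // sqrtr_gt0.
Qed.

End Final.

Theorem lemma2p4 (R : realType) (V : vectType R) (phi : kform V 3)
    (g : {dot V for @idfun R}) (vol : kform V 7) (UU : {vspace V}) :
  \dim {:V} = 7%N -> G2_structure phi -> G2_metric phi g vol ->
  \dim UU = 3%N -> ~ isotropic phi UU ->
  let psi : kform V 4 := @hodge R V 3 4 g vol phi in
  let Uperp := orthov g UU in
  (forall (U : 3.-tuple V) (theta : 'I_3 -> 'Hom(V, R^o)),
    basis_of UU U ->
    (forall i j, theta i (tnth U j) = (i == j)%:R) ->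
    (forall i v, v \in Uperp -> theta i v = 0) ->
    let c : R := phi U in
    let A := gram g U in
    let K := kerU phi U in
    let om := omega phi U in
    let tom := tomega phi psi U in
    let theta123 : kform V 3 :=
      form_of (theta 0) \wedge form_of (theta 1) \wedge form_of (theta 2) in
    let volUperp : kform V 4 :=
      (\det A `^ (1 / 2)) *: @hodge R V 3 4 g vol theta123 in
    [/\ c != 0,
        phi = phi_term1 phi U + phi_term2 phi U + Omega phi U &
        psi = psi_term1 phi psi U + psi_term2 phi psi U
              + psi_term3 phi psi U + barOmega phi psi U] /\
    [/\ horizontal UU (beta psi U),
        forall k, horizontal UU (om k),
        forall k, horizontal UU (tom k),
        horizontal UU (Omega phi U) &
        horizontal UU (barOmega phi psi U)] /\
    [/\ forall i j, (om i \wedge om j : kform V 4) =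
          (2 * c * (\det A `^ (5 / 6)) * (A i j / (\det A `^ (1 / 3))))
            *: volUperp,
        forall i j, (tom i \wedge tom j : kform V 4) =
          (2 * c * (\det A `^ (7 / 6))
             * (invmx A i j / (\det A `^ (- (1 / 3))))) *: volUperp,
        definite_triple_on Uperp om &
        definite_triple_on Uperp tom] /\
    [/\ horizontal UU volUperp,
        volume_form_on g Uperp volUperp &
        (* orientation of Uperp: U followed by an oriented basis of Uperp is
           an oriented basis of V *)
        forall E : 4.-tuple V, {subset E <= Uperp} ->
          0 < vol [tuple of U ++ E] -> 0 < volUperp E] /\
    definite_triple_on K om /\ definite_triple_on K tom) /\
  (forall U U' : 3.-tuple V, basis_of UU U -> basis_of UU U' ->
    [/\ phi_term1 phi U = phi_term1 phi U',
        phi_term2 phi U = phi_term2 phi U' &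
        Omega phi U = Omega phi U'] /\
    [/\ psi_term1 phi psi U = psi_term1 phi psi U',
        psi_term2 phi psi U = psi_term2 phi psi U',
        psi_term3 phi psi U = psi_term3 phi psi U' &
        barOmega phi psi U = barOmega phi psi U']).
Proof.
move=> dimV G2phi metric dimU noniso psi Uperp.
have formphi := G2_is_form G2phi.
have formvol : is_form vol by have [[]] := metric.
have formpsi : is_form psi by apply: is_form_hodge.
split; last first.
  move=> U U' basisU basisU'.
  have [P nzP ->] := basis_change basisU basisU'.
  by rewrite phi_term1_change // phi_term2_change // Omega_change //
    psi_term1_change // psi_term2_change // psi_term3_change // barOmega_change.
move=> U theta basisU thetaU thetaperp c A K om tom theta123 volUperp.
have nz_c : c != 0 := phi_basis_neq0 G2phi basisU noniso.
pose nu : kform V 4 := plug U vol.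
have detA_gt0 : 0 < \det A := det_gram_gt0 dimV G2phi metric dimU noniso basisU.
have nz_r : Num.sqrt (\det A) != 0 by rewrite gt_eqF // sqrtr_gt0.
have volE : volUperp = (Num.sqrt (\det A))^-1 *: nu.
  exact: (volUperpE dimV G2phi metric dimU noniso basisU thetaU thetaperp).
have formnu : is_form nu by apply: is_form_plug.
have hornu : horizontal UU nu by apply: (horizontal_plug basisU (m := 3)).
have nznu : nu != 0 := nu_neq0 dimV G2phi metric dimU noniso basisU.
have scE (a : R) (M : 'M[R]_3) i j : (a *: M) i j = a * M i j by rewrite mxE.
have omE i j : (om i \wedge om j : kform V 4) = (2 * (c *: A) i j) *: nu.
  by rewrite (wedge_omega dimV G2phi metric dimU noniso basisU) scE mulrA.
have tomE i j : (tom i \wedge tom j : kform V 4) =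
    (2 * ((c * \det A) *: invmx A) i j) *: nu.
  by rewrite (wedge_tomega dimV G2phi metric dimU noniso basisU) scE !mulrA.
have posA : posdefmx A := posdef_gram g basisU.
have unitA : A \in unitmx by rewrite unitmxE unitfE gt_eqF.
have symA : A^T = A by apply/matrixP => i j; rewrite !mxE dotC.
have defA : definitemx (c *: A) by apply: definite_scale.
have defAi : definitemx ((c * \det A) *: invmx A).
  apply: definite_scale; first by rewrite mulf_neq0 // gt_eqF.
  exact: posdef_inv.
have sumperp := sum_orthogonal dimV G2phi metric dimU noniso basisU.
have dimperp := dim_orthogonal dimV G2phi metric dimU noniso basisU.
have sumK := sum_kerU G2phi noniso basisU.
have dimK := dim_kerU dimV G2phi dimU noniso basisU.
split; last split; last split; last split.
- split=> //; first by rewrite addrC subrK.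
  by rewrite addrC subrK.
- split.
  + exact: (horizontal_beta metric basisU).
  + exact: (horizontal_omega G2phi basisU).
  + exact: (horizontal_tomega G2phi metric basisU).
  + exact: (horizontal_Omega G2phi noniso basisU).
  + exact: (horizontal_barOmega dimV G2phi metric dimU noniso basisU).
- have pD r s : \det A `^ (r + s) = \det A `^ r * \det A `^ s.
    by apply: powRD; rewrite (gt_eqF detA_gt0) implybT.
  split.
  + move=> i j; rewrite omE volE scalerA scE; congr (_ *: _).
    have -> : \det A `^ (5 / 6) = Num.sqrt (\det A) * \det A `^ (1 / 3).
      by rewrite -powR12_sqrt ?ltW // -pD; congr (_ `^ _); field.
    have nz3 : \det A `^ (1 / 3) != 0 by rewrite gt_eqF // powR_gt0.
    by field; rewrite nz_r.
  + move=> i j; rewrite tomE volE scalerA scE; congr (_ *: _).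
    have -> : \det A `^ (7 / 6) = Num.sqrt (\det A) * \det A * \det A `^ (- (1 / 3)).
      have -> : 7 / 6 = 2^-1 + 1 + - (1 / 3) :> R by field.
      by rewrite !pD powRr1 ?powR12_sqrt // ltW.
    have nz3 : \det A `^ (- (1 / 3)) != 0 by rewrite gt_eqF // powR_gt0.
    by field; rewrite nz_r.
  + exact: (definite_on_complement basisU formnu hornu nznu sumperp dimperp omE defA).
  + exact: (definite_on_complement basisU formnu hornu nznu sumperp dimperp tomE defAi).
- split.
  + move=> u uU; rewrite volE; apply: kform_ext => s szs.
    by rewrite feval_interior fevalZ_form -feval_interior hornu // feval0_form mulr0.
  + split=> //; first by rewrite volE; apply: is_formZ.
    move=> E subE onE; rewrite volE -[(_ *: nu) E]/(_ * nu E) normrM.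
    rewrite (nu_orthonormal dimV G2phi metric dimU noniso basisU subE onE).
    by rewrite ger0_norm ?invr_ge0 ?sqrtr_ge0 // mulVf.
  + move=> E subE volUE; rewrite volE.
    by rewrite -[(_ *: nu) E]/(_ * nu E) mulr_gt0 // invr_gt0 sqrtr_gt0.
- split.
  + exact: (definite_on_complement basisU formnu hornu nznu sumK dimK omE defA).
  + exact: (definite_on_complement basisU formnu hornu nznu sumK dimK tomE defAi).
Qed.
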